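(* Let $T$ be a torus of rank $l\ge 1$ and let $U$ and $V$ be finite-dimensional complex $T$-modules with $U^T=0$, $V^T=0$ and $\dim_{\mathbb C} U>\dim_{\mathbb C} V$. Let $\varphi:U\to\mathbb R$ be a continuous $T$-map (that is, a continuous $T$-invariant function) such that $\varphi(0)<0$ and $\varphi(x)>0$ for $\|x\|$ sufficiently large. If $f:U\to V$ is a continuous $T$-equivariant map, then the intersection $\{x\in U\mid f(x)=0\}\cap\{x\in U\mid\varphi(x)=0\}$ has covering dimension greater than or equal to $2(\dim_{\mathbb C}U-\dim_{\mathbb C}V)-1$.
   Context: $U^T$, $V^T$ denote the fixed subspaces. $U$ is equipped with a $T$-invariant Euclidean norm $\|\cdot\|$, and $T$ acts trivially on $\mathbb R$. Covering dimension is Lebesgue covering dimension. *)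

(* Defs.v *)
From HB Require Import structures.
From mathcomp Require Import all_boot all_order all_algebra.
From mathcomp Require Import complex.
From mathcomp Require Import all_classical all_reals all_analysis.

Set Implicit Arguments.
Unset Strict Implicit.
Unset Printing Implicit Defensive.

Import Order.TTheory GRing.Theory Num.Theory.
Import numFieldNormedType.Exports.

Local Open Scope classical_set_scope.
Local Open Scope ring_scope.
Local Open Scope complex_scope.
Local Open Scope card_scope.

(* The alias ^o is where the metric topology of the complex numbers lives. *)
Notation CC R := ((complex R)^o).

(* Lebesgue covering dimension, in the form dim X < k: every finite open cover
   has an open refinement in which each point lies in at most k members. Thus
   k is one more than the usual bound on the dimension, and dim X < 0 holds
   exactly when X is empty (dim of the empty space is -1). *)
Definition covering_dim_lt (X : topologicalType) (k : nat) : Prop :=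
  forall A : set (set X),
    finite_set A -> A `<=` open -> cover A id = setT ->
    exists B : set (set X),
      [/\ B `<=` open,
          cover B id = setT,
          forall W, B W -> exists2 W', A W' & W `<=` W'
        & forall x, B `&` [set W | W x] #<= `I_k].

Definition covering_dim_ge (X : topologicalType) (k : nat) : Prop :=
  ~ covering_dim_lt X k.

Section TorusModules.
Variable R : realType.

(* The group (S^1)^l, under entrywise multiplication. *)
Definition torus (l : nat) : set 'rV[CC R]_l :=
  [set t | forall j, `|t ord0 j| = 1].

Definition torus_mul (l : nat) (s t : 'rV[CC R]_l) : 'rV[CC R]_l :=
  map2_mx *%R s t.

(* A complex T-module of dimension n, in coordinates: a continuous homomorphism
   from T to GL_n(C), acting on column vectors. Values of rho off the torus are
   irrelevant; invertibility on the torus follows from the two equations. *)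
Definition torus_rep (l n : nat) (rho : 'rV[CC R]_l -> 'M[CC R]_n) : Prop :=
  [/\ rho (const_mx 1) = 1%:M,
      forall s t, torus s -> torus t ->
        rho (torus_mul s t) = rho s *m rho t
    & {within @torus l, continuous rho}].

Definition fixed_subspace (l n : nat) (rho : 'rV[CC R]_l -> 'M[CC R]_n) :
    set 'cV[CC R]_n :=
  [set x | forall t, torus t -> rho t *m x = x].

(* Inner products on the underlying real vector space of C^n; real parts of
   Hermitian inner products are the special case invariant under 'i. *)
Definition real_inner_product (n : nat)
    (dot : 'cV[CC R]_n -> 'cV[CC R]_n -> R) : Prop :=
  [/\ forall x y, dot x y = dot y x,
      forall x y z, dot (x + y) z = dot x z + dot y z,
      forall (a : R) x y, dot (a%:C *: x) y = a * dot x y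
    & forall x, x != 0 -> 0 < dot x x].

Definition euclidean_norm (n : nat) (N : 'cV[CC R]_n -> R) : Prop :=
  exists2 dot, real_inner_product dot & forall x, N x = Num.sqrt (dot x x).

Definition torus_invariant (l n : nat) (rho : 'rV[CC R]_l -> 'M[CC R]_n)
    (g : 'cV[CC R]_n -> R) : Prop :=
  forall t x, torus t -> g (rho t *m x) = g x.

Definition torus_equivariant (l n m : nat) (rhoU : 'rV[CC R]_l -> 'M[CC R]_n)
    (rhoV : 'rV[CC R]_l -> 'M[CC R]_m)
    (f : 'cV[CC R]_n -> 'cV[CC R]_m) : Prop :=
  forall t x, torus t -> f (rhoU t *m x) = rhoV t *m f x.

End TorusModules.

(* Main.v *)
(* Choose a large prime p and an element t of order p in T whose powers are so dense in T
   that t fixes no nonzero vector of U or V. In eigencoordinates of t, suitable powers of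
   the coordinates of f are m complex functions on which t acts as multiplication by one
   fixed primitive p-th root of unity, that is, of weight one. Put dim U = n + 1 and let Z be the
   common zero set of f and phi. It is compact, and t acts freely on it.

   If dim Z < 2(n - m) + 1, a general position argument yields n - m + 1 further functions
   of weight one such that, at each point of Z, one of the first n - m does not vanish or
   the last one is strictly closest in direction to one of the p-th roots of unity. Cut the
   plane into the p open sectors around these roots. As p is odd, a nonzero z lies in an
   open sector, or i z does. Therefore the set {phi = 0} is covered by 2n + 1 levels of
   open sets, each level being a disjoint union of p sets permuted cyclically by t.

   Such a cover cannot exist, because {phi = 0} separates 0 from infinity in a space of
   real dimension 2n + 2. This is a cochain computation over the field with p elements.
   Inside a fine subdivision of the cone with apex 0 over a large sphere, which is a join
   of 2n + 2 orbits of t, the sector labels map the part near {phi = 0} to the standard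
   resolution of Z/p. Pulling back cocycles that lift the unit class gives the value
   (-1)^q in every degree q <= 2n + 1. But there are only 2n + 1 levels, so that any chain
   of 2n + 2 labels repeats one, and the last coboundary vanishes by normalization. *)
Require Import Defs.
From HB Require Import structures.
From mathcomp Require Import all_boot all_order all_algebra.
From mathcomp Require Import complex finmap.
From mathcomp Require Import all_classical all_reals all_analysis.
From mathcomp Require Import ring lra zify.

Set Implicit Arguments.
Unset Strict Implicit.
Unset Printing Implicit Defensive.

Import Order.TTheory GRing.Theory Num.Theory.
Import numFieldNormedType.Exports.

Local Open Scope ring_scope.

(** * Ordered cochains and flags *)

(** The number 2(n - m) + 1 counts the real equations of a bad point of Z: n - m complex functions
    vanish, and one real linear form records a tie between two roots of unity. General position
    removes such points when dim Z is smaller. On {phi = 0} outside Z some coordinate of f is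
    nonzero and supplies a sector. Each function that may vanish needs two levels, for itself and
    for its multiple by i, while the last function needs only one; hence 2m + 2(n - m) + 1 levels.

    The obstacle on the cochain side is that the cone has no global labelling: t fixes the apex 0,
    where every weight one function vanishes. Cochains on labels can therefore not be pulled back to
    the whole cone. The remedy is to evaluate only on flags whose labelled faces are followed by
    exactly one face of level N, the level of the inner region {phi < 0}. This acts like a
    connecting homomorphism and shifts degrees by one: in degree 0 the single unlabelled vertex 0
    already gives the value 1, while on the outer sphere, which misses level N, everything
    vanishes. *)

Section OrderedCochains.
Variable F : comNzRingType.

(** The ordered simplicial coboundary in augmented form: unfolding gives the alternating sum over
    deleted entries, and the empty sequence is the simplex of degree -1. Recursion on the first
    vertex makes the identities below short inductions. *)
Fixpoint cobd (V : Type) (w : seq V -> F) (s : seq V) : F :=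
  if s is v :: s' then w s' - cobd (fun u => w (v :: u)) s' else 0.

Lemma cobd_cons (V : Type) (w : seq V -> F) (v : V) (s : seq V) :
  cobd w (v :: s) = w s - cobd (fun u => w (v :: u)) s.
Proof. by []. Qed.

Lemma eq_cobd (V : Type) (w w' : seq V -> F) (s : seq V) :
  (forall u, size u = (size s).-1 -> w u = w' u) -> cobd w s = cobd w' s.
Proof.
elim: s w w' => //= v s IH w w' e; rewrite e //; congr (_ - _).
case: s IH e => // v' s IH e; apply: IH => u su; apply: e => /=.
by rewrite su.
Qed.

Lemma cobdB (V : Type) (w w' : seq V -> F) (s : seq V) :
  cobd (fun u => w u - w' u) s = cobd w s - cobd w' s.
Proof. by elim: s w w' => [|v s IH] w w' /=; rewrite ?IH; ring. Qed.

Lemma cobd0 (V : Type) (s : seq V) : cobd (fun _ => 0) s = 0.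
Proof. by elim: s => //= v s ->; rewrite subr0. Qed.

Lemma cobd_sum (V I : Type) (r : seq I) (w : I -> seq V -> F) (s : seq V) :
  cobd (fun u => \sum_(i <- r) w i u) s = \sum_(i <- r) cobd (w i) s.
Proof.
elim: s w => [|v s IH] w /=; first by rewrite big1.
by rewrite IH -sumrB.
Qed.

Lemma cobd_cobd (V : Type) (w : seq V -> F) (s : seq V) : cobd (cobd w) s = 0.
Proof.
elim: s w => //= v s IH w.
by rewrite cobdB IH subr0 subrr.
Qed.

Lemma cobd_map (V U : Type) (f : V -> U) (w : seq U -> F) (s : seq V) :
  cobd w (map f s) = cobd (fun u => w (map f u)) s.
Proof. by elim: s w => //= v s IH w; rewrite IH. Qed.

Fixpoint faces (V : Type) (s : seq V) : seq (F * seq V) :=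
  if s is v :: s' then (1, s') :: [seq (- t.1, v :: t.2) | t <- faces s']
  else [::].

Lemma sum_faces (V : Type) (w : seq V -> F) (s : seq V) :
  \sum_(t <- faces s) t.1 * w t.2 = cobd w s.
Proof.
elim: s w => [|v s IH] w /=; first by rewrite big_nil.
rewrite big_cons mul1r big_map -IH -sumrN; congr (_ + _).
by apply: eq_bigr => t _; rewrite mulNr.
Qed.

Lemma mem_faces (V : eqType) (s : seq V) (t : F * seq V) : t \in faces s ->
  {subset t.2 <= s} /\ size s = (size t.2).+1.
Proof.
elim: s t => //= v s IH t; rewrite inE => /orP[/eqP->|/mapP[t' /IH[h1 h2] ->]] /=.
  by split=> // x; rewrite inE orbC => ->.
split; last by rewrite h2.
by move=> x; rewrite !inE => /orP[->//|/h1->]; rewrite orbT.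
Qed.

Definition ev (V : Type) (w : seq V -> F) (c : seq (F * seq V)) : F :=
  \sum_(t <- c) t.1 * w t.2.

(** Barycentric subdivision as a signed list of complete flags, largest face first, with products of
    incidence signs. For n = size s a flag ends at a single vertex, so the empty face is never
    listed. *)
Fixpoint flags_rec (V : Type) (n : nat) (s : seq V) : seq (F * seq (seq V)) :=
  if n is n'.+1 then
    [seq (t.1 * u.1, s :: u.2) | t <- faces s, u <- flags_rec n' t.2]
  else [:: (1, [::])].

Definition flag_cochain (V : Type) (w : seq (seq V) -> F) (s : seq V) : F :=
  ev w (flags_rec (size s) s).

Lemma flag_cochain_nil (V : Type) (w : seq (seq V) -> F) : flag_cochain w [::] = w [::].
Proof. by rewrite /flag_cochain /ev /= big_seq1 mul1r. Qed.

Lemma flag_cochain_cons (V : eqType) (w : seq (seq V) -> F) (v : V) (s : seq V) :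
  flag_cochain w (v :: s) =
  cobd (flag_cochain (fun u => w ((v :: s) :: u))) (v :: s).
Proof.
rewrite -sum_faces [LHS]big_allpairs_dep.
rewrite big_seq [RHS]big_seq; apply: eq_bigr => t /mem_faces[_ [st]].
rewrite /flag_cochain /ev -st mulr_sumr; apply: eq_bigr => u _ /=.
by rewrite mulrA.
Qed.

(** By [flag_cochain_cons] the subdivision of a simplex is a cone over its subdivided boundary. The
    boundary of this cone is its base, as wanted, minus the cone over the boundary of a cycle, which
    is zero. *)
Lemma flag_cochain_cobd (V : eqType) (w : seq (seq V) -> F) (s : seq V) :
  flag_cochain (cobd w) s = cobd (flag_cochain w) s.
Proof.
elim: {s}(size s).+1 {-2}s (ltnSn (size s)) w => // n IH [|v s] sn w.
  by rewrite flag_cochain_nil.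
rewrite flag_cochain_cons.
transitivity (cobd (fun u => flag_cochain w u
  - cobd (flag_cochain (fun u => w ((v :: s) :: u))) u) (v :: s)).
  apply: eq_cobd => u su; rewrite -IH; last by rewrite su.
  rewrite /flag_cochain /ev -sumrB; apply: eq_bigr => t _ /=.
  by rewrite mulrBr.
by rewrite cobdB cobd_cobd subr0.
Qed.

Lemma flag_cochain_map (V U : eqType) (f : V -> U) (w : seq (seq U) -> F) (s : seq V) :
  flag_cochain w (map f s) = flag_cochain (fun u => w (map (map f) u)) s.
Proof.
elim: {s}(size s).+1 {-2}s (ltnSn (size s)) w => // n IH [|v s] sn w.
  by rewrite !flag_cochain_nil.
rewrite [map f _]/= !flag_cochain_cons -map_cons cobd_map.
by apply: eq_cobd => u su; rewrite IH // su.
Qed.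

(** Sequences may repeat entries, so containment does not bound the length and the size is bounded
    separately. These flags need not be complete. *)
Fixpoint is_flag (V : eqType) (s : seq V) (fl : seq (seq V)) : Prop :=
  if fl is x :: fl'
  then [/\ x != [::], {subset x <= s}, (size x <= size s)%N & is_flag x fl'] else True.

Lemma is_flag_sub (V : eqType) (s s' : seq V) fl :
  {subset s <= s'} -> (size s <= size s')%N -> is_flag s fl -> is_flag s' fl.
Proof.
case: fl => //= x fl h hs [? h' hs' ?]; split=> //; last exact: leq_trans hs.
by move=> y /h'/h.
Qed.

Lemma eq_flag_cochain (V : eqType) (w w' : seq (seq V) -> F) (s : seq V) :
  (forall fl, is_flag s fl -> size fl = size s -> w fl = w' fl) ->
  flag_cochain w s = flag_cochain w' s.
Proof.
elim: {s}(size s).+1 {-2}s (ltnSn (size s)) w w' => // n IH [|v s] sn w w' e.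
  by rewrite !flag_cochain_nil e.
rewrite !flag_cochain_cons -!sum_faces big_seq [RHS]big_seq.
apply: eq_bigr => t /mem_faces[ts [st]]; congr (_ * _).
apply: IH; first by rewrite -st.
move=> fl ft sfl; apply: e; last by rewrite /= sfl st.
by split=> //; apply: is_flag_sub ft => //=; rewrite st.
Qed.

Lemma sub_flag_cochain (V : eqType) (w w' : seq (seq V) -> F) (s : seq V) :
  flag_cochain (fun fl => w fl - w' fl) s = flag_cochain w s - flag_cochain w' s.
Proof. by rewrite /flag_cochain /ev -sumrB; apply: eq_bigr => t _; rewrite mulrBr. Qed.

Lemma sum_flag_cochain (V : eqType) (I : Type) (r : seq I) (w : I -> seq (seq V) -> F) (s : seq V) :
  flag_cochain (fun fl => \sum_(i <- r) w i fl) s = \sum_(i <- r) flag_cochain (w i) s.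
Proof.
rewrite /flag_cochain /ev exchange_big /=; apply: eq_bigr => t _.
by rewrite mulr_sumr.
Qed.

End OrderedCochains.

(** * The periodic resolution of Z/p *)

Lemma sum_cyclic_shift (V : nmodType) p (f : nat -> V) : f p = f 0%N ->
  \sum_(j < p) f j.+1 = \sum_(j < p) f j.
Proof.
case: p f => [|k] f e; first by rewrite !big_ord0.
by rewrite big_ord_recr [RHS]big_ord_recl /= e addrC.
Qed.

Section PeriodicResolution.
Variables (p : nat).
Hypothesis p_pr : prime p.
Local Notation F := 'F_p.

(* Transposes of the differentials of the periodic free resolution of Z/p:
   g - 1 in odd degrees and the norm 1 + g + ... + g^(p-1) in positive even
   degrees; the identity in degree 0 makes the recursions start uniformly. *)
Definition resol_op (V : Type) (g : V -> V) (q : nat) (w : seq V -> F) (s : seq V) : F :=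
  if q == 0%N then w s else
  if odd q then w (map g s) - w s
  else \sum_(j < p) w (map (iter j g) s).

Lemma resol_op_odd (V : Type) (g : V -> V) q w s : odd q ->
  resol_op g q w s = w (map g s) - w s.
Proof. by rewrite /resol_op; case: q => //= q ->. Qed.

Lemma resol_op_even (V : Type) (g : V -> V) q w s : odd q ->
  resol_op g q.+1 w s = \sum_(j < p) w (map (iter j g) s).
Proof. by rewrite /resol_op /= => ->. Qed.

Lemma pF0 : p%:R = 0 :> F.
Proof. by apply: pcharf0; apply: pchar_Fp. Qed.

Lemma resol_op_cobd (V : Type) (g : V -> V) q (w : seq V -> F) s :
  resol_op g q (cobd w) s = cobd (resol_op g q w) s.
Proof.
rewrite /resol_op; case: eqP => // _; case: odd.
  by rewrite cobd_map cobdB.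
by rewrite cobd_sum; apply: eq_bigr => j _; rewrite cobd_map.
Qed.

Lemma resol_op_comp (V : Type) (g : V -> V) q (w : seq V -> F) s :
  (forall x, iter p g x = x) -> (0 < q)%N ->
  resol_op g q (resol_op g q.+1 w) s = 0.
Proof.
move=> gp; rewrite /resol_op /=; case: q => //= q _.
have mapit j u : map (iter j g) (map g u) = map (iter j.+1 g) u.
  by rewrite -map_comp; apply: eq_map => x /=; rewrite -iterSr.
have mapp u : map (iter p g) u = u.
  by rewrite -[RHS]map_id; apply: eq_map => x; apply: gp.
have map0 u : map (iter 0 g) u = u by rewrite -[RHS]map_id; apply: eq_map.
case: odd => /=.
  rewrite sumrB; apply/eqP; rewrite subr_eq0; apply/eqP.
  under eq_bigr do rewrite -map_comp.
  have := @sum_cyclic_shift F p (fun j => w (map (iter j g) s)); apply.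
  by rewrite mapp map0.
apply/eqP; rewrite subr_eq0; apply/eqP.
under eq_bigr do rewrite mapit.
have := @sum_cyclic_shift F p (fun j => w (map (iter j g) s)); apply.
by rewrite mapp map0.
Qed.

Definition shift (a : F) (s : seq F) : seq F := map (fun x => x + a) s.

Lemma iter_add1 j (x : F) : iter j (fun x => x + 1) x = x + j%:R.
Proof. by elim: j => [|j IH]; rewrite ?addr0 //= IH -natr1 addrA. Qed.

(* Cochains on Z/p lifting the unit along the resolution: the coboundary of each is the
   image of the next one under [resol_op] (see [resol_cochainP]). *)
Fixpoint resol_cochain (q : nat) (s : seq F) : F :=
  if q is q'.+1 then
    if odd q'.+1
    then \sum_(j < val (head 0 s)) cobd (resol_cochain q') (shift (j%:R - head 0 s) s)
    else (head 0 s == 0)%:R * cobd (resol_cochain q') s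
  else (nilp s)%:R.

Lemma shiftD a b s : shift a (shift b s) = shift (b + a) s.
Proof. by rewrite /shift -map_comp; apply: eq_map => x /=; rewrite addrA. Qed.

Lemma shift0 s : shift 0 s = s.
Proof. by rewrite /shift -[RHS]map_id; apply: eq_map => x; rewrite addr0. Qed.

Lemma map_iter_add1 j s : map (iter j (fun x : F => x + 1)) s = shift j%:R s.
Proof. by apply: eq_map => x; rewrite iter_add1. Qed.

Lemma val_natFp (j : nat) : (j < p)%N -> val (j%:R : F) = j.
Proof. by move=> jp; rewrite /= val_Fp_nat ?modn_small. Qed.

Lemma natFp_val (a : F) : (val a)%:R = a.
Proof. exact: natr_Zp. Qed.

Lemma Fp_val_lt (a : F) : (val a < p)%N.
Proof. by have := ltn_ord a; rewrite [X in (_ < X)%N -> _]Fp_cast. Qed.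

Lemma resol_cochain_odd q a s : ~~ odd q ->
  resol_cochain q.+1 (a :: s) =
  \sum_(j < val a) cobd (resol_cochain q) (shift (j%:R - a) (a :: s)).
Proof. by move=> /= ->. Qed.

Lemma resol_cochain_even q a s : odd q ->
  resol_cochain q.+1 (a :: s) = (a == 0)%:R * cobd (resol_cochain q) (a :: s).
Proof. by move=> /= ->. Qed.

(** By induction the coboundary c of the previous cochain is killed by the preceding operator. If
    its norm vanishes, partial sums along an orbit, started at head 0, solve the equation for g - 1.
    If c is invariant, it is the norm of its restriction to sequences with head 0. *)
Lemma resol_cochainP q s : size s = q.+1 ->
  resol_op (fun x => x + 1) q.+1 (resol_cochain q.+1) s = cobd (resol_cochain q) s.
Proof.
elim: q s => [|q IH] s ss.
  have sm (c : F) : resol_cochain 1 [:: c] = c.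
    by rewrite resol_cochain_odd // [LHS]/= subr0 sumr_const card_ord natFp_val.
  case: s ss => // a [] // _; rewrite /resol_op [LHS]/(resol_cochain 1 [:: a + 1] - resol_cochain 1 [:: a]).
  have e1 (b : F) : b + 1 - b = 1 - 0 by rewrite addrAC subrr add0r subr0.
  by rewrite !sm; apply: e1.
set c := cobd (resol_cochain q.+1).
have inv u : size u = q.+2 -> resol_op (fun x => x + 1) q.+1 c u = 0.
  move=> su; rewrite resol_op_cobd; apply: etrans (cobd_cobd (resol_cochain q) u).
  by apply: eq_cobd => t st; rewrite IH // st su.
case: s ss => // a s' ss; set s := a :: s' in ss *.
have ssh b : size (shift b s) = q.+2 by rewrite size_map.
have [od|od] := boolP (odd q).
  pose f (j : nat) := c (shift (j%:R - a) s).
  have f0 : \sum_(j < p) f j = 0.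
    rewrite -[RHS](inv _ (ssh (- a))) resol_op_even //.
    by apply: eq_bigr => j _; rewrite map_iter_add1 shiftD addrC.
  have fa : f (val a) = c s by rewrite /f natFp_val subrr shift0.
  have e0 : resol_cochain q.+2 s = \sum_(j < val a) f j.
    by rewrite resol_cochain_odd //= od.
  have e1 : resol_cochain q.+2 (map (fun x => x + 1) s) = \sum_(j < val (a + 1)) f j.
    rewrite -[map _ _]/((a + 1) :: shift 1 s') resol_cochain_odd; last by rewrite /= od.
    apply: eq_bigr => j _; rewrite -[_ :: _]/(shift 1 s) shiftD /f.
    by rewrite -/c; congr (c (shift _ _)); ring.
  rewrite resol_op_odd; last by rewrite /= od.
  rewrite e0 e1 -fa.
  (* If a = p - 1, the shifted head is 0 and its partial sum is empty; the identity is then the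
     vanishing [f0] of the full orbit sum. *)
  have := Fp_val_lt a; rewrite leq_eqVlt => /orP[/eqP ap|ap].
    have gen k r : k.+1 = r -> \sum_(j < r) f j = \sum_(j < k) f j + f k.
      by move=> <-; rewrite big_ord_recr.
    have -> : a + 1 = 0 by rewrite -(natFp_val a) natr1 ap pF0.
    rewrite big_ord0 sub0r; apply/eqP; rewrite eqr_oppLR -addr_eq0.
    by rewrite -(gen _ _ ap) f0.
  have -> : val (a + 1) = (val a).+1 by rewrite -[X in X + 1]natFp_val natr1 val_natFp.
  by rewrite big_ord_recr /= addrAC subrr add0r.
have c1 u : size u = q.+2 -> c (shift 1 u) = c u.
  move=> su; have /eqP := inv _ su; rewrite resol_op_odd //.
  by rewrite subr_eq0 => /eqP.
have cj j : c (shift j%:R s) = c s.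
  elim: j => [|j IHj]; first by rewrite shift0.
  by rewrite -natr1 -shiftD c1.
rewrite resol_op_even //.
have e1 j : resol_cochain q.+2 (map (iter j (fun x => x + 1)) s) = (a + j%:R == 0)%:R * c s.
  rewrite -(cj j) -map_iter_add1.
  rewrite -[map _ s]/((iter j (fun x => x + 1) a) :: map (iter j (fun x => x + 1)) s').
  by rewrite resol_cochain_even // iter_add1.
under eq_bigr do rewrite e1.
rewrite (bigD1 (Ordinal (Fp_val_lt (- a)))) //= big1 => [|j jne].
  by rewrite -[X in (a + X)]/((val (- a))%:R) natFp_val subrr eqxx mul1r addr0.
case: eqP => [aj|]; last by rewrite mul0r.
case/eqP: jne; apply: val_inj; rewrite -[LHS](val_natFp (ltn_ord j)).
suff -> : (nat_of_ord j)%:R = - a by [].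
by rewrite -[LHS](addKr a) aj addr0.
Qed.

End PeriodicResolution.

(** * Cochains sliced by level *)

Section Stutter.
Variable F : comNzRingType.

Fixpoint stutter (V : eqType) (s : seq V) : bool :=
  if s is v :: s' then (ohead s' == Some v) || stutter s' else false.

Definition normalized (V : eqType) (w : seq V -> F) := forall s, stutter s -> w s = 0.

(** The two faces that drop one of two equal neighbours cancel, and every other face still
    stutters. *)
Lemma normalized_cobd (V : eqType) (w : seq V -> F) : normalized w -> normalized (cobd w).
Proof.
move=> nw s; elim: s w nw => // v s IH w nw /= /orP[|st]; last first.
  rewrite nw // sub0r IH ?oppr0 // => u su.
  by apply: nw; rewrite /= su orbT.
case: s IH => // v' s IH /= /eqP[->].
have e u : w (v :: v :: u) = 0 by apply: nw; rewrite /= eqxx.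
rewrite opprB addrC subrK -[RHS](cobd0 F s).
exact: eq_cobd.
Qed.

End Stutter.

Lemma stutter_map (V U : eqType) (f : V -> U) (s : seq V) : stutter s -> stutter (map f s).
Proof.
elim: s => //= v s IH /orP[|/IH->]; last by rewrite orbT.
by case: s {IH} => //= v' s /eqP[->]; rewrite eqxx.
Qed.

Lemma normalized_resol_cochain p q : normalized (@resol_cochain p q).
Proof.
elim: q => [|q IH] s; first by case: s.
move=> ss; have h b : cobd (resol_cochain q) (shift b s) = 0.
  by apply: (normalized_cobd IH); apply: stutter_map.
case: s ss h => // a s ss h; have [od|od] := boolP (odd q).
  by rewrite resol_cochain_even // -[a :: s]shift0 h mulr0.
by rewrite resol_cochain_odd // big1.
Qed.

Section SlicedCochain.
Variables (p : nat) (E : zmodType) (lev : E -> nat) (grp : E -> 'F_p) (N : nat).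

(** Labelling faces through their lowest vertex makes levels weakly rise along a flag, since flags
    list larger faces first. *)
Definition lowest (x : seq E) : E :=
  foldr (fun b c => if (lev b < lev c)%N then b else c) (head 0 x) x.

Lemma lowest_in x : x != [::] -> lowest x \in x.
Proof.
move=> x0; rewrite /lowest; have : head 0 x \in x by case: x x0 => //= a s _; rewrite inE eqxx.
move: (head 0 x) => a; elim: x {x0} => //= b x IH; rewrite inE => ax.
case: ifP => _; first by rewrite inE eqxx.
case/orP: ax => [/eqP->|/IH ax]; last by rewrite inE ax orbT.
elim: (x) => /= [|c y IHy]; first by rewrite inE eqxx.
by case: ifP => _; rewrite !inE ?eqxx ?orbT //; move: IHy; rewrite !inE => /orP[->|->]; rewrite ?orbT.
Qed.

Lemma lowest_le x b : b \in x -> (lev (lowest x) <= lev b)%N.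
Proof.
rewrite /lowest; elim: x (head 0 x) => //= c x IH a; rewrite inE => /orP[/eqP->|bx].
  by case: ltnP.
have := IH a bx; case: ltnP => // h1 h2; exact: leq_trans (ltnW h1) h2.
Qed.

Local Notation lvl x := (lev (lowest x)).

(* The value of W on the group labels of the lowest vertices of a flag, whose last
   face must be the first one to have lowest level N. *)
Definition sliced (W : seq 'F_p -> 'F_p) (fl : seq (seq E)) : 'F_p :=
  if fl is x :: s then
    if (lvl (last x s) == N) && all (fun y => lvl y < N)%N (belast x s)
    then W (map (fun y => grp (lowest y)) (belast x s)) else 0
  else 0.

Lemma sliced_cons W x y s : sliced W (x :: y :: s) =
  if (lvl x < N)%N then sliced (fun u => W (grp (lowest x) :: u)) (y :: s) else 0.
Proof. by rewrite /sliced /=; case: (lvl x < N)%N; rewrite ?andbF. Qed.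

Lemma slicedB (W W' : seq 'F_p -> 'F_p) fl :
  sliced (fun u => W u - W' u) fl = sliced W fl - sliced W' fl.
Proof. by case: fl => [|x s] /=; [rewrite subr0 | case: ifP => _; rewrite ?subr0]. Qed.

(** No small simplex may join the inner region, of level N, to the outer one, of level above N. *)
Definition unmixed (s : seq E) := forall a b, a \in s -> b \in s -> lev a = N -> (lev b <= N)%N.

Lemma unmixed_sub s s' : {subset s' <= s} -> unmixed s -> unmixed s'.
Proof. by move=> h u a b /h ha /h hb; apply: u. Qed.

(** Levels rise along the flag, so the only terms not accounted for by [cobd W] come from flags
    ending in two faces of level at least N. Dropping one or the other gives opposite signs, and
    [unmixed] makes both levels equal to N or neither, so these terms cancel. *)
Lemma cobd_sliced s W fl : unmixed s -> is_flag s fl ->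
  cobd (sliced W) fl = sliced (cobd W) fl.
Proof.
elim: fl s W => // x fl IH s W us [x0 xs _ ff].
have {IH} IH := IH x _ (unmixed_sub xs us) ff.
rewrite cobd_cons; case: (ltnP (lvl x) N) => lx.
  have -> : cobd (fun u => sliced W (x :: u)) fl =
            cobd (sliced (fun u => W (grp (lowest x) :: u))) fl.
    apply: eq_cobd => u _; case: u => [|y u].
      by rewrite /= eqn_leq [(N <= _)%N]leqNgt lx /= andbF.
    by rewrite sliced_cons lx.
  rewrite IH -slicedB; case: fl {IH ff} => [|y fl].
    by rewrite /= [lvl x == N]eqn_leq [(N <= _)%N]leqNgt lx andbF.
  by rewrite sliced_cons lx.
have lxs y u : sliced W (x :: y :: u) = 0 by rewrite sliced_cons ltnNge lx.
case: fl ff {IH} => [|y fl] ff; first by rewrite /= subr0; case: ifP.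
rewrite [RHS]sliced_cons [(lvl x < N)%N]ltnNge lx.
case: ff => y0 yx _ ff; have lxy : (lvl x <= lvl y)%N by apply/lowest_le/yx/lowest_in.
case: fl ff => [|z fl] ff.
  rewrite /= !andbT subr0; suff -> : (lvl y == N) = (lvl x == N) by rewrite subrr.
  apply/eqP/eqP => h; first by apply/eqP; rewrite eqn_leq lx -h lxy.
  apply/eqP; rewrite eqn_leq (leq_trans lx lxy) andbT.
  by apply: (us _ _ _ _ h); [apply/xs/lowest_in | apply/xs/yx/lowest_in].
rewrite sliced_cons ltnNge (leq_trans lx lxy) sub0r -[RHS]oppr0; congr (- _).
rewrite -[RHS](cobd0 'F_p [:: y, z & fl]); apply: eq_cobd => -[|y' u] // _.
Qed.

Definition coherent (s : seq E) :=
  forall a b, a \in s -> b \in s -> lev a = lev b -> (lev a < N)%N -> grp a = grp b.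

(** Two consecutive faces of equal level below N carry the same group label by coherence. Without a
    stutter the levels thus rise strictly, which leaves room for at most N faces. *)
Lemma flag_level_bound s x fl : coherent s -> is_flag s (x :: fl) ->
  all (fun y => lvl y < N)%N (x :: fl) ->
  ~~ stutter (map (fun y => grp (lowest y)) (x :: fl)) -> (lvl x + size fl < N)%N.
Proof.
elim: fl s x => [|y fl IH] s x cs [x0 xs _ ff]; first by rewrite /= addn0 andbT.
move=> /= /andP[lx ly]; rewrite negb_or => /andP[gxy ns].
have cx : coherent x by move=> a b /xs ax /xs bx; apply: cs.
have := IH x y cx ff ly ns; suff lxy : (lvl x < lvl y)%N.
  by apply: leq_ltn_trans; rewrite addnS -addSn leq_add2r.
case: ff => y0 yx _ _; have := lowest_le (yx _ (lowest_in y0)); rewrite leq_eqVlt => /orP[/eqP e|//].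
case/eqP: gxy; congr Some; apply/esym/cx => //; first exact: lowest_in.
exact/yx/lowest_in.
Qed.

Lemma is_flag_belast s (x : seq E) fl : is_flag s (x :: fl) -> is_flag s (belast x fl).
Proof.
elim: fl s x => [|y fl IH] s x // [x0 xs sx ff].
by split=> //; apply: IH.
Qed.

Lemma sliced_degenerate W s fl : coherent s -> is_flag s fl ->
  normalized W -> size fl = N.+2 -> sliced W fl = 0.
Proof.
case: fl => //= x fl cs ff nW [sf]; case: ifP => // /andP[_ al].
have {}ff := is_flag_belast ff.
apply: nW; have : size (belast x fl) = N.+1 by rewrite size_belast.
case: (belast x fl) al ff => // y u al ff [su]; apply: contraT => ns.
by have := flag_level_bound cs ff al ns; rewrite su ltnNge leq_addl.
Qed.

Lemma lowest_map (f : E -> E) x : f 0 = 0 -> (forall b, b \in x -> lev (f b) = lev b) ->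
  lowest (map f x) = f (lowest x).
Proof.
move=> f0 fl; rewrite /lowest; have -> : head 0 (map f x) = f (head 0 x) by case: x {fl} => /=.
have : lev (f (head 0 x)) = lev (head 0 x) by case: x fl => [|a x] fl; rewrite /= ?f0 ?fl ?inE ?eqxx.
move: (head 0 x) => a; elim: x fl => //= b x IH fl fa.
rewrite IH //; last by move=> c cx; apply: fl; rewrite inE cx orbT.
rewrite fl ?inE ?eqxx //; set c := foldr _ _ _.
suff -> : lev (f c) = lev c by case: ifP.
rewrite /c; elim: (x) fl => //= y z IHz fl; case: ifP => _.
  by apply: fl; rewrite !inE eqxx orbT.
by apply: IHz => t; rewrite inE => /orP[/eqP->|tz]; apply: fl; rewrite !inE ?eqxx ?tz ?orbT.
Qed.

Lemma sliced_map (f : E -> E) (g : 'F_p -> 'F_p) W (fl : seq (seq E)) : f 0 = 0 ->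
  (forall x b, x \in fl -> b \in x -> lev (f b) = lev b) ->
  (forall x b, x \in fl -> b \in x -> (lev b < N)%N -> grp (f b) = g (grp b)) ->
  (forall x, x \in fl -> x != [::]) ->
  sliced W (map (map f) fl) = sliced (fun u => W (map g u)) fl.
Proof.
move=> f0 fl0 fg fn; case: fl fl0 fg fn => //= x s fl fg fn.
have lw y : y \in x :: s -> lowest (map f y) = f (lowest y).
  by move=> ys; rewrite lowest_map ?f0 // => b; apply: fl.
have ll y : y \in x :: s -> lvl (map f y) = lvl y.
  by move=> ys; rewrite lw // (fl y) //; apply/lowest_in/fn.
rewrite last_map ll ?mem_last // belast_map all_map.
have bs : {subset belast x s <= x :: s} by move=> y; apply: mem_belast.
rewrite (@eq_in_all _ _ (fun y => lvl y < N)%N); last by move=> y /bs ys /=; rewrite ll.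
case: ifP => // /andP[_ /allP al]; congr W; rewrite -!map_comp.
by apply/eq_in_map => y ys /=; rewrite lw ?(fg y) //; [exact: bs | exact/lowest_in/fn/bs | exact: al | exact: bs].
Qed.

End SlicedCochain.

(** * Barycentric subdivision *)

Section Barycentric.
Variables (K : numFieldType) (E : lmodType K) (R : archiRealFieldType) (nr : E -> R).
Hypothesis nrD : forall x y, nr (x + y) <= nr x + nr y.
Hypothesis nrN : forall x, nr (- x) = nr x.
Hypothesis nr0 : nr 0 = 0.
Hypothesis nrV : forall k x, nr ((k.+1)%:R^-1 *: x) = (k.+1)%:R^-1 * nr x.

Definition bary (s : seq E) : E := (size s)%:R^-1 *: \sum_(x <- s) x.

(** Convexity, restricted to the only averages that subdivision forms. *)
Definition bary_closed (C : E -> Prop) :=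
  forall s, s != [::] -> (forall x, x \in s -> C x) -> C (bary s).

Lemma nr_sum (s : seq E) (f : E -> E) : nr (\sum_(x <- s) f x) <= \sum_(x <- s) nr (f x).
Proof.
elim: s => [|x s IH]; first by rewrite !big_nil nr0.
by rewrite !big_cons; apply: le_trans (nrD _ _) _; rewrite lerD2l.
Qed.

Lemma bary_sub (s : seq E) a : s != [::] ->
  bary s - a = (size s)%:R^-1 *: \sum_(x <- s) (x - a).
Proof.
move=> s0; rewrite sumrB scalerBr big_const_seq count_predT iter_addr_0 -(scaler_nat (size s) a).
by rewrite scalerA mulVf ?scale1r // pnatr_eq0 size_eq0.
Qed.

Lemma bary_map (f : {linear E -> E}) s : bary (map f s) = f (bary s).
Proof. by rewrite /bary size_map big_map linearZ_LR (linear_sum f). Qed.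

Lemma bary_closed_ball a r : bary_closed (fun x => nr (x - a) <= r).
Proof.
move=> s s0 h; rewrite bary_sub //; case: s s0 h => // x s _ h.
rewrite nrV ler_pdivrMl ?ltr0n //; apply: le_trans (nr_sum _ _) _.
apply: le_trans (_ : _ <= \sum_(y <- x :: s) r) _.
  by rewrite big_seq [leRHS]big_seq; apply: ler_sum => y /h.
by rewrite big_const_seq count_predT iter_addr_0 mulr_natl.
Qed.

Lemma bary_closedI C C' : bary_closed C -> bary_closed C' -> bary_closed (fun x => C x /\ C' x).
Proof. by move=> h h' s s0 hs; split; [apply: h | apply: h'] => // x /hs[]. Qed.

Definition fine (C : E -> Prop) M D (s : seq E) :=
  [/\ (size s <= M.+1)%N, forall x, x \in s -> C x &
      forall x y, x \in s -> y \in s -> nr (x - y) <= D].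

(** The vertex v contributes 0 to the average of the differences y - v, so one term fewer than size
    s remains. This is the source of the contraction factor. *)
Lemma fine_vertex C M D (s : seq E) v : fine C M D s -> s != [::] -> v \in s ->
  nr (bary s - v) <= M%:R / M.+1%:R * D.
Proof.
move=> [sM _ sD] s0 vs; have D0 : 0 <= D by have := sD v v vs vs; rewrite subrr nr0.
rewrite bary_sub //; case: s s0 sM vs sD => // x s _ sM vs sD.
rewrite nrV; apply: le_trans (_ : _ <= (size s)%:R / (size s).+1%:R * D) _; last first.
  apply: ler_wpM2r => //; rewrite ler_pdivrMr ?ltr0n // mulrAC ler_pdivlMr ?ltr0n //.
  by rewrite -!natrM ler_nat; rewrite /= in sM; nia.
rewrite mulrAC -[_ * D / _]mulrC; apply: ler_wpM2l; first by rewrite invr_ge0 ler0n.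
have -> : \sum_(y <- x :: s) (y - v) = \sum_(y <- rem v (x :: s)) (y - v).
  by rewrite (big_rem v vs) /= subrr add0r.
apply: le_trans (nr_sum _ _) _.
apply: le_trans (_ : _ <= \sum_(y <- rem v (x :: s)) D) _.
  by rewrite big_seq [leRHS]big_seq; apply: ler_sum => y /mem_rem ys; apply: sD.
by rewrite big_const_seq count_predT iter_addr_0 mulr_natl size_rem.
Qed.

Lemma fine_subdivision C M D (s : seq E) fl : bary_closed C -> fine C M D s ->
  is_flag s fl -> size fl = size s -> fine C M (M%:R / M.+1%:R * D) (map bary fl).
Proof.
move=> bC fs ff sfl; have [sM sC _] := fs; rewrite /fine size_map sfl; split=> //.
  move=> _ /mapP[x xf ->]; have {xf}[x0 xs] : x != [::] /\ {subset x <= s}.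
    elim: fl s ff xf {fs sfl sM sC} => // y fl IH s [y0 ys _ ff].
    rewrite inE => /orP[/eqP->//|xf]; have [? h] := IH _ ff xf.
    by split=> // z /h/ys.
  by apply: bC => // z /xs/sC.
move=> {sfl sM sC}; elim: fl s fs ff => // x fl IH s fs [x0 xs sx ff].
have fx : fine C M D x.
  have [sM sC sD] := fs; split; first exact: leq_trans sM.
    by move=> z /xs/sC.
  by move=> z t /xs zs /xs; apply: sD.
have D0 : 0 <= M%:R / M.+1%:R * D.
  case: x x0 fx {xs sx ff} => // a x _ [_ _ /(_ a a)].
  rewrite inE eqxx subrr nr0 => /(_ isT isT) D0.
  by rewrite mulr_ge0 // divr_ge0.
have cmp y : y \in fl -> nr (bary x - bary y) <= M%:R / M.+1%:R * D.
  move=> yf; have {yf}[y0 yx] : y != [::] /\ {subset y <= x}.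
    elim: fl x ff yf {fs fx IH x0 xs sx D0} => // y' fl IH x [y0 ys _ ff].
    rewrite inE => /orP[/eqP->//|yf]; have [? h] := IH _ ff yf.
    by split=> // z /h/ys.
  (* A ball around [bary x] that contains the vertices of x also contains the barycentre of the
     smaller face y. *)
  rewrite -nrN opprB; apply: bary_closed_ball => // v /yx vx.
  by rewrite -nrN opprB; apply: fine_vertex fx _ vx.
move=> _ _ /mapP[y yf ->] /mapP[z zf ->]; move: yf zf; rewrite !inE.
case/orP=> [/eqP->|yf] /orP[/eqP->|zf]; first by rewrite subrr nr0.
- exact: cmp.
- by rewrite -nrN opprB; apply: cmp.
by apply: (IH x) => //; apply: map_f.
Qed.

Section Subdivide.
Variable F : comNzRingType.

Definition subdiv (w : seq E -> F) (s : seq E) : F :=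
  flag_cochain (fun fl => w (map bary fl)) s.

Lemma subdiv_cobd w s : subdiv (cobd w) s = cobd (subdiv w) s.
Proof.
rewrite -flag_cochain_cobd; apply: eq_flag_cochain => fl _ _.
by rewrite -cobd_map.
Qed.

Lemma iter_subdiv_cobd r w s : iter r subdiv (cobd w) s = cobd (iter r subdiv w) s.
Proof.
elim: r s => //= r IH s; rewrite -subdiv_cobd; apply: eq_flag_cochain => fl _ _.
exact: IH.
Qed.

Lemma subdiv_map (f : {linear E -> E}) w s :
  subdiv w (map f s) = subdiv (fun u => w (map f u)) s.
Proof.
rewrite /subdiv flag_cochain_map; apply: eq_flag_cochain => fl _ _.
by rewrite -!map_comp; congr w; apply: eq_map => x /=; rewrite bary_map.
Qed.

(** Locality: all rules for labels hold only on small simplices inside C, and they enter the cochain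
    computation through this lemma. *)
Lemma eq_iter_subdiv C M r D w w' s : bary_closed C ->
  (forall u, fine C M ((M%:R / M.+1%:R) ^+ r * D) u -> size u = size s -> w u = w' u) ->
  fine C M D s -> iter r subdiv w s = iter r subdiv w' s.
Proof.
move=> bC; elim: r D w w' s => [|r IH] D w w' s e fs.
  by apply: e => //; rewrite expr0 mul1r.
apply: eq_flag_cochain => fl ff sfl; apply: (IH (M%:R / M.+1%:R * D)).
  move=> u fu su; apply: e; last by rewrite su size_map sfl.
    by rewrite exprSr -[_ * _ * D]mulrA.
exact: fine_subdivision ff sfl.
Qed.

Lemma iter_subdiv_map (f : {linear E -> E}) r w s :
  iter r subdiv w (map f s) = iter r subdiv (fun u => w (map f u)) s.
Proof.
elim: r w s => //= r IH w s; rewrite subdiv_map; apply: eq_flag_cochain => fl _ _.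
exact: IH.
Qed.

End Subdivide.

Lemma fine_scale_lt M (D eps : R) : 0 < eps -> exists r, (M%:R / M.+1%:R) ^+ r * D < eps.
Proof.
move=> e0; case: (posnP M) => [->|M0].
  by exists 1%N; rewrite mul0r expr1 mul0r.
pose r := Num.bound (D * M%:R / eps); exists r.
have rb : D * M%:R / eps < r%:R.
  case: (leP 0 (D * M%:R / eps)) => h; first exact: archi_boundP.
  exact: lt_le_trans h (ler0n _ _).
have Mp : 0 < M%:R :> R by rewrite ltr0n.
(* Bernoulli's inequality for the inverse factor 1 + 1/M. *)
have bern : 1 + r%:R / M%:R <= (M.+1%:R / M%:R) ^+ r :> R.
  have -> : M.+1%:R / M%:R = 1 + M%:R^-1 :> R by rewrite -natr1 mulrDl divff ?gt_eqF // mul1r.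
  elim: (r) => [|k IH]; first by rewrite mul0r addr0 expr0.
  rewrite exprS; apply: le_trans (ler_wpM2l _ IH); last first.
    by rewrite addr_ge0 // invr_ge0 ltW.
  rewrite -natr1 mulrDl mul1r mulrDl !mul1r mulrDr mulr1.
  have : 0 <= (M%:R^-1 * (k%:R / M%:R) : R) by rewrite mulr_ge0 ?divr_ge0 ?invr_ge0 // ltW.
  lra.
have q0 : 0 < (M.+1%:R / M%:R) ^+ r :> R by rewrite exprn_gt0 // divr_gt0 ?ltr0n.
have -> : (M%:R / M.+1%:R) ^+ r = ((M.+1%:R / M%:R) ^+ r)^-1 :> R.
  by rewrite -exprVn invf_div.
rewrite ltr_pdivrMl //; apply: lt_le_trans (_ : (1 + r%:R / M%:R) * eps <= _); last by rewrite ler_pM2r.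
apply: lt_trans (_ : r%:R / M%:R * eps < _); last by rewrite ltr_pM2r // ltrDr.
by move: rb; rewrite ltr_pdivrMr // mulrAC ltr_pdivlMr.
Qed.

End Barycentric.

(** * The cochain obstruction *)

Section NoLabelling.
Variables (p : nat) (p_pr : prime p).
Variables (K : numFieldType) (E : lmodType K) (R : archiRealFieldType) (nr : E -> R).
Hypothesis nrD : forall x y, nr (x + y) <= nr x + nr y.
Hypothesis nrN : forall x, nr (- x) = nr x.
Hypothesis nr0 : nr 0 = 0.
Hypothesis nrV : forall k x, nr ((k.+1)%:R^-1 *: x) = (k.+1)%:R^-1 * nr x.
Variables (act : {linear E -> E}) (lev : E -> nat) (grp : E -> 'F_p) (N : nat).
Hypothesis actp : forall x, iter p act x = x.
Variables (v : nat -> E) (C : E -> Prop) (eps B : R).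
Hypothesis eps0 : 0 < eps.
Hypothesis C_closed : bary_closed C.
Hypothesis C_act : forall x, C x -> C (act x).
Hypothesis C_bounded : forall x, C x -> nr x <= B.
Hypothesis C0 : C 0.
Hypothesis Cv : forall q, (q <= N)%N -> C (v q).
Hypothesis lev_act : forall x, C x -> lev (act x) = lev x.
Hypothesis grp_act : forall x, C x -> (lev x < N)%N -> grp (act x) = grp x + 1.
Hypothesis grp_near : forall x y, C x -> C y -> nr (x - y) < eps ->
  lev x = lev y -> (lev x < N)%N -> grp x = grp y.
Hypothesis lev_near : forall x y, C x -> C y -> nr (x - y) < eps ->
  lev x = N -> (lev y <= N)%N.
Hypothesis lev0 : lev 0 = N.
(** In the application levels below N are sectors, N is the region well inside {phi < 0}, and C' is
    a half-space away from 0. It contains the simplex spanned by arbitrary translates of the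
    vertices, hence every simplex of its subdivisions. *)
Hypothesis lev_far : forall t : nat -> nat, exists C' : E -> Prop,
  [/\ bary_closed C', forall q, (q <= N)%N -> C' (iter (t q) act (v q)) &
      forall x, C x -> C' x -> lev x <> N].

Local Notation F := 'F_p.
Local Notation T q := (@resol_op p E act q).

(* [sphere q] evaluates a cochain on the (q-1)-chain h_q of the sphere given by
   h_0 = [::] and h_(q+1) = v_q * (d_q h_q); [ball q] evaluates it on the cone 0 * h_q. *)
Fixpoint sphere (q : nat) (w : seq E -> F) : F :=
  if q is q'.+1 then sphere q' (T q' (fun s => w (v q' :: s))) else w [::].

Definition ball (q : nat) (w : seq E -> F) : F := sphere q (fun s => w (0 :: s)).

Definition sphere_simplex q (s : seq E) :=
  exists t : nat -> nat, s = [seq iter (t i) act (v i) | i <- rev (iota 0 q)].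

Lemma sphere_simplex_map q j s : sphere_simplex q s -> sphere_simplex q (map (iter j act) s).
Proof.
case=> t ->; exists (fun i => j + t i)%N; rewrite -map_comp.
by apply: eq_map => i /=; rewrite iterD.
Qed.

Lemma sphere_simplex_cons q s : sphere_simplex q s -> sphere_simplex q.+1 (v q :: s).
Proof.
case=> t ->; exists (fun i => if i == q then 0%N else t i).
rewrite -addn1 iotaD rev_cat /= add0n eqxx; congr (_ :: _).
apply/eq_in_map => i; rewrite mem_rev mem_iota add0n => /andP[_ iq].
by rewrite ltn_eqF.
Qed.

Lemma eq_resol_op_simplex q q' w w' s : sphere_simplex q s ->
  (forall u, sphere_simplex q u -> w u = w' u) -> T q' w s = T q' w' s.
Proof.
move=> ss e; rewrite /resol_op !e //; last by apply: (sphere_simplex_map 1).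
case: eqP => // _; case: odd => //; apply: eq_bigr => j _.
by rewrite e //; apply: sphere_simplex_map.
Qed.

Lemma eq_sphere q w w' : (forall s, sphere_simplex q s -> w s = w' s) ->
  sphere q w = sphere q w'.
Proof.
elim: q w w' => [|q IH] w w' e /=; first by apply: e; exists (fun=> 0%N).
apply: IH => s ss; apply: (eq_resol_op_simplex _ ss) => u su.
exact/e/sphere_simplex_cons.
Qed.

Lemma sphereB q w w' : sphere q (fun s => w s - w' s) = sphere q w - sphere q w'.
Proof.
elim: q w w' => //= q IH w w'; rewrite -IH; apply: eq_sphere => s _.
rewrite /resol_op; case: eqP => // _; case: odd; last by rewrite sumrB.
ring.
Qed.

Lemma sphere0 q : sphere q (fun=> 0) = 0.
Proof.
have := sphereB q (fun=> 0) (fun=> 0); rewrite [RHS]subrr => h.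
by rewrite -[RHS]h; apply: eq_sphere => s _; rewrite subrr.
Qed.

(** In terms of chains, the boundary of h_(q+1) is T_q h_q: the join formula leaves T_q h_q minus
    the join of v_q with T_q T_(q-1) h_(q-1), and consecutive operators compose to zero. *)
Lemma sphere_cobd q w : sphere q.+1 (cobd w) = sphere q (T q w).
Proof.
elim: q w => [|q IH] w; first by rewrite /= /resol_op /= subr0.
have -> : sphere q.+2 (cobd w) =
    sphere q.+1 (T q.+1 w) - sphere q.+1 (cobd (T q.+1 (fun s => w (v q.+1 :: s)))).
  rewrite -sphereB -[LHS]/(sphere q.+1 (T q.+1 (fun s => cobd w (v q.+1 :: s)))).
  apply: eq_sphere => s _.
  rewrite -resol_op_cobd /resol_op /=; case: ifP => _; last by rewrite -sumrB.
  ring.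
rewrite IH; suff -> : sphere q (T q (T q.+1 (fun s => w (v q.+1 :: s)))) = 0 by rewrite subr0.
rewrite -[RHS](sphere0 q); apply: eq_sphere => s ss.
(* For q = 0 the operator T_0 is the identity, and the composite vanishes because g - 1 kills the
   empty simplex. *)
case: q ss {IH} => [|q] ss; last by apply: resol_op_comp.
by case: ss => t ->; rewrite /resol_op /= subrr.
Qed.

(** The action fixes the apex 0, so the operators commute with coning. *)
Lemma ball_cobd q w : ball q.+1 (cobd w) = sphere q.+1 w - ball q (T q w).
Proof.
rewrite /ball [LHS](sphereB q.+1 w (cobd (fun s => w (0 :: s)))) sphere_cobd.
congr (_ - _); apply: eq_sphere => s _.
have e j : iter j act 0 = 0 by elim: j => //= j ->; rewrite raddf0.
rewrite /resol_op /= linear0; case: ifP => // _; case: ifP => // _.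
by apply: eq_bigr => j _; rewrite e.
Qed.

Local Notation M := N.+1.

Lemma simplex_fine q s : (q <= N.+1)%N -> sphere_simplex q s ->
  fine nr C M (B + B) (0 :: s).
Proof.
move=> qN [t ->]; have sC x : x \in 0 :: [seq iter (t i) act (v i) | i <- rev (iota 0 q)] -> C x.
  rewrite inE => /orP[/eqP->//|/mapP[i0]]; rewrite mem_rev mem_iota /= add0n => iq ->.
  elim: (t i0) => [|j IH] /=; last exact: C_act.
  by apply: Cv; rewrite -ltnS (leq_trans iq).
split=> //=; first by rewrite size_map size_rev size_iota ltnS.
move=> x y /sC/C_bounded xB /sC/C_bounded yB.
by apply: le_trans (nrD _ _) _; rewrite nrN lerD.
Qed.

Definition slice q : seq (seq E) -> F := sliced lev grp N (@resol_cochain p q).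

Variable r : nat.
Hypothesis r_small : (M%:R / M.+1%:R) ^+ r * (B + B) < eps.

(** Labels belong to faces, so the last of r + 1 subdivisions stays combinatorial: r geometric ones
    make the simplices small, and [flag_cochain] then evaluates on their flags. *)
Definition fine_flag (w : seq (seq E) -> F) : seq E -> F := iter r (@subdiv K E F) (flag_cochain w).

Lemma fine_flag_cobd w s : fine_flag (cobd w) s = cobd (fine_flag w) s.
Proof.
rewrite /fine_flag -iter_subdiv_cobd; elim: (r) s => [|r' IH] s /=; first exact: flag_cochain_cobd.
by apply: eq_flag_cochain => fl _ _; apply: IH.
Qed.

Lemma eq_fine_flag (C' : E -> Prop) w w' s : bary_closed C' -> (forall x, C' x -> C x) ->
  (forall u fl, (forall x, x \in u -> C' x) ->
     (forall x y, x \in u -> y \in u -> nr (x - y) < eps) ->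
     is_flag u fl -> size fl = size s -> w fl = w' fl) ->
  fine nr C' M (B + B) s -> fine_flag w s = fine_flag w' s.
Proof.
move=> bC CC e fs; apply: (eq_iter_subdiv nrD nrN nr0 nrV bC _ fs).
move=> u [_ uC uD] su; apply: eq_flag_cochain => fl ff sfl; apply: (e u) => //.
  by move=> x y xu yu; apply: le_lt_trans (uD _ _ xu yu) r_small.
by rewrite sfl.
Qed.

Lemma fine_flag0 s : fine_flag (fun=> 0) s = 0.
Proof.
rewrite /fine_flag; elim: (r) s => [|r' IH] s /=.
  by rewrite /flag_cochain /ev big1 // => t _; rewrite mulr0.
by rewrite /subdiv /flag_cochain /ev big1 // => t _; rewrite IH mulr0.
Qed.

Lemma fine_flag_map (f : {linear E -> E}) w s :
  fine_flag w (map f s) = fine_flag (fun fl => w (map (map f) fl)) s.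
Proof.
rewrite /fine_flag iter_subdiv_map; elim: (r) s => [|r' IH] s /=; first exact: flag_cochain_map.
by apply: eq_flag_cochain => fl _ _; apply: IH.
Qed.

Lemma eq_fine_flag_all w w' s : w =1 w' -> fine_flag w s = fine_flag w' s.
Proof.
move=> e; rewrite /fine_flag; elim: (r) s => [|r' IH] s /=.
  by apply: eq_flag_cochain => fl _ _.
by apply: eq_flag_cochain => fl _ _; apply: IH.
Qed.

Lemma fine_flag_iter_map j w s :
  fine_flag w (map (iter j act) s) = fine_flag (fun fl => w (map (map (iter j act)) fl)) s.
Proof.
have it0 (V : Type) (f : V -> V) (x : seq V) : f =1 id -> map f x = x.
  by move=> e; rewrite (eq_map e) map_id.
elim: j w => [|j IH] w.
  by rewrite it0 //; apply: eq_fine_flag_all => fl; rewrite it0 // => x; rewrite it0.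
rewrite (eq_map (_ : iter j.+1 act =1 act \o iter j act)) // map_comp fine_flag_map IH.
apply: eq_fine_flag_all => fl; rewrite -map_comp; congr w; apply: eq_map => x /=.
by rewrite -map_comp.
Qed.

Lemma fine_flag_sum (I : Type) (l : seq I) (w : I -> seq (seq E) -> F) s :
  fine_flag (fun fl => \sum_(i <- l) w i fl) s = \sum_(i <- l) fine_flag (w i) s.
Proof.
rewrite /fine_flag; elim: (r) s => [|r' IH] s /=; first exact: sum_flag_cochain.
by rewrite -sum_flag_cochain; apply: eq_flag_cochain => fl _ _; apply: IH.
Qed.

Lemma fine_flagB w w' s :
  fine_flag (fun fl => w fl - w' fl) s = fine_flag w s - fine_flag w' s.
Proof.
rewrite /fine_flag; elim: (r) s => [|r' IH] s /=; first exact: sub_flag_cochain.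
by rewrite -sub_flag_cochain; apply: eq_flag_cochain => fl _ _; apply: IH.
Qed.

Lemma fine_flag_resol q w s : fine_flag (@resol_op p _ (map act) q w) s = T q (fine_flag w) s.
Proof.
rewrite /resol_op; case: eqP => // _; case: odd; first by rewrite fine_flagB fine_flag_map.
rewrite fine_flag_sum; apply: eq_bigr => j _; rewrite fine_flag_iter_map.
apply: eq_fine_flag_all => fl; congr w; apply: eq_map => x.
by elim: (nat_of_ord j) => [|i /= ->]; rewrite ?map_id // -map_comp.
Qed.

Lemma flag_sub (u : seq E) fl x : is_flag u fl -> x \in fl -> x != [::] /\ {subset x <= u}.
Proof.
elim: fl u => // y fl IH u [y0 yu _ ff]; rewrite inE => /orP[/eqP->//|/(IH _ ff)[? xy]].
by split=> // b /xy/yu.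
Qed.

(** A flag contributes only if its last face has level N, which [lev_far] excludes on the subdivided
    sphere. *)
Lemma slice_sphere q : (q <= N)%N -> sphere q.+1 (fine_flag (slice q)) = 0.
Proof.
move=> qN; rewrite -(sphere0 q.+1); apply: eq_sphere => s [t st].
have [C' [bC' C'v C'N]] := lev_far t.
have [sM sC sD] : fine nr C M (B + B) s.
  have [|sM sC sD] := @simplex_fine q.+1 s qN; first by exists t.
  split=> [|x xs|x y xs ys]; first exact: leq_trans sM.
    by apply: sC; rewrite inE xs orbT.
  by apply: sD; rewrite inE ?xs ?ys orbT.
rewrite -(fine_flag0 s); apply: (@eq_fine_flag (fun x => C x /\ C' x)).
- exact: bary_closedI.
- by move=> x [].
- move=> u fl uC _ ff _; case: fl ff => // x fl ff; rewrite /slice /sliced; case: ifP => // /andP[/eqP h _].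
  have [y0 yu] := flag_sub ff (mem_last x fl).
  by have [h1 h2] := uC _ (yu _ (lowest_in lev y0)); case: (C'N _ h1 h2).
split=> // x xs; split; first exact: sC.
move: xs; rewrite st => /mapP[i0]; rewrite mem_rev mem_iota add0n => /andP[_ iq] ->.
by apply: C'v; rewrite -ltnS (leq_trans iq).
Qed.

Lemma near_flag u : (forall x, x \in u -> C x) ->
  (forall x y, x \in u -> y \in u -> nr (x - y) < eps) -> unmixed lev N u /\ coherent lev grp N u.
Proof.
move=> uC ud; split=> a b au bu.
  by apply: lev_near; [exact: uC | exact: uC | exact: ud].
by apply: grp_near; [exact: uC | exact: uC | exact: ud].
Qed.

Lemma sliced_eq_size W W' n fl : size fl = n.+1 -> (forall u, size u = n -> W u = W' u) ->
  sliced lev grp N W fl = sliced lev grp N W' fl.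
Proof.
case: fl => //= x fl [sf] e; case: ifP => // _; apply: e.
by rewrite size_map size_belast.
Qed.

Lemma lev_iter j x : C x -> lev (iter j act x) = lev x /\ C (iter j act x).
Proof. by move=> Cx; elim: j => //= j [e c]; rewrite lev_act //; split=> //; apply: C_act. Qed.

Lemma grp_iter j x : C x -> (lev x < N)%N -> grp (iter j act x) = iter j (fun a => a + 1) (grp x).
Proof.
move=> Cx lx; elim: j => //= j <-; have [e c] := lev_iter j Cx.
by apply: grp_act; rewrite ?e.
Qed.

(** On small simplices [cobd] passes inside [sliced], where [resol_cochainP] trades it for the next
    cochain. Equivariance of the labels then moves the operator from labels to points. *)
Lemma slice_ball q : (q <= N)%N ->
  ball q.+1 (fine_flag (cobd (slice q))) = ball q.+1 (T q.+1 (fine_flag (slice q.+1))).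
Proof.
move=> qN; apply: eq_sphere => s ss; have fs := @simplex_fine q.+1 s qN ss.
transitivity (fine_flag (resol_op (map act) q.+1 (slice q.+1)) (0 :: s)).
  apply: (eq_fine_flag C_closed) fs => // u fl uC ud ff sfl.
  have [um _] := near_flag uC ud; rewrite (cobd_sliced grp _ um ff).
  rewrite (@sliced_eq_size _ (resol_op (fun a => a + 1) q.+1 (@resol_cochain p q.+1)) q.+1); last 2 first.
    by rewrite sfl /=; case: ss => t ->; rewrite size_map size_rev size_iota.
  - by move=> u' su'; rewrite resol_cochainP.
  have fn x : x \in fl -> x != [::] /\ {subset x <= u} by apply: flag_sub.
  have mapj j : sliced lev grp N (@resol_cochain p q.+1) (map (iter j (map act)) fl) =
      sliced lev grp N (fun u => resol_cochain q.+1 (map (iter j (fun a => a + 1)) u)) fl.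
    rewrite (eq_map (_ : iter j (map act) =1 map (iter j act))); last first.
      by move=> x; elim: j => [|i /= ->]; rewrite ?map_id // -map_comp.
    apply: sliced_map; first by elim: j => //= j ->; rewrite linear0.
    - by move=> x b /fn[_ xu] /xu bu; have [] := lev_iter j (uC _ bu).
    - by move=> x b /fn[_ xu] /xu bu; apply/grp_iter/uC.
    by move=> x /fn[].
  rewrite /resol_op -[q.+1 == 0%N]/false; case: (odd q.+1).
    by rewrite slicedB; congr (_ - _); apply/esym/(mapj 1%N).
  rewrite [RHS](eq_bigr _ (fun (j : 'I_p) _ => mapj j)).
  by case: (fl) => [|x l] /=; [rewrite big1 | case: ifP => // _; rewrite big1].
by rewrite fine_flag_resol.
Qed.

Lemma slice_top : ball N.+1 (fine_flag (cobd (slice N))) = 0.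
Proof.
rewrite /ball -(sphere0 N.+1); apply: eq_sphere => s ss; have fs := @simplex_fine N.+1 s (leqnn _) ss.
rewrite -(fine_flag0 (0 :: s)); apply: (eq_fine_flag C_closed) fs => // u fl uC ud ff sfl.
have [um co] := near_flag uC ud; rewrite (cobd_sliced grp _ um ff).
apply: (sliced_degenerate co ff); last first.
  by rewrite sfl /=; case: ss => t ->; rewrite size_map size_rev size_iota.
exact/normalized_cobd/normalized_resol_cochain.
Qed.

(* Subdivision carries the degree one class at the origin, which has level N, up the
   resolution; in the top degree pigeonhole on the N levels makes it vanish. *)
Lemma slice_signed q : (q <= N)%N ->
  ball q (T q (fine_flag (slice q))) = (-1) ^+ q.
Proof.
elim: q => [|q IH] qN.
  have flag1 (w : seq (seq E) -> F) : flag_cochain w [:: 0] = w [:: [:: 0]].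
    by rewrite flag_cochain_cons /= subr0 flag_cochain_nil.
  have -> : ball 0 (T 0 (fine_flag (slice 0))) = fine_flag (slice 0) [:: 0] by [].
  have -> : fine_flag (slice 0) [:: 0] = flag_cochain (slice 0) [:: 0].
    rewrite /fine_flag; elim: (r) => //= r' <-; rewrite /subdiv flag1 /=.
    by rewrite /bary big_seq1 scaler0.
  by rewrite flag1 /slice /sliced /= /lowest /= ltnn lev0 eqxx.
rewrite -slice_ball ?(ltnW qN) //.
transitivity (ball q.+1 (cobd (fine_flag (slice q)))).
  by apply: eq_sphere => s _; apply: fine_flag_cobd.
by rewrite ball_cobd slice_sphere ?(ltnW qN) // IH ?(ltnW qN) // sub0r exprS mulN1r.
Qed.

Lemma slice_absurd : False.
Proof.
have top := slice_top; have : ball N.+1 (cobd (fine_flag (slice N))) = 0.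
  by rewrite -top; apply: eq_sphere => s _; rewrite fine_flag_cobd.
rewrite ball_cobd slice_sphere // slice_signed // sub0r => /eqP.
by rewrite oppr_eq0 signr_eq0.
Qed.

End NoLabelling.

Theorem no_labelling (p : nat) (K : numFieldType) (E : lmodType K)
    (R : archiRealFieldType) (nr : E -> R) (act : {linear E -> E})
    (lev : E -> nat) (grp : E -> 'F_p) (N : nat) (v : nat -> E)
    (C : E -> Prop) (eps B : R) :
  prime p ->
  (forall x y, nr (x + y) <= nr x + nr y) -> (forall x, nr (- x) = nr x) ->
  nr 0 = 0 -> (forall k x, nr ((k.+1)%:R^-1 *: x) = (k.+1)%:R^-1 * nr x) ->
  (forall x, iter p act x = x) -> 0 < eps ->
  bary_closed C -> (forall x, C x -> C (act x)) -> (forall x, C x -> nr x <= B) ->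
  C 0 -> (forall q, (q <= N)%N -> C (v q)) ->
  (forall x, C x -> lev (act x) = lev x) ->
  (forall x, C x -> (lev x < N)%N -> grp (act x) = grp x + 1) ->
  (forall x y, C x -> C y -> nr (x - y) < eps ->
    lev x = lev y -> (lev x < N)%N -> grp x = grp y) ->
  (forall x y, C x -> C y -> nr (x - y) < eps -> lev x = N -> (lev y <= N)%N) ->
  lev 0 = N ->
  (forall t : nat -> nat, exists C' : E -> Prop,
    [/\ bary_closed C', forall q, (q <= N)%N -> C' (iter (t q) act (v q)) &
      forall x, C x -> C' x -> lev x <> N]) ->
  False.
Proof.
move=> pp nrD nrN nr0 nrV actp e0 Cc Ca CB C0 Cv la ga gn ln l0 lf.
have [r rs] := fine_scale_lt N.+1 (B + B) e0.
exact: (slice_absurd pp nrD nrN nr0 nrV actp Cc Ca CB C0 Cv la ga gn ln l0 lf rs).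
Qed.

(** * General position *)

Section GeneralPosition.
Variable R : realFieldType.

Lemma small_nonroot (q : {poly R}) (d : R) : q != 0 -> 0 < d ->
  exists2 e, 0 < e < d & ~~ root q e.
Proof.
move=> q0 d0; pose s := [seq d / i.+2%:R | i <- iota 0 (size q)].
have sd e : e \in s -> 0 < e < d.
  case/mapP=> i _ ->; rewrite divr_gt0 ?ltr0n //= ltr_pdivrMr ?ltr0n //.
  by rewrite -[ltLHS]mulr1 ltr_pM2l // ltr1n.
have us : uniq s.
  rewrite map_inj_uniq ?iota_uniq // => i j /(mulfI (lt0r_neq0 d0)) /invr_inj /eqP.
  by rewrite eqr_nat => /eqP[].
have /allPn[e es er] : ~~ all (root q) s.
  apply/negP => sr; have := max_poly_roots q0 sr us.
  by rewrite size_map size_iota ltnn.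
by exists e => //; apply: sd.
Qed.

Definition moment_mx k M : 'M[R]_(M, k) := \matrix_(i, j) (nat_of_ord i)%:R ^+ j.

Lemma moment_unit k M (g : 'I_k -> 'I_M) : injective g ->
  rowsub g (moment_mx k M) \in unitmx.
Proof.
move=> gi; have -> : rowsub g (moment_mx k M) = (Vandermonde k (\row_j (nat_of_ord (g j))%:R))^T.
  by apply/matrixP => i j; rewrite !mxE.
rewrite unitmx_tr unitmxE det_Vandermonde unitfE; apply/prodf_neq0 => i _.
apply/prodf_neq0 => j ij; rewrite !mxE subr_eq0 eqr_nat.
by apply: contraTneq ij => /val_inj/gi->; rewrite ltnn.
Qed.

(** A choice g of k rows of the moment matrix gives an invertible V_g, and the perturbed rows are
    V_g (e - A_g), singular only at eigenvalues of A_g. A small e avoids the roots of the product of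
    all these characteristic polynomials. *)
Lemma generic_rows k M (H : 'M[R]_(M, k)) (d : R) : 0 < d ->
  exists2 e, 0 < e < d & forall g : 'I_k -> 'I_M, injective g ->
    rowsub g (H + e *: moment_mx k M) \in unitmx.
Proof.
move=> d0; pose A (g : {ffun 'I_k -> 'I_M}) := - (invmx (rowsub g (moment_mx k M)) *m rowsub g H).
have q0 : \prod_g char_poly (A g) != 0.
  by apply/prodf_neq0 => g _; apply/monic_neq0/char_poly_monic.
have [e ed er] := small_nonroot q0 d0; exists e => // g gi.
pose f := finfun g; have fg i : f i = g i by rewrite ffunE.
have fi : injective f by move=> i j; rewrite !fg => /gi.
have {er} : ~~ root (char_poly (A f)) e.
  apply: contra er; rewrite (bigD1 f) //= rootM => ->; by [].
rewrite -eigenvalue_root_char => er.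
have Vu := moment_unit fi.
have -> : rowsub g (H + e *: moment_mx k M) = rowsub f (moment_mx k M) *m (e%:M - A f).
  rewrite mulmxBr mulmxN opprK mulKVmx // mul_mx_scalar addrC.
  by apply/matrixP => i j; rewrite !mxE fg.
rewrite unitmx_mul Vu /=; apply: contraR er => nu.
rewrite /eigenvalue /eigenspace kermx_eq0 row_free_unit.
by rewrite -opprB -scaleN1r unitmxZ ?unitrN1 in nu.
Qed.

(* Perturbing along a moment curve makes any k rows independent; the k rows appended
   below h complete the support of lam to exactly k rows. *)
Lemma general_position k M (h : 'M[R]_(M, k)) (d : R) : 0 < d ->
  exists y : 'M[R]_(M, k), (forall i j, `|y i j - h i j| < d) /\
    forall lam : 'rV[R]_M, (#|[set i | lam ord0 i != 0%R]| <= k)%N ->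
      lam *m y = 0 -> lam = 0.
Proof.
move=> d0; pose c := \sum_i \sum_j `|moment_mx k (M + k) i j|.
have c0 : 0 <= c by do 2!apply: sumr_ge0 => ? _.
have [|e /andP[e0 ed] he] := @generic_rows k (M + k) (col_mx h 0) (d / (1 + c)).
  by rewrite divr_gt0 // ltr_pwDl.
pose Y := col_mx h 0 + e *: moment_mx k (M + k).
exists (usubmx Y); split=> [i j|lam lamk].
  rewrite /Y linearD /= col_mxKu linearZ !mxE addrAC subrr add0r normrM.
  rewrite gtr0_norm //; apply: le_lt_trans (_ : e * (1 + c) < _); last first.
    by rewrite -ltr_pdivlMr // ltr_pwDl.
  rewrite ler_pM2l //; apply: ler_wpDl => //; rewrite /c (bigD1 (lshift k i)) //=.
  rewrite (bigD1 j) //= -addrA mxE /= lerDl addr_ge0 //; apply: sumr_ge0 => // ? _.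
  exact: sumr_ge0.
move=> lam0; case: k {c c0 ed e0} h @Y lamk he lam0 => [|k] h Y lamk he lam0.
  apply/rowP => i; move: lamk; rewrite leqn0 cards_eq0 => /eqP/setP/(_ i).
  by rewrite !inE mxE => /negbFE/eqP.
pose L : 'rV[R]_(M + k.+1) := row_mx lam 0.
have LY : L *m Y = 0.
  by rewrite -[Y]vsubmxK mul_row_col mul0mx addr0.
pose S := [set i | L ord0 i != 0].
have Sk : (#|S| <= k.+1)%N.
  apply: leq_trans lamk; rewrite -(card_imset _ (@lshift_inj M k.+1)).
  apply: subset_leq_card; apply/fintype.subsetP => i; rewrite inE.
  case: (split_ordP i) => j ->; first by rewrite row_mxEl => lj; rewrite imset_f // inE.
  by rewrite row_mxEr mxE eqxx.
pose s := take k.+1 (enum S ++ enum (~: S)).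
have us0 : uniq (enum S ++ enum (~: S)).
  rewrite cat_uniq !enum_uniq /= andbT; apply/hasPn => i.
  by rewrite !mem_enum inE.
have ss : size s == k.+1.
  rewrite size_take size_cat -!cardE cardsC card_ord; case: ltnP => // h1.
  by rewrite eqn_leq h1 leq_addl.
pose g (i : 'I_k.+1) := tnth (Tuple ss) i.
have us : uniq s by apply: take_uniq.
have gi : injective g by apply/(tuple_uniqP (Tuple ss)).
have Ss i : i \notin s -> L ord0 i = 0.
  move=> is0; apply/eqP; apply: contraNT is0 => Li.
  by rewrite /s take_cat -cardE ltnNge Sk /= mem_cat mem_enum inE Li.
have : colsub g L *m rowsub g Y = 0.
  rewrite -LY; apply/rowP => j; rewrite !mxE.
  rewrite (bigID (mem s)) /= [X in _ + X]big1 ?addr0 => [|i /Ss->]; last by rewrite mul0r.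
  rewrite -big_uniq // -[s]/(tval (Tuple ss)) big_tuple.
  by apply: eq_bigr => i _; rewrite !mxE.
move/(congr1 (mulmxr (invmx (rowsub g Y)))); rewrite /= mul0mx mulmxK ?he // => Lg.
apply/rowP => i; have -> : lam ord0 i = L ord0 (lshift _ i) by rewrite row_mxEl.
rewrite [RHS]mxE; case: (boolP (lshift k.+1 i \in s)) => [|/Ss//].
move=> /(tnthP (Tuple ss))[j ->]; have := congr1 (fun m : 'rV_k.+1 => m ord0 j) Lg.
by rewrite [LHS]mxE [RHS]mxE.
Qed.

End GeneralPosition.

(** * Representations of a cyclic group of prime order *)

Lemma prime_unity_root (F : closedFieldType) p : prime p -> p%:R != 0 :> F ->
  {om : F | p.-primitive_root om}.
Proof.
move=> pp p0; have p1 := prime_gt0 pp.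
pose P : {poly F} := \poly_(i < p) 1.
have sP : size P = p by rewrite size_poly_eq // oner_eq0.
have /closed_rootP/sigW[z] : size P != 1 by rewrite sP gtn_eqF ?prime_gt1.
rewrite /root horner_poly; under eq_bigr do rewrite mul1r; move=> /eqP z0.
have zp : z ^+ p = 1 by apply/eqP; rewrite -subr_eq0 subrX1 z0 mulr0.
have [q qz qp] := prim_order_exists p1 zp; exists z.
case/primeP: pp => _ /(_ q qp)/orP[/eqP q1|/eqP <- //]; case/negP: p0.
have z1 : z = 1 by have := prim_expr_order qz; rewrite q1.
rewrite -z0 z1; under eq_bigr do rewrite expr1n.
by rewrite sumr_const card_ord.
Qed.

Section CyclicRepresentation.
Variables (F : fieldType) (p : nat) (om : F).
Hypothesis p_pr : prime p.
Hypothesis om_prim : p.-primitive_root om.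

(** The minimal polynomial divides X^p - 1, which splits with distinct roots. *)
Lemma finite_order_diagonal n (A : 'M[F]_n) :
  (forall x : 'cV_n, iter p (mulmx A) x = x) ->
  exists (Q : 'M[F]_n) (al : 'I_n -> F), Q \in unitmx /\
    forall (x : 'cV_n) j, (Q *m (A *m x)) j ord0 = al j * (Q *m x) j ord0.
Proof.
case: n A => [|n] A iA; first by exists 1%:M, (fun=> 1); split=> [|x []//]; exact: unitmx1.
have iterE k (x : 'cV_n.+1) : iter k (mulmx A) x = A ^+ k *m x.
  by elim: k => [|k IH]; rewrite ?expr0 ?mul1mx //= IH exprS mulmxA.
have Ap : A ^+ p = 1.
  by apply/row_matrixP/eqfunP/forallP => i; apply/eqP; apply/rowP => j;
    have /colP/(_ i) := iA (delta_mx j 0); rewrite iterE -colE !mxE eqxx andbT.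
have /diagonalizableP[P Pu /diagonalizable_forPex[D /(simmxPp (stablemx_unit _ Pu)) PA]] :
    exists2 rs : seq F, uniq rs & mxminpoly A %| \prod_(x <- rs) ('X - x%:P).
  exists [seq om ^+ i | i <- index_iota 0 p].
    rewrite map_inj_in_uniq ?iota_uniq // => i j; rewrite !mem_index_iota => /= ip jp /eqP.
    by rewrite (eq_prim_root_expr om_prim) !modn_small // => /eqP.
  rewrite big_map (factor_Xn_sub_1 om_prim); apply: mxminpoly_min.
  by rewrite rmorphB rmorphXn /= horner_mx_X rmorph1 Ap subrr.
exists P, (fun j => D 0 j); split=> // x j.
by rewrite mulmxA PA -mulmxA mul_diag_mx mxE.
Qed.

Section Eigenvalues.
Variables (n : nat) (A Q : 'M[F]_n) (al : 'I_n -> F).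
Hypothesis Qu : Q \in unitmx.
Hypothesis QA : forall (x : 'cV_n) j, (Q *m (A *m x)) j ord0 = al j * (Q *m x) j ord0.

Lemma eigenvalue_order j : (forall x : 'cV_n, iter p (mulmx A) x = x) -> al j ^+ p = 1.
Proof.
move=> /(_ (invmx Q *m delta_mx j 0)) h.
have iE k (x : 'cV_n) : (Q *m iter k (mulmx A) x) j ord0 = al j ^+ k * (Q *m x) j ord0.
  by elim: k => [|k IH] /=; rewrite ?mul1r // QA IH exprS mulrA.
by have := iE p (invmx Q *m delta_mx j 0); rewrite h mulKVmx // !mxE !eqxx mulr1.
Qed.

Lemma eigenvalue_neq1 j : (forall x : 'cV_n, A *m x = x -> x = 0) -> al j != 1.
Proof.
move=> fix0; apply/eqP => aj; pose x : 'cV_n := invmx Q *m delta_mx j 0.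
have : x = 0.
  apply: fix0; apply: (can_inj (mulKmx Qu)); apply/colP => i; rewrite QA.
  rewrite mulKVmx // !mxE eqxx andbT; case: eqP => [->|_]; last by rewrite mulr0.
  by rewrite aj mul1r.
move=> /(congr1 (mulmx Q)); rewrite mulKVmx // mulmx0 => /colP/(_ j)/eqP.
by rewrite !mxE !eqxx oner_eq0.
Qed.

End Eigenvalues.

(** This brings all coordinates of f to the same weight; since c > 0, taking powers keeps their
    zeros. *)
Lemma unity_root_power z : z ^+ p = 1 -> z != 1 -> exists2 c, (0 < c)%N & z ^+ c = om.
Proof.
move=> /(prim_rootP om_prim)[a ->] z1.
have ap : p.-primitive_root (om ^+ a).
  rewrite prim_root_exp_coprime // coprime_sym prime_coprime // gtnNdvd //.
  by rewrite lt0n; apply: contra z1 => /eqP->.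
have [c omc] := prim_rootP ap (prim_expr_order om_prim).
exists c => //; rewrite lt0n; apply: contraTneq (prime_gt1 p_pr) => c0.
by have := prim_order_dvd om_prim 1; rewrite omc c0 expr0 expr1n eqxx dvdn1 => /eqP->.
Qed.

End CyclicRepresentation.

Local Open Scope classical_set_scope.
Local Open Scope ring_scope.
Local Open Scope complex_scope.

(** * Topology of complex column vectors *)

Section ComplexTopology.
Variable R : realType.
Local Notation C := (CC R).
Implicit Types (z w : C).

(** The norm of R[i] has values in R[i]; this is the same norm with values in R, as needed for real
    bounds and continuity. *)
Definition cabs (z : R[i]) : R := Normc.normc z.

Lemma normC_cabs (z : R[i]) : `|z| = (cabs z)%:C. Proof. by []. Qed.

Lemma cabs_ge0 z : 0 <= cabs z.
Proof. by have := normr_ge0 z; rewrite normC_cabs lecR. Qed.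

Lemma cabsM z w : cabs (z * w) = cabs z * cabs w.
Proof. by apply: complexI; rewrite rmorphM -!normC_cabs normrM. Qed.

Lemma cabsD z w : cabs (z + w) <= cabs z + cabs w.
Proof. by have := ler_normD z w; rewrite !normC_cabs -rmorphD lecR. Qed.

Lemma cabsN z : cabs (- z) = cabs z.
Proof. by apply: complexI; rewrite -!normC_cabs normrN. Qed.

Lemma cabs0 : cabs 0 = 0.
Proof. by apply: complexI; rewrite -normC_cabs normr0. Qed.

Lemma cabs1 : cabs 1 = 1.
Proof. by apply: complexI; rewrite -normC_cabs normr1. Qed.

Lemma cabs_eq0 z : (cabs z == 0) = (z == 0).
Proof. by rewrite -(inj_eq (@complexI R)) -normC_cabs normr_eq0. Qed.

Lemma cabsV z : cabs z^-1 = (cabs z)^-1.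
Proof. by apply: complexI; rewrite -normC_cabs normfV fmorphV. Qed.

Lemma cabsX z k : cabs (z ^+ k) = cabs z ^+ k.
Proof. by elim: k => [|k IH]; rewrite ?expr0 ?cabs1 // !exprS cabsM IH. Qed.

Lemma cabs_unity_root p z : (0 < p)%N -> z ^+ p = 1 -> cabs z = 1.
Proof.
by move=> p0 zp; apply/eqP; rewrite -(eqrXn2 p0 (cabs_ge0 z) ler01) expr1n -cabsX zp cabs1.
Qed.

Lemma cabs_real (a : R) : cabs a%:C = `|a|.
Proof. by rewrite /cabs /= expr0n /= addr0 sqrtr_sqr. Qed.

Lemma cabsB z w : cabs (z - w) = cabs (w - z).
Proof. by rewrite -cabsN opprB. Qed.

Lemma cabs_sum (I : Type) (r : seq I) (f : I -> C) :
  cabs (\sum_(i <- r) f i) <= \sum_(i <- r) cabs (f i).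
Proof.
elim: r => [|x s IH]; first by rewrite !big_nil cabs0.
by rewrite !big_cons; apply: le_trans (cabsD _ _) _; rewrite lerD2l.
Qed.

Lemma cabs_Re z : `|complex.Re z| <= cabs z.
Proof. by have := normc_ge_Re z; rewrite normC_cabs lecR. Qed.

Lemma cabs_Im z : `|complex.Im z| <= cabs z.
Proof.
case: z => a b; rewrite /cabs /=; rewrite -[leLHS]sqrtr_sqr ler_wsqrtr //.
by rewrite lerDr sqr_ge0.
Qed.

Lemma cabs_le z : cabs z <= `|complex.Re z| + `|complex.Im z|.
Proof.
have {1}-> : z = (complex.Re z)%:C + 'i * (complex.Im z)%:C by case: z => a b; simpc.
apply: le_trans (cabsD _ _) _; rewrite cabsM !cabs_real.
by rewrite {1}/cabs /= expr0n expr1n /= add0r sqrtr1 mul1r.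
Qed.

Lemma Re_realM (a : R) (z : R[i]) : complex.Re (a%:C * z) = a * complex.Re z.
Proof. by case: z => u v; simpc. Qed.

Lemma nbhs_C z (A : set C) : nbhs z A <-> exists2 e : R, 0 < e & forall w, cabs (z - w) < e -> A w.
Proof.
split.
  move=> /nbhs_ballP[e /= e0 eA]; move: (e0); rewrite ltcE /= => /andP[/eqP ie re].
  exists (complex.Re e) => // w zw; apply: eA; rewrite -ball_normE /=.
  by rewrite normC_cabs ltcE /= ie eqxx.
move=> [e e0 eA]; apply/nbhs_ballP; exists e%:C; first by rewrite /= ltcR.
by move=> w; rewrite -ball_normE /= normC_cabs ltcR; apply: eA.
Qed.

Lemma cvg_C (T : Type) (F : set_system T) (FF : Filter F) (f : T -> C) z :
  (f @ F --> z) <-> forall e : R, 0 < e -> \forall t \near F, cabs (z - f t) < e.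
Proof.
split=> [fz e e0|h A /nbhs_C[e e0 eA]].
  by apply: (fz [set w | cabs (z - w) < e]); apply/nbhs_C; exists e.
by apply: filterS (h e e0) => t /eA.
Qed.

Lemma continuous_fromC (f : C -> R) :
  (forall z w, `|f z - f w| <= cabs (z - w)) -> continuous f.
Proof.
move=> h z; apply/(@cvgrPdist_lt _ _ _ _ (@nbhs_filter C z)) => e e0.
by apply/nbhs_C; exists e => // w; apply: le_lt_trans.
Qed.

Lemma cabs_dist z w : `|cabs z - cabs w| <= cabs (z - w).
Proof.
rewrite ler_norml lerBlDr lerNl opprB lerBlDr.
have := cabsD (z - w) w; have := cabsD (w - z) z; rewrite !subrK (cabsB w z) => h1 h2.
by rewrite h1 h2.
Qed.

Lemma continuous_cabs : continuous (cabs : C -> R).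
Proof. by apply: continuous_fromC => z w; apply: cabs_dist. Qed.

Lemma continuous_Re : continuous (@complex.Re R : C -> R).
Proof. by apply: continuous_fromC => z w; rewrite -raddfB; exact: cabs_Re. Qed.

Lemma continuous_Im : continuous (@complex.Im R : C -> R).
Proof. by apply: continuous_fromC => z w; rewrite -raddfB; exact: cabs_Im. Qed.

Lemma continuous_complex : continuous ((fun a => a%:C) : R -> C).
Proof.
move=> a; apply/cvg_C => e e0; have : \forall t \near a, `|a - t| < e.
  exact: (@cvgr_dist_lt _ _ _ _ _ _ _ (@cvg_id _ (nbhs a))).
by apply: filterS => t; rewrite -rmorphB cabs_real.
Qed.

Lemma compact_box (r : R) : compact [set z : C | `|complex.Re z| <= r /\ `|complex.Im z| <= r].
Proof.
pose f (x : R * R) : C := (x.1)%:C + 'i * (x.2)%:C.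
have cf : continuous f.
  move=> x; apply: cvgD; first exact: (continuous_comp (@cvg_fst _ _ _ _ _) (@continuous_complex _)).
  apply: cvgM; first exact: cvg_cst.
  exact: (continuous_comp (@cvg_snd _ _ _ _ _) (@continuous_complex _)).
have -> : [set z : C | `|complex.Re z| <= r /\ `|complex.Im z| <= r] =
          f @` (`[-r, r] `*` `[-r, r]).
  apply/seteqP; split => [[a b] /= [ar br]|_ [[a b] /= [ar br]] <-].
    exists (a, b); last by rewrite /f /=; simpc.
    by split; rewrite /= in_itv /= -ler_norml.
  by move: ar br; rewrite /f /= !in_itv /= -!ler_norml; simpc.
apply: continuous_compact; first exact: continuous_subspaceT.
by apply: compact_setX; exact: segment_compact.
Qed.

End ComplexTopology.

Arguments cabs {R} z : simpl never.

Lemma seq_lower_bound (R : realDomainType) (I : eqType) (s : seq I) (f : I -> R) :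
  (forall i, 0 < f i) -> exists2 e, 0 < e & forall i, i \in s -> e <= f i.
Proof.
move=> f0; elim: s => [|i s [e e0 he]]; first by exists 1.
exists (Num.min e (f i)); first by rewrite lt_min e0 f0.
by move=> j; rewrite inE ge_min => /orP[/eqP->|/he->//]; rewrite lexx orbT.
Qed.

Section NormTopology.
Variables (R : realType) (E : ptopologicalType) (sub : E -> E -> R).
Hypothesis sub_open : forall x d, open [set y | sub y x < d].
Hypothesis subxx : forall x, sub x x = 0.

Lemma finite_ball_cover (K : set E) (r : E -> R) : compact K ->
  (forall x, K x -> 0 < r x) ->
  exists s : seq E, (forall x, x \in s -> K x) /\
    (forall y, K y -> exists2 x, x \in s & sub y x < r x).
Proof.
rewrite compact_cover => cK r0.
have [|x Kx|D DK Kc] := cK E K (fun x => [set y | sub y x < r x]).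
- by move=> x _; apply: sub_open.
- by exists x => //=; rewrite subxx; apply: r0.
exists (finmap.enum_fset D); split=> [x xD|y /Kc[x xD yx]].
  by have := DK x xD; rewrite inE.
by exists x.
Qed.

End NormTopology.

Section ColumnTopology.
Variables (R : realType) (n : nat).
Local Notation C := (CC R).
Local Notation E := 'cV[C]_n.

Lemma cvg_mx (T : Type) (F : set_system T) (FF : Filter F) m k (f : T -> 'M[C]_(m, k)) (M : 'M[C]_(m, k)) :
  (forall i j, (fun t => f t i j) @ F --> (M i j : C)) -> f @ F --> M.
Proof.
move=> h A [P MP PA]; rewrite /nbhs /=.
apply: filterS (_ : F [set t | forall i j, P i j (f t i j)]) => [t tP|]; first exact: PA.
apply: filter_forall => i; apply: filter_forall => j.
exact: h (MP i j).
Qed.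

(** The l1 norm in the coordinates Q. In eigencoordinates whose eigenvalues are roots of unity, the
    action becomes isometric. *)
Definition colnorm (Q : 'M[C]_n) (x : E) : R := \sum_j cabs ((Q *m x) j ord0).

Lemma colnormD Q x y : colnorm Q (x + y) <= colnorm Q x + colnorm Q y.
Proof.
rewrite /colnorm -big_split /=; apply: ler_sum => j _.
by rewrite mulmxDr mxE; apply: cabsD.
Qed.

Lemma colnormN Q x : colnorm Q (- x) = colnorm Q x.
Proof. by apply: eq_bigr => j _; rewrite mulmxN mxE cabsN. Qed.

Lemma colnorm0 Q : colnorm Q 0 = 0.
Proof. by rewrite /colnorm big1 // => j _; rewrite mulmx0 mxE cabs0. Qed.

Lemma colnormZ Q (a : C) x : colnorm Q (a *: x) = cabs a * colnorm Q x.
Proof. by rewrite /colnorm mulr_sumr; apply: eq_bigr => j _; rewrite -scalemxAr mxE cabsM. Qed.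

Lemma colnorm_ge0 Q x : 0 <= colnorm Q x.
Proof. by apply: sumr_ge0 => j _; apply: cabs_ge0. Qed.

Lemma colnorm_coord Q x j : cabs ((Q *m x) j ord0) <= colnorm Q x.
Proof. by rewrite /colnorm (bigD1 j) //= lerDl sumr_ge0 // => i _; apply: cabs_ge0. Qed.

Lemma colnorm_le Q P : exists2 L : R, 0 < L & forall x, colnorm Q (P *m x) <= L * colnorm 1%:M x.
Proof.
exists (1 + \sum_i \sum_j cabs ((Q *m P) i j)).
  by rewrite ltr_pwDl // sumr_ge0 // => i _; apply: sumr_ge0 => j _; apply: cabs_ge0.
move=> x; rewrite mulrDl mul1r; apply: ler_wpDl; first exact: colnorm_ge0.
rewrite mulr_suml [leLHS]/colnorm; apply: ler_sum => i _; rewrite mulmxA mxE.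
apply: le_trans (cabs_sum _ _) _; rewrite mulr_suml; apply: ler_sum => j _.
rewrite cabsM; apply: ler_wpM2l; first exact: cabs_ge0.
by have := colnorm_coord 1%:M x j; rewrite mul1mx.
Qed.

Lemma colnorm_equiv Q : Q \in unitmx -> exists L : R, 0 < L /\
  forall x, colnorm Q x <= L * colnorm 1%:M x /\ colnorm 1%:M x <= L * colnorm Q x.
Proof.
move=> Qu; have [L1 L10 h1] := colnorm_le Q 1%:M; have [L2 L20 h2] := colnorm_le 1%:M (invmx Q).
exists (L1 + L2); split=> [|x]; first exact: addr_gt0.
split; apply: le_trans (ler_wpM2r (colnorm_ge0 _ _) _).
- by have := h1 x; rewrite mul1mx; apply.
- by rewrite lerDl ltW.
- have := h2 (Q *m x); rewrite mulKmx // => h; apply: (le_trans h).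
  by rewrite /colnorm; under eq_bigr do rewrite mul1mx.
- by rewrite lerDr ltW.
Qed.

Lemma nbhs_colnorm1 (x : E) (A : set E) :
  nbhs x A <-> exists2 d : R, 0 < d & forall y, colnorm 1%:M (y - x) < d -> A y.
Proof.
split=> [[P xP PA]|[d d0 dA]].
  have /= h i := (nbhs_C (x i ord0) (P i ord0)).1 (xP i ord0).
  have [e eP] := choice (fun i => let: ex_intro2 e e0 he := h i in ex_intro _ e (conj e0 he)).
  exists (\big[Order.min/1]_i e i).
    by apply/bigmin_gtP; split=> // i _; have [] := eP i.
  move=> y yx; apply: PA => i j; rewrite ord1; have [_] := eP i; apply.
  rewrite cabsB; apply: le_lt_trans (_ : _ <= colnorm 1%:M (y - x)) _.
    by have := colnorm_coord 1%:M (y - x) i; rewrite mul1mx !mxE.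
  by apply: lt_le_trans yx _; apply: bigmin_le.
pose e : R := d / n.+1%:R; have e0 : 0 < e by rewrite divr_gt0 // ltr0n.
exists (fun i j => [set w | cabs (x i j - w) < e]).
  by move=> i j; apply/nbhs_C; exists e.
move=> y xy; apply: dA; apply: le_lt_trans (_ : _ <= \sum_(j < n) e) _.
  apply: ler_sum => j _; rewrite mul1mx !mxE cabsB; exact/ltW/xy.
rewrite sumr_const card_ord -(mulr_natl e n) /e mulrCA -[ltRHS]mulr1 ltr_pM2l //.
by rewrite ltr_pdivrMr ?ltr0n // mul1r ltr_nat.
Qed.

Lemma nbhs_colnorm Q (x : E) (A : set E) : Q \in unitmx ->
  nbhs x A <-> exists2 d : R, 0 < d & forall y, colnorm Q (y - x) < d -> A y.
Proof.
move=> /colnorm_equiv[L [L0 hL]]; rewrite nbhs_colnorm1; split=> -[d d0 dA].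
  exists (d / L); first by rewrite divr_gt0.
  move=> y; rewrite ltr_pdivlMr // mulrC => h; apply: dA; apply: le_lt_trans h.
  by have [] := hL (y - x).
exists (d / L); first by rewrite divr_gt0.
move=> y; rewrite ltr_pdivlMr // mulrC => h; apply: dA; apply: le_lt_trans h.
by have [] := hL (y - x).
Qed.

Lemma colnorm_dist Q x y : `|colnorm Q x - colnorm Q y| <= colnorm Q (y - x).
Proof.
rewrite ler_norml lerBlDr lerNl opprB lerBlDr.
have := colnormD Q (y - x) x; have := colnormD Q (x - y) y.
by rewrite !subrK -[x - y]opprB colnormN => -> ->.
Qed.

Lemma continuous_colnormB Q a : Q \in unitmx -> continuous (fun x : E => colnorm Q (x - a)).
Proof.
move=> Qu x; apply/(@cvgrPdist_lt _ _ _ _ (@nbhs_filter E x)) => e e0; apply/(nbhs_colnorm _ _ Qu).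
exists e => // y; apply: le_lt_trans; apply: le_trans (colnorm_dist _ _ _) _.
by rewrite opprB addrA subrK.
Qed.

Lemma continuous_colnorm Q : Q \in unitmx -> continuous (colnorm Q).
Proof.
move=> Qu; have := continuous_colnormB (a := 0) Qu.
by rewrite (_ : (fun x => _) = colnorm Q) //; apply/funext => x; rewrite subr0.
Qed.

Lemma open_colnorm Q x d : Q \in unitmx -> open [set y : E | colnorm Q (y - x) < d].
Proof.
move=> Qu; have := open_comp (D := [set t : R | t < d]) (f := fun y : E => colnorm Q (y - x)).
by apply=> [y _|]; [exact: continuous_colnormB | exact: open_lt].
Qed.

Lemma compact_colnorm Q r : Q \in unitmx -> compact [set x : E | colnorm Q x <= r].
Proof.
move=> Qu; have [L [L0 hL]] := colnorm_equiv Qu.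
pose B := [set z : C | `|complex.Re z| <= L * r /\ `|complex.Im z| <= L * r].
have cB := @rV_compact C n (fun=> B) (fun=> @compact_box R (L * r)).
have ct : compact ((@trmx C 1 n) @` [set v : 'rV[C]_n | forall i, B (v ord0 i)]).
  apply: continuous_compact cB; apply: continuous_subspaceT => v.
  apply: (@cvg_mx _ _ (@nbhs_filter 'rV[C]_n v)) => i j; have -> : (v^T i j : C) = v j i by rewrite mxE.
  rewrite (_ : (fun t : 'rV_n => t^T i j) = (fun t : 'rV_n => t j i)); last by apply/funext => t; rewrite mxE.
  exact: (@coord_continuous _ 1 n j i v).
apply: subclosed_compact ct _ => [|x xr].
  apply: (closed_comp (D := [set t : R | t <= r]) (f := colnorm Q)); last exact: closed_le.
  by move=> x _; apply: continuous_colnorm.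
exists (x^T); last by rewrite trmxK.
move=> i; rewrite mxE; have h : cabs (x i ord0) <= L * r.
  apply: le_trans (_ : L * colnorm Q x <= _); last by rewrite ler_pM2l.
  have [_ h] := hL x; apply: le_trans h.
  by have := colnorm_coord 1%:M x i; rewrite mul1mx.
by split; [apply: le_trans (cabs_Re _) h | apply: le_trans (cabs_Im _) h].
Qed.

Lemma colnorm_ball_cover Q (K : set E) (r : E -> R) : Q \in unitmx -> compact K ->
  (forall x, 0 < r x) -> exists s : seq E, (forall x, x \in s -> K x) /\
    (forall y, K y -> exists2 x, x \in s & colnorm Q (y - x) < r x).
Proof.
move=> Qu cK r0; apply: (finite_ball_cover _ _ cK) => [x d|x|x _]; last exact: r0.
  exact: open_colnorm.
by rewrite subrr colnorm0.
Qed.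

Lemma colnorm_gt0 Q x : Q \in unitmx -> x != 0 -> 0 < colnorm Q x.
Proof.
move=> Qu x0; rewrite lt_neqAle eq_sym colnorm_ge0 andbT; apply: contra x0.
rewrite /colnorm psumr_eq0 => [/allP h|j _]; last exact: cabs_ge0.
apply/eqP/(can_inj (mulKmx Qu))/colP => j; rewrite mulmx0 [RHS]mxE; apply/eqP.
by have := h j (mem_index_enum _); rewrite cabs_eq0.
Qed.

Lemma compact_colnorm_sphere Q : Q \in unitmx -> compact [set x | colnorm Q x = 1].
Proof.
move=> Qu; apply: (@subclosed_compact _ _ [set x | colnorm Q x <= 1]); last by move=> x /= ->.
  apply: (closed_comp (D := [set t : R | t = 1]) (f := colnorm Q)); last exact: closed_eq.
  by move=> x _; apply: continuous_colnorm.
exact: compact_colnorm.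
Qed.

End ColumnTopology.

(** * Nonvanishing perturbations below the covering dimension *)

Section ContinuousOperations.
Variables (T : topologicalType) (K : numFieldType).
Implicit Types f g : T -> K.

Lemma cont_cst (a : K) : continuous (fun _ : T => a).
Proof. by move=> x; apply: cvg_cst. Qed.

Lemma contD f g : continuous f -> continuous g -> continuous (fun x => f x + g x).
Proof. by move=> cf cg x; apply: cvgD; [exact: cf | exact: cg]. Qed.

Lemma contB f g : continuous f -> continuous g -> continuous (fun x => f x - g x).
Proof. by move=> cf cg x; apply: cvgB; [exact: cf | exact: cg]. Qed.

Lemma contM f g : continuous f -> continuous g -> continuous (fun x => f x * g x).
Proof. by move=> cf cg x; apply: cvgM; [exact: cf | exact: cg]. Qed.

Lemma cont_sum (I : Type) (r : seq I) (P : pred I) (f : I -> T -> K) :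
  (forall i, P i -> continuous (f i)) -> continuous (fun x => \sum_(i <- r | P i) f i x).
Proof.
by move=> cf x; apply: cvg_big => [|i Pi]; [exact: add_continuous | exact: cf].
Qed.

Lemma cont_comp (U V W : topologicalType) (h : U -> V) (h' : V -> W) :
  continuous h -> continuous h' -> continuous (fun x => h' (h x)).
Proof. by move=> ch ch' x; apply: continuous_comp; [exact: ch | exact: ch']. Qed.

End ContinuousOperations.

Section ContinuousComplex.
Variables (T : topologicalType) (R : realType).
Implicit Types f g : T -> CC R.

Lemma contC_cst (a : CC R) : continuous (fun _ : T => a).
Proof. exact: (@cont_cst T R[i] a). Qed.

Lemma contCD f g : continuous f -> continuous g -> continuous (fun x => f x + g x : CC R).
Proof. exact: (@contD T R[i] f g). Qed.

Lemma contCM f g : continuous f -> continuous g -> continuous (fun x => f x * g x : CC R).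
Proof. exact: (@contM T R[i] f g). Qed.

Lemma contC_sum (I : Type) (r : seq I) (P : pred I) (f : I -> T -> CC R) :
  (forall i, P i -> continuous (f i)) -> continuous (fun x => \sum_(i <- r | P i) f i x : CC R).
Proof. exact: (@cont_sum T R[i] I r P f). Qed.

End ContinuousComplex.

Lemma cont_max (R : realType) (T : topologicalType) (f g : T -> R) :
  continuous f -> continuous g -> continuous (fun x => Num.max (f x) (g x)).
Proof. by move=> cf cg x; apply: continuous_max; [exact: cf | exact: cg]. Qed.

Lemma cont_min (R : realType) (T : topologicalType) (f g : T -> R) :
  continuous f -> continuous g -> continuous (fun x => Num.min (f x) (g x)).
Proof. by move=> cf cg x; apply: continuous_min; [exact: cf | exact: cg]. Qed.

Lemma near_gt (R : realType) (T : topologicalType) (f : T -> R) (a : R) x :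
  continuous f -> a < f x -> \forall y \near x, a < f y.
Proof. by move=> cf h; have /cvgr_gt := cf x; apply. Qed.

Lemma near_lt (R : realType) (T : topologicalType) (f : T -> R) (a : R) x :
  continuous f -> f x < a -> \forall y \near x, f y < a.
Proof. by move=> cf h; have /cvgr_lt := cf x; apply. Qed.

Section Perturbation.
Variables (R : realType) (E : ptopologicalType) (sub : E -> E -> R).
Hypothesis nbhs_sub : forall x (A : set E),
  nbhs x A <-> exists2 d : R, 0 < d & forall y, sub y x < d -> A y.
Hypothesis subxx : forall x, sub x x = 0.
Hypothesis sub_cont : forall a, continuous (sub ^~ a).
Variables (Z : set E) (k : nat).
Hypothesis cZ : compact Z.
Hypothesis dimZ : covering_dim_lt (set_type Z) k.

Lemma sub_open x d : open [set y | sub y x < d].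
Proof.
have := open_comp (D := [set t : R | t < d]) (f := sub ^~ x).
by apply=> [y _|]; [exact: sub_cont | exact: open_lt].
Qed.

Lemma compact_pos_min (f : E -> R) : continuous f -> (forall x, Z x -> 0 < f x) ->
  exists2 c, 0 < c & forall x, Z x -> c <= f x.
Proof.
move=> cf f0; have [Z0|Z0] := pselect (Z !=set0); last first.
  by exists 1 => // x Zx; case: Z0; exists x.
have [c cZ' h] := compact_EVT_min Z0 cZ (continuous_subspaceT cf).
exists (f c); first by apply/f0; move: cZ'; rewrite inE.
by move=> x Zx; apply: h; rewrite inE.
Qed.

Lemma inj_card_le (I : finType) (T : choiceType) (A : set T) (S : {set I}) (f : I -> T) :
  (A #<= `I_k)%card -> injective f -> (forall i, i \in S -> A (f i)) -> (#|S| <= k)%N.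
Proof.
move=> Ak fi fA; apply: leq_trans (geq_card_fset_set Ak).
have finA : finite_set A by apply/finite_set_leP; exists k.
rewrite cardE -(size_map f); apply: uniq_leq_size; first by rewrite map_inj_uniq ?enum_uniq.
by move=> W /mapP[j]; rewrite mem_enum => jS ->; rewrite in_fset_set // inE; apply: fA.
Qed.

(** An unnormalized partition of unity subordinate to a refinement of order k by sets on which q
    hardly varies; row i of h is a sample of q near the support of [mu i]. *)
Lemma fine_refinement (q : E -> 'rV[R]_k) (d : R) :
  (forall j, continuous (fun x => q x ord0 j)) -> 0 < d ->
  exists M (mu : 'I_M -> E -> R) (h : 'M[R]_(M, k)),
  [/\ forall i, continuous (mu i), forall i x, 0 <= mu i x,
      forall x, Z x -> 0 < \sum_i mu i x,
      forall x, Z x -> (#|[set i | mu i x != 0%R]%SET| <= k)%N &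
      forall x i j, Z x -> mu i x != 0 -> `|q x ord0 j - h i j| < d].
Proof.
move=> cq d0.
have osc x : exists r : R, 0 < r /\ forall y, sub y x < r -> forall j, `|q y ord0 j - q x ord0 j| < d.
  have : \forall y \near x, forall j, `|q y ord0 j - q x ord0 j| < d.
    apply: filter_forall => j.
    have := @cvgr_dist_lt _ _ _ _ (@nbhs_filter E x) _ _ (cq j x) d d0.
    by apply: filterS => y; rewrite distrC.
  by move=> /nbhs_sub[r r0 h]; exists r.
have [r hr] := choice osc.
have [s [sZ sc]] := finite_ball_cover sub_open subxx cZ (fun x _ => (hr x).1).
pose A (x : E) : set (set_type Z) := [set z | sub (val z) x < r x].
have Aopen x : open (A x) by exists [set y | sub y x < r x]; [exact: sub_open|].
have [ | | |B [Bo Bc BA Bk]] := dimZ (A := [set A x | x in [set` s]]).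
- exact/finite_image/finite_seq.
- by move=> _ [x _ <-]; apply: Aopen.
- apply/seteqP; split=> // z _; have [x xs zx] := sc (val z) (set_valP z).
  by exists (A x) => //; exists x.
(* The refinement B may be infinite. Choosing at each point one member and a radius lets compactness
   select finitely many members, without raising the order. *)
have loc z : exists Wr : set (set_type Z) * R, 0 < Wr.2 /\ (Z z -> B Wr.1 /\
    forall y : set_type Z, sub (val y) z < Wr.2 -> Wr.1 y).
  have [Zz|nZ] := pselect (Z z); last by exists (set0, 1).
  have [W BW Wz] : cover B id (exist _ z (mem_set Zz) : set_type Z) by rewrite Bc.
  have [V0 oV VW] := Bo _ BW.
  have : nbhs z V0 by apply: open_nbhs_nbhs; split=> //; rewrite -VW in Wz.
  move=> /nbhs_sub[r1 r10 hV]; exists (W, r1); split=> // _; split=> // y /hV.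
  by rewrite -VW.
have [Wr hWr] := choice loc.
have [s2 [s2Z s2c]] := finite_ball_cover sub_open subxx cZ (fun x _ => (hWr x).1).
pose bump z y : R := Num.max 0 ((Wr z).2 - sub y z).
have bump0 z y : 0 <= bump z y by rewrite le_max lexx.
have bumpc z : continuous (bump z).
  by apply: cont_max; [exact: cont_cst | apply: contB; [exact: cont_cst | exact: sub_cont]].
have bumpW z (y : set_type Z) : Z z -> bump z (val y) != 0 -> (Wr z).1 y.
  move=> Zz; have [_ /(_ Zz)[_ h]] := hWr z => by0; apply: h; rewrite ltNge.
  by apply: contra by0 => h; rewrite /bump max_l // subr_le0.
(* Several points may select the same member; their bumps are merged, as repeated members would
   spoil the count by k. *)
pose l := undup (map (fun z => (Wr z).1) s2).
pose W (i : 'I_(size l)) : set (set_type Z) := nth set0 l i.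
have Wl i : W i \in l by apply: mem_nth.
have WB i : B (W i).
  have := Wl i; rewrite mem_undup => /mapP[z zs ->].
  by have [_ /(_ (s2Z _ zs))[]] := hWr z.
pose mu i y := \sum_(z <- s2 | (Wr z).1 == W i) bump z y.
have muW i (y : set_type Z) : mu i (val y) != 0 -> W i y.
  move=> m0; apply: contrapT => nW; case/eqP: m0; rewrite /mu big_seq_cond big1 // => z /andP[zs /eqP e].
  by apply/eqP; apply: contraT => /(bumpW _ _ (s2Z _ zs)); rewrite e => /nW.
have WA i : exists x, W i `<=` A x.
  by have [_ [x _ <-] h] := BA _ (WB i); exists x.
have [c hc] := choice WA.
exists (size l), mu, (\matrix_(i, j) q (c i) ord0 j); split.
- by move=> i; apply: cont_sum => z _; apply: bumpc.
- by move=> i x; apply: sumr_ge0.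
- move=> x Zx; have [z zs xz] := s2c x Zx.
  have Wzl : (Wr z).1 \in l by rewrite mem_undup; apply: map_f.
  have il : (index (Wr z).1 l < size l)%N by rewrite index_mem.
  rewrite (bigD1 (Ordinal il)) //= ltr_pwDl ?sumr_ge0 //; last by move=> i _; apply: sumr_ge0.
  rewrite /mu (big_rem z) //= /W /= nth_index // eqxx ltr_pwDl //; last exact: sumr_ge0.
  by rewrite /bump lt_max subr_gt0 xz orbT.
- move=> x Zx; apply: (inj_card_le (f := W) (Bk (exist _ x (mem_set Zx)))).
    by move=> i j /eqP; rewrite nth_uniq ?undup_uniq // => /eqP/val_inj.
  move=> i; rewrite finset.inE => mi; split; first exact: WB.
  exact: (muW i (exist _ x (mem_set Zx))).
move=> x i j Zx mi; rewrite mxE; have := hc i _ (muW i (exist _ x (mem_set Zx)) mi).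
by move=> /(hr (c i)).2.
Qed.

(** On Z the perturbed map is a convex combination of at most k of the generic rows of y. Any k of
    these are linearly independent, so it is not zero. *)
Lemma nonvanishing_perturbation (q : E -> 'rV[R]_k) (d : R) :
  (forall j, continuous (fun x => q x ord0 j)) -> 0 < d ->
  exists e : E -> 'rV[R]_k,
  [/\ forall j, continuous (fun x => e x ord0 j),
      forall x j, Z x -> `|e x ord0 j| <= d &
      forall x, Z x -> q x + e x != 0].
Proof.
move=> cq d0; have d20 : 0 < d / 2 by rewrite divr_gt0.
have [M [mu [h [muc mu0 mus muk muh]]]] := fine_refinement cq d20.
have [y [yh ylin]] := general_position h d20.
pose s x := \sum_i mu i x.
have sc : continuous s by apply: cont_sum => i _; apply: muc.
have [c c0 cs] := compact_pos_min sc mus.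
(* The maximum with c changes nothing on Z and keeps the quotient continuous off Z, where the sum s
   may vanish. *)
pose lam x i := mu i x / Num.max (s x) c.
have mx0 x : Num.max (s x) c != 0 by rewrite gt_eqF // lt_max c0 orbT.
have lamc i : continuous (lam ^~ i).
  move=> x; apply: cvgM; first exact: muc.
  apply: cvgV => //; apply: cont_max => //; exact: cst_continuous.
have lam0 i x : 0 <= lam x i by rewrite divr_ge0 // le_max (ltW c0) orbT.
have lam1 x : Z x -> \sum_i lam x i = 1.
  by move=> Zx; rewrite -mulr_suml max_l ?cs // divff // gt_eqF // mus.
pose e x : 'rV[R]_k := \row_j \sum_i lam x i * (y i j - q x ord0 j).
exists e; split.
- move=> j; rewrite (_ : (fun x => _) = (fun x => \sum_i lam x i * (y i j - q x ord0 j))); last first.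
    by apply/funext => x; rewrite mxE.
  apply: cont_sum => i _ x; apply: cvgM; first exact: lamc.
  by apply: cvgB; [exact: cvg_cst | exact: cq].
- move=> x j Zx; rewrite mxE; apply: le_trans (ler_norm_sum _ _ _) _.
  apply: le_trans (_ : _ <= \sum_i lam x i * d) _; last by rewrite -mulr_suml lam1 // mul1r.
  apply: ler_sum => i _; rewrite normrM ger0_norm //.
  have [mi|mi] := eqVneq (mu i x) 0; first by rewrite /lam mi !mul0r.
  apply: ler_wpM2l => //; have := muh x i j Zx mi; have := yh i j.
  rewrite !ltr_norml ler_norml => /andP[? ?] /andP[? ?]; apply/andP; split; lra.
move=> x Zx; pose L : 'rV[R]_M := \row_i lam x i.
have -> : q x + e x = L *m y.
  apply/rowP => j; rewrite !mxE.
  transitivity (q x ord0 j * \sum_i lam x i + \sum_i lam x i * (y i j - q x ord0 j)).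
    by rewrite lam1 // mulr1.
  rewrite mulr_sumr -big_split /=; apply: eq_bigr => i _; rewrite mxE; ring.
apply/eqP => Ly; have /eqP := lam1 x Zx.
have {Ly}L0 : L = 0.
  apply: ylin Ly; apply: leq_trans (muk x Zx); apply: subset_leq_card.
  apply/fintype.subsetP => i; rewrite !inE !mxE; apply: contraNneq => mi.
  by rewrite /lam mi mul0r.
rewrite big1 ?(eq_sym _ 1) ?oner_eq0 // => i _.
by have := congr1 (fun v : 'rV_M => v ord0 i) L0; rewrite !mxE.
Qed.

End Perturbation.

(** * Equivariant maps in general position *)

Lemma separation_arith (R : realFieldType) (a b b' c : R) :
  a < 2 * (b / 4) -> b <= b' -> b' <= a + c -> 2 * (b / 4) <= c.
Proof. lra. Qed.

(** The average over the cyclic group against the character om projects a function onto its part of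
    weight one. *)
Lemma twisted_average (K : fieldType) (X : Type) (g : X -> X) (p : nat) (om : K) (f : X -> K) x :
  (forall y, iter p g y = y) -> om ^+ p = 1 -> om != 0 ->
  \sum_(j < p) om ^- j * f (iter j g (g x)) = om * \sum_(j < p) om ^- j * f (iter j g x).
Proof.
move=> gp omp om0; rewrite -(@sum_cyclic_shift _ p (fun j => om ^- j * f (iter j g x))); last first.
  by rewrite gp omp expr0.
rewrite mulr_sumr; apply: eq_bigr => j _; rewrite iterSr mulrA; congr (_ * _).
by rewrite exprS invfM mulrA divff // mul1r.
Qed.

Section EquivariantMap.
Variables (R : realType) (n d p : nat).
Local Notation C := (CC R).
Local Notation E := 'cV[C]_n.
Variables (Q A : 'M[C]_n) (Z : set E) (om : C).
Local Notation nr := (colnorm Q).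
Local Notation act := (mulmx A).
Local Notation k := (d + d + 1)%N.
Hypothesis Qu : Q \in unitmx.
Hypothesis nrA : forall x : E, nr (A *m x) = nr x.
Hypothesis p0 : (0 < p)%N.
Hypothesis actp : forall x : E, iter p act x = x.
Hypothesis omp : om ^+ p = 1.
Hypothesis cZ : compact Z.
Hypothesis Zact : forall x, Z x -> Z (A *m x).
Hypothesis Zfree : forall x j, Z x -> (0 < j < p)%N -> iter j act x != x.
Hypothesis dimZ : covering_dim_lt (set_type Z) k.

(* The vanishing of [proj c w] is k = 2d + 1 real conditions on w in C^(d+1): all
   coordinates but the last vanish, and the last one is orthogonal to c. As dim Z < k,
   they can be avoided on Z. *)
Definition proj (c : C) (w : option 'I_d -> C) : 'rV[R]_k :=
  row_mx (row_mx (\row_j complex.Re (w (Some j))) (\row_j complex.Im (w (Some j))))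
    (\row_(j < 1) complex.Re (w None * (c^*)%C)).

Definition lift_proj (c : C) (e : 'rV[R]_k) (i : option 'I_d) : C :=
  if i is Some j
  then (e ord0 (lshift 1 (lshift d j)))%:C + 'i * (e ord0 (lshift 1 (rshift d j)))%:C
  else (e ord0 (rshift (d + d) ord0))%:C * ((c^*)%C)^-1.

Lemma projD c w w' : proj c (fun i => w i + w' i) = proj c w + proj c w'.
Proof.
rewrite /proj !add_row_mx; congr (row_mx (row_mx _ _) _); apply/rowP => j; rewrite !mxE.
- by rewrite raddfD.
- by rewrite raddfD.
by rewrite mulrDl raddfD.
Qed.

Lemma lift_projK c e : c != 0 -> proj c (lift_proj c e) = e.
Proof.
move=> c0; apply/rowP => j; rewrite /proj.
case: (split_ordP j) => j' ->; last first.
  by rewrite row_mxEr mxE [lift_proj _ _ _]/= mulfVK ?conjc_eq0 // (ord1 j').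
rewrite row_mxEl; case: (split_ordP j') => i ->; rewrite ?row_mxEl ?row_mxEr mxE /=;
  by simpc.
Qed.

Lemma proj_bound c w e : (forall i, cabs (w i) <= e) -> forall j, `|proj c w ord0 j| <= (1 + cabs c) * e.
Proof.
move=> we j; have e0 : 0 <= e by apply: le_trans (we None); apply: cabs_ge0.
have c0 := cabs_ge0 c.
rewrite /proj; case: (split_ordP j) => j' ->; last first.
  rewrite row_mxEr mxE; apply: le_trans (cabs_Re _) _; rewrite cabsM.
  have -> : cabs ((c^*)%C) = cabs c by apply: complexI; rewrite -!normC_cabs normcJ.
  rewrite mulrC; apply: le_trans (_ : cabs c * e <= _); first by rewrite ler_wpM2l.
  by rewrite ler_wpM2r // lerDr.
apply: (le_trans _ (_ : e <= _)); last by rewrite mulrDl mul1r lerDl mulr_ge0.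
rewrite row_mxEl; case: (split_ordP j') => i ->; rewrite ?row_mxEl ?row_mxEr mxE.
  exact: le_trans (cabs_Re _) (we _).
exact: le_trans (cabs_Im _) (we _).
Qed.

Lemma proj_eq0 c w : (forall j, w (Some j) = 0) -> complex.Re (w None * (c^*)%C) = 0 -> proj c w = 0.
Proof.
move=> w0 wl; apply/rowP => j; rewrite /proj [RHS]mxE.
case: (split_ordP j) => j' ->; first by rewrite row_mxEl;
  case: (split_ordP j') => i ->; rewrite ?row_mxEl ?row_mxEr mxE w0.
by rewrite row_mxEr mxE.
Qed.

Lemma lift_proj_bound (c : C) (e : 'rV[R]_k) (b : R) : c != 0 -> (forall j, `|e ord0 j| <= b) ->
  forall i, cabs (lift_proj c e i) <= (2 + (cabs c)^-1) * b.
Proof.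
move=> c0 eb i; have cb : 0 <= (cabs c)^-1 by rewrite invr_ge0 cabs_ge0.
have b0 : 0 <= b by apply: le_trans (eb (rshift (d + d) ord0)).
case: i => [j|] /=; last first.
  rewrite cabsM cabsV cabs_real.
  have -> : cabs ((c^*)%C) = cabs c by apply: complexI; rewrite -!normC_cabs normcJ.
  rewrite mulrC; apply: le_trans (_ : (cabs c)^-1 * b <= _); first by rewrite ler_wpM2l.
  by rewrite ler_wpM2r // lerDr.
apply: le_trans (cabsD _ _) _; rewrite cabsM !cabs_real.
have -> : cabs ('i : R[i]) = 1 by rewrite /cabs /= expr0n expr1n /= add0r sqrtr1.
rewrite mul1r; apply: le_trans (_ : 2 * b <= _); last by rewrite ler_wpM2r // lerDl.
by rewrite mulr_natl mulr2n lerD.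
Qed.

(** The ball of radius 2r around z is disjoint from its nontrivial translates, so a function
    supported there can be chosen freely and then spread equivariantly. *)
Definition separated (z : E) (r : R) :=
  0 < r /\ forall x j, nr (x - z) < 2 * r -> (0 < j < p)%N -> 2 * r <= nr (iter j act x - z).

Lemma nr_iter j (x : E) : nr (iter j act x) = nr x.
Proof. by elim: j => //= j IH; rewrite nrA. Qed.

Lemma iter_actB j (x y : E) : iter j act (x - y) = iter j act x - iter j act y.
Proof. by elim: j => //= j ->; rewrite mulmxBr. Qed.

Lemma separated_ex z : Z z -> exists r, separated z r.
Proof.
move=> Zz; pose b := \big[Order.min/1]_(j < p | (0 < j)%N) nr (iter j act z - z).
have b0 : 0 < b.
  apply/bigmin_gtP; split=> // j j0; apply: (colnorm_gt0 Qu); rewrite subr_eq0.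
  by apply: Zfree; rewrite ?j0 ?ltn_ord.
exists (b / 4); split=> [|x j xz /andP[j0 jp]]; first by rewrite divr_gt0.
have bj : b <= nr (iter j act z - z) by apply: (@bigmin_le_cond _ _ _ 1 (Ordinal jp)).
have : nr (iter j act z - z) <= nr (iter j act (z - x)) + nr (iter j act x - z).
  by rewrite iter_actB; apply: le_trans (colnormD _ _ _); rewrite addrA subrK.
rewrite nr_iter -[z - x]opprB colnormN; exact: separation_arith xz bj.
Qed.

Definition cutoff z r (x : E) : R := Num.min 1 (Num.max 0 (2 - nr (x - z) / r)).

Lemma cutoff_cont z r : continuous (cutoff z r).
Proof.
apply: cont_min; first exact: cont_cst.
apply: cont_max; first exact: cont_cst.
apply: contB; first exact: cont_cst.
by apply: contM; [exact: continuous_colnormB | exact: cont_cst].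
Qed.

Lemma cutoff_range z r x : 0 <= cutoff z r x <= 1.
Proof. by rewrite /cutoff ge_min lexx /= le_min ler01 le_max lexx. Qed.

Lemma cutoff1 z r x : 0 < r -> nr (x - z) <= r -> cutoff z r x = 1.
Proof.
move=> r0 h; rewrite /cutoff min_l // le_max; apply/orP; right.
have : nr (x - z) / r <= 1 by rewrite ler_pdivrMr ?mul1r. lra.
Qed.

Lemma cutoff0 z r x : 0 < r -> 2 * r <= nr (x - z) -> cutoff z r x = 0.
Proof.
move=> r0 h; rewrite /cutoff max_l ?min_r //.
have : 2 <= nr (x - z) / r by rewrite ler_pdivlMr. lra.
Qed.

Definition equimap (F : option 'I_d -> E -> C) :=
  (forall i, continuous (F i)) /\ forall i x, F i (A *m x) = om * F i x.

(** The margin eta makes the condition survive the perturbations made later on other balls. *)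
Definition avoids (F : option 'I_d -> E -> C) (eta : R) (t : E * R * C) :=
  forall x, Z x -> nr (x - t.1.1) <= t.1.2 ->
  forall w, (forall i, cabs (w i - F i x) <= eta) -> proj t.2 w != 0.

Lemma continuous_act j : continuous (fun x : E => iter j act x).
Proof.
move=> x U /(nbhs_colnorm _ _ Qu)[e e0 eU]; apply/(nbhs_colnorm _ _ Qu).
exists e; first exact: e0.
by move=> y yx; apply: eU; rewrite -iter_actB nr_iter; exact: yx.
Qed.

Lemma continuous_lift_proj c (e : E -> 'rV[R]_k) i : (forall j, continuous (fun x => e x ord0 j)) ->
  continuous (fun x => lift_proj c (e x) i).
Proof.
move=> ec; have cc j : continuous (fun x => (e x ord0 j)%:C : C).
  exact: (cont_comp (ec j) (@continuous_complex R)).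
rewrite /lift_proj; case: i => [j|]; last by apply: contCM; [exact: cc | exact: contC_cst].
by apply: contCD; [exact: cc | apply: contCM; [exact: contC_cst | exact: cc]].
Qed.

(** Induction over pairs of a ball and a direction c. On the ball around z only the term j = 0 of
    the twisted average survives, so the perturbation e, which is not equivariant, appears there
    unchanged although F' has weight one. *)
Lemma avoid_all (l : seq (E * R * C)) :
  (forall t, t \in l -> separated t.1.1 t.1.2 /\ t.2 != 0) ->
  exists F eta, [/\ equimap F, 0 < eta & forall t, t \in l -> avoids F eta t].
Proof.
elim: l => [|[[z r] c] l IH] hl.
  exists (fun _ _ => 0), 1; split=> //; split=> [i|i x]; first exact: contC_cst.
  by rewrite mulr0.
have [|F [eta [[Fc Fe] eta0 Fa]]] := IH; first by move=> t tl; apply: hl; rewrite inE tl orbT.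
have [[/= r0 sep] /= c0] := hl _ (mem_head _ _).
have cb : 0 < 2 + (cabs c)^-1 :> R by rewrite ltr_pwDl // invr_ge0 cabs_ge0.
(* The bound of [lift_proj_bound] and the p terms of the average then move F by at most eta / 2 on
   Z. The other half of the margin is left for the balls treated before. *)
pose del := eta / 2 / p%:R / (2 + (cabs c)^-1).
have pR : 0 < p%:R :> R by rewrite ltr0n.
have del0 : 0 < del by rewrite !divr_gt0.
pose q x := proj c (fun i => F i x).
have qc j : continuous (fun x => q x ord0 j).
  suff [g gq gc] : exists2 g, (fun x => q x ord0 j) = g & continuous g by rewrite gq.
  case: (split_ordP j) => j' ->; last first.
    exists (fun x => complex.Re (F None x * (c^*)%C)).
      by apply/funext => x; rewrite /q /proj row_mxEr mxE.
    by apply: (cont_comp _ (@continuous_Re R)); apply: contCM; [exact: Fc | exact: contC_cst].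
  case: (split_ordP j') => i ->.
    exists (fun x => complex.Re (F (Some i) x)).
      by apply/funext => x; rewrite /q /proj row_mxEl row_mxEl mxE.
    by apply: (cont_comp _ (@continuous_Re R)); exact: Fc.
  exists (fun x => complex.Im (F (Some i) x)).
    by apply/funext => x; rewrite /q /proj row_mxEl row_mxEr mxE.
  by apply: (cont_comp _ (@continuous_Im R)); exact: Fc.
have nb (x : E) (U : set E) := @nbhs_colnorm R n Q x U Qu.
have [e [ec eb ene]] := nonvanishing_perturbation nb
  (fun x => etrans (congr1 _ (subrr x)) (colnorm0 Q)) (fun a => @continuous_colnormB R n Q a Qu) cZ dimZ qc del0.
pose g i x : C := (cutoff z r x)%:C * lift_proj c (e x) i.
have gc i : continuous (g i).
  apply: contCM; last exact: continuous_lift_proj.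
  apply: (cont_comp _ (@continuous_complex R)); exact: cutoff_cont.
pose F' i x := F i x + \sum_(j < p) om ^- j * g i (iter j act x).
have om0 : om != 0 by apply/eqP => h; move/eqP: omp; rewrite h expr0n gtn_eqF // eq_sym oner_eq0.
have om1 : cabs om = 1 := cabs_unity_root p0 omp.
have Zit j x : Z x -> Z (iter j act x) by move=> Zx; elim: j => //= j; apply: Zact.
have small x i : Z x -> cabs (F' i x - F i x) <= eta / 2.
  move=> Zx; rewrite /F' addrAC subrr add0r; apply: le_trans (cabs_sum _ _) _.
  apply: le_trans (_ : _ <= \sum_(j < p) eta / 2 / p%:R) _; last first.
    by rewrite sumr_const card_ord -[leLHS]mulr_natl mulrC divfK ?gt_eqF.
  apply: ler_sum => j _; rewrite cabsM cabsV cabsX om1 expr1n invr1 mul1r /g cabsM cabs_real.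
  have /andP[h0 h1] := cutoff_range z r (iter j act x); rewrite ger0_norm //.
  apply: le_trans (_ : 1 * cabs (lift_proj c (e (iter j act x)) i) <= _).
    by apply: ler_wpM2r => //; apply: cabs_ge0.
  rewrite mul1r; apply: le_trans (lift_proj_bound c0 _ i) _; first by move=> j'; apply/eb/Zit.
  by rewrite /del mulrC divfK ?gt_eqF.
have loc x i : nr (x - z) <= r -> F' i x = F i x + lift_proj c (e x) i.
  move=> xz; rewrite /F' (bigD1 (Ordinal p0)) //= big1 ?addr0 => [|j j0].
    by rewrite expr0 invr1 mul1r /g cutoff1 // mul1r.
  rewrite /g cutoff0 ?mul0r ?mulr0 //; apply: sep; last by rewrite ltn_ord andbT lt0n.
  by apply: le_lt_trans xz _; rewrite ltr_pMl // ltr1n.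
have ne0 x : Z x -> 0 < \sum_j `|(q x + e x) ord0 j|.
  move=> Zx; rewrite lt_neqAle eq_sym sumr_ge0 // andbT; apply: contra (ene x Zx).
  rewrite psumr_eq0 // => /allP h; apply/eqP/rowP => j; rewrite [RHS]mxE.
  by apply/eqP; have := h j (mem_index_enum _); rewrite normr_eq0.
have sc : continuous (fun x => \sum_j `|(q x + e x) ord0 j|).
  apply: cont_sum => j _; apply: (cont_comp _ (@norm_continuous _ R)).
  rewrite (_ : (fun x => _) = (fun x => q x ord0 j + e x ord0 j)); last first.
    by apply/funext => x; rewrite mxE.
  by apply: contD; [exact: qc | exact: ec].
(* The value kap bounds the l1 size of q + e on Z from below, and b eta' bounds that of the
   projection of an error eta'; the new margin makes b eta' < kap. *)
have [kap kap0 hkap] := compact_pos_min cZ sc ne0.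
pose b := k%:R * (1 + cabs c); have b0 : 0 < b.
  by rewrite mulr_gt0 ?ltr_pwDl ?cabs_ge0 // ltr0n addn1.
pose eta' := Num.min (eta / 2) (kap / b / 2).
have eta'0 : 0 < eta' by rewrite lt_min !divr_gt0.
exists F', eta'; split; [ | exact: eta'0 | ].
  split=> [i|i x].
    apply: contCD => //; apply: contC_sum => j _; apply: contCM; first exact: contC_cst.
    apply: (cont_comp _ (gc i)); exact: continuous_act.
  rewrite /F' Fe mulrDr; congr (_ + _).
  exact: twisted_average.
move=> t; rewrite inE => /orP[/eqP->|tl] x Zx /= xz w hw; last first.
  apply: (Fa t tl x Zx xz) => i; rewrite -(subrK (F' i x) (w i)) -addrA.
  apply: le_trans (cabsD _ _) _; have := small x i Zx; have := hw i.
  have : eta' <= eta / 2 by rewrite ge_min lexx.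
  lra.
apply/eqP => pw; have := hkap x Zx.
have -> : q x + e x = - proj c (fun i => w i - F' i x).
  have -> : q x + e x = proj c (fun i => F' i x).
    rewrite -[e x](lift_projK _ c0) -projD; congr proj; apply/funext => i.
    by rewrite loc.
  apply/eqP; rewrite -addr_eq0 -projD -[X in _ == X]pw; apply/eqP; congr proj.
  by apply/funext => i; rewrite addrC subrK.
apply/negP; rewrite -ltNge; apply: le_lt_trans (_ : \sum_(j < k) (1 + cabs c) * eta' < kap).
  by apply: ler_sum => j _; rewrite mxE normrN; apply: proj_bound.
rewrite sumr_const card_ord -mulr_natl mulrA -/b; apply: le_lt_trans (_ : b * (kap / b / 2) < _).
  by rewrite ler_pM2l // ge_min lexx orbT.
rewrite mulrA [b * _]mulrC divfK ?gt_eqF //; lra.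
Qed.

Theorem avoiding_equimap (cs : seq C) : (forall c, c \in cs -> c != 0) ->
  exists F, equimap F /\ forall x c, Z x -> c \in cs -> proj c (fun i => F i x) != 0.
Proof.
move=> cs0.
have sepx z : exists r : R, 0 < r /\ (Z z -> separated z r).
  have [Zz|nZ] := pselect (Z z); last by exists 1.
  by have [r rs] := separated_ex Zz; exists r; split=> //; case: rs.
have [r hr] := choice sepx.
have [s [sZ sc]] := colnorm_ball_cover Qu cZ (fun x => (hr x).1).
have [|F [eta [Fe eta0 Fa]]] := @avoid_all [seq (z, r z, c) | z <- s, c <- cs].
  by move=> t /allpairsP[[z c] [zs ccs ->]] /=; split; [apply/(hr z).2/sZ | apply: cs0].
exists F; split=> // x c Zx ccs; have [z zs xz] := sc x Zx.
apply: (Fa (z, r z, c)); [by apply/allpairsP; exists (z, c) | exact: Zx | exact: ltW |].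
by move=> i; rewrite subrr cabs0 ltW.
Qed.

End EquivariantMap.

(** * Sectors of the complex plane *)

Section Sectors.
Variables (R : realType) (p : nat) (om : CC R).
Local Notation C := (CC R).
Hypothesis p_pr : prime p.
Hypothesis p_odd : odd p.
Hypothesis om_prim : p.-primitive_root om.

Definition omx (g : 'F_p) : C := om ^+ val g.

Lemma omp : om ^+ p = 1. Proof. exact: prim_expr_order. Qed.

Lemma omxD g h : omx (g + h) = omx g * omx h.
Proof.
rewrite /omx -exprD -[RHS](prim_expr_mod om_prim); congr (om ^+ _).
have -> : val (g + h) = ((val g + val h) %% p)%N.
  by apply: (congr1 (fun r => ((val g + val h) %% r)%N)); apply: Fp_cast.
by [].
Qed.

Lemma omx1 : omx 1 = om.
Proof. by rewrite /omx -[1 : 'F_p]/(1%:R) val_natFp ?prime_gt1. Qed.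

Lemma omx_inj : injective omx.
Proof.
move=> g h /eqP; rewrite (eq_prim_root_expr om_prim) !modn_small ?Fp_val_lt // => /eqP.
exact: val_inj.
Qed.

Lemma omx_neq0 g : omx g != 0.
Proof.
rewrite expf_neq0 //; apply/eqP => h; have := omp; rewrite h expr0n gtn_eqF ?prime_gt0 // => /eqP.
by rewrite eq_sym oner_eq0.
Qed.

Lemma omx_conj g : conjc (omx g) = (omx g)^-1.
Proof.
have h : cabs (omx g) = 1 by rewrite cabsX (cabs_unity_root (prime_gt0 p_pr) omp) expr1n.
apply: (mulfI (omx_neq0 g)); rewrite divff ?omx_neq0 //.
by rewrite -sqr_normc normC_cabs h expr1n.
Qed.

Definition sector (g : 'F_p) (z : C) : Prop :=
  forall h, h != g -> complex.Re (z * conjc (omx h)) < complex.Re (z * conjc (omx g)).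

Lemma sector_uniq g h z : sector g z -> sector h z -> g = h.
Proof.
move=> sg sh; apply/eqP; apply: contraT => gh.
have := lt_trans (sg h _) (sh g gh); rewrite ltxx; apply.
by rewrite eq_sym.
Qed.

Lemma sector_om g z : sector g z -> sector (g + 1) (om * z).
Proof.
move=> sg h hg; have e (a : 'F_p) : om * z * conjc (omx (a + 1)) = z * conjc (omx a).
  rewrite !omx_conj omxD omx1 invfM [om * z]mulrC -mulrA [om * _]mulrC -mulrA mulVf ?mulr1 //.
  by rewrite -omx1 omx_neq0.
rewrite -(subrK 1 h) !e; apply: sg; apply: contra hg => /eqP<-.
by rewrite subrK.
Qed.

Lemma sector0 g : ~ sector g 0.
Proof.
move=> /(_ (g + 1)); rewrite !mul0r ltxx => h; have : false; last by [].
by apply: h; rewrite -subr_eq0 addrAC subrr add0r oner_eq0.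
Qed.

Lemma tie z : (forall g, ~ sector g z) ->
  exists g h, g != h /\ complex.Re (z * conjc (omx g - omx h)) = 0.
Proof.
move=> ns; pose F g := complex.Re (z * conjc (omx g)).
have [g _ gmax] : exists2 g, true & forall h, F h <= F g.
  by case: (@Order.TotalTheory.arg_maxP _ _ _ 0 xpredT F isT) => g _ h; exists g => // a; apply: h.
have [h [hg hF]] : exists h, h != g /\ F g <= F h.
  apply: contrapT => nh; apply: (ns g) => h hg; rewrite ltNge; apply/negP => hF.
  by apply: nh; exists h.
exists g, h; split; first by rewrite eq_sym.
rewrite rmorphB mulrBr raddfB; apply/eqP; rewrite subr_eq0; apply/eqP/le_anti.
by rewrite hF gmax.
Qed.

(** A tie between the roots u and v says that z conj(u - v) is purely imaginary, that is z = conj(z)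
    u v. The p-th power removes the factor u v. *)
Lemma tie_real z : (forall g, ~ sector g z) -> conjc (z ^+ p) = z ^+ p.
Proof.
move=> /tie[g [h [gh re0]]]; set u := omx g in re0 *; set v := omx h in re0 *.
have uv : u - v != 0 by rewrite subr_eq0 (inj_eq omx_inj).
have e : z * (u^-1 - v^-1) = - (conjc z * (u - v)).
  apply/eqP; rewrite -addr_eq0; have := addcJ (z * conjc (u - v)); rewrite re0.
  have -> : conjc (z * conjc (u - v)) = conjc z * (u - v).
    by rewrite (rmorphM (@conjc R)) /= conjcK.
  have -> : conjc (u - v) = u^-1 - v^-1 by rewrite (rmorphB (@conjc R)) /= !omx_conj.
  by rewrite mulr0 => ->.
have zc : z = conjc z * (u * v).
  apply: (mulIf uv); have -> : conjc z * (u * v) * (u - v) = - (conjc z * (u - v)) * - (u * v) by ring.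
  rewrite -e -[LHS]mulr1; have u0 : u != 0 := omx_neq0 g; have v0 : v != 0 := omx_neq0 h.
  by field; rewrite u0 v0.
rewrite rmorphXn {2}zc exprMn exprMn -!exprM !(mulnC _ p) !exprM omp !expr1n !mulr1.
by [].
Qed.

(* If z and iz both lie on ties then z^p and (iz)^p are both real, although i^p is not. *)
Lemma sector_cover z : z != 0 -> exists g, sector g z \/ sector g ('i * z).
Proof.
move=> z0; apply: contrapT => ns.
have h1 : conjc (z ^+ p) = z ^+ p by apply: tie_real => g sg; apply: ns; exists g; left.
have h2 : conjc (('i * z) ^+ p) = ('i * z) ^+ p by apply: tie_real => g sg; apply: ns; exists g; right.
have ip : ('i ^+ p : R[i]) = (-1) ^+ p./2 * 'i.
  by rewrite -{1}(odd_double_half p) p_odd exprD expr1 -mul2n exprM sqr_i mulrC.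
have key (w : R[i]) k : conjc w = w -> conjc ((-1) ^+ k * 'i * w) = (-1) ^+ k * 'i * w -> w = 0.
  rewrite -signr_odd; case: w (odd k) => a b [] /=; rewrite ?expr0 ?expr1; simpc => -[hb];
    move=> [ha]; apply/eqP; rewrite eq_complex /=; apply/andP; split; apply/eqP; lra.
have h3 : ('i * z) ^+ p = (-1) ^+ p./2 * 'i * z ^+ p by rewrite exprMn ip.
rewrite h3 in h2; move/eqP: (key _ _ h1 h2); rewrite expf_eq0 (negbTE z0) andbF //.
Qed.

End Sectors.

(** * Labels from a cover by sectors *)

Section Labels.
Variables (R : realType) (n p N : nat).
Local Notation C := (CC R).
Local Notation E := 'cV[C]_n.
Variables (Q A : 'M[C]_n) (om : C) (phi : E -> R) (psi : nat -> E -> C).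
Local Notation nr := (colnorm Q).
Local Notation act := (mulmx A).
Hypothesis p_pr : prime p.
Hypothesis om_prim : p.-primitive_root om.
Hypothesis Qu : Q \in unitmx.
Hypothesis nrA : forall x : E, nr (A *m x) = nr x.
Hypothesis actp : forall x : E, iter p act x = x.
Hypothesis phi_act : forall x : E, phi (A *m x) = phi x.
Hypothesis phi_cont : continuous phi.
Hypothesis psi_cont : forall i, continuous (psi i).
Hypothesis psi_act : forall i x, psi i (A *m x) = om * psi i x.
Hypothesis cover : forall x, phi x = 0 -> exists i (g : 'F_p), (i < N)%N /\ sector om g (psi i x).
Variables (K : set E) (cK : compact K).

Lemma sector_near i (g : 'F_p) x : sector om g (psi i x) -> \forall y \near x, sector om g (psi i y).
Proof.
move=> sg.
have : \forall y \near x, forall h : 'F_p, h != g ->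
    complex.Re (psi i y * conjc (omx om h)) < complex.Re (psi i y * conjc (omx om g)).
  apply: (@filter_forall _ _ _ _ (@nbhs_filter E x)) => h; have [hg|hg] := eqVneq h g.
    by apply: (@filterE _ _ (@nbhs_filter E x)).
  have c (a : C) : continuous (fun y => complex.Re (psi i y * a)).
    by apply: (cont_comp _ (@continuous_Re R)); apply: contCM; [exact: psi_cont | exact: contC_cst].
  have cd := contB (c (conjc (omx om g))) (c (conjc (omx om h))).
  have := @near_gt _ _ _ 0 x cd; rewrite subr_gt0 => /(_ (sg h hg)); apply: (@filterS _ _ (@nbhs_filter E x)) => y.
  by rewrite subr_gt0.
by apply: (@filterS _ _ (@nbhs_filter E x)).
Qed.

Variant alternative := Neg | Pos | Lev of nat & 'F_p.

Definition holds (a : alternative) (y : E) : Prop :=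
  match a with
  | Neg => phi y < 0
  | Pos => 0 < phi y
  | Lev i g => (i < N)%N /\ sector om g (psi i y)
  end.

Lemma lebesgue_number : exists2 eps : R, 0 < eps &
  forall x, K x -> exists a, forall y, nr (y - x) < eps -> holds a y.
Proof.
have loc (x : E) : exists ra : R * alternative, 0 < ra.1 /\
    forall y, nr (y - x) < ra.1 + ra.1 -> holds ra.2 y.
  have [a ha] : exists a, \forall y \near x, holds a y.
    have [ph|ph|ph] := ltgtP (phi x) 0.
    - exists Neg; exact: near_lt phi_cont ph.
    - exists Pos; exact: near_gt phi_cont ph.
    have [i [g [iN sg]]] := cover ph; exists (Lev i g).
    by apply: (@filterS _ _ (@nbhs_filter E x)) (sector_near sg) => y.
  have [e e0 he] := (nbhs_colnorm _ _ Qu).1 ha.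
  by exists (e / 2, a); rewrite /= -splitr; split=> //; rewrite divr_gt0.
have [ra hra] := choice loc.
have [s [sK sc]] := colnorm_ball_cover Qu cK (fun x => (hra x).1).
have [eps eps0 heps] := seq_lower_bound s (fun x => (hra x).1).
exists eps => // y Ky; have [x xs yx] := sc y Ky; exists (ra x).2 => z zy.
apply: (hra x).2; rewrite -(subrK y z) -addrA; apply: le_lt_trans (colnormD _ _ _) _.
exact: ltrD (lt_le_trans zy (heps _ xs)) yx.
Qed.

Variables (eps : R) (eps0 : 0 < eps).
Hypothesis leb : forall x, K x -> exists a, forall y, nr (y - x) < eps -> holds a y.

(** The condition on the whole eps-ball makes labels of nearby points comparable: each point lies in
    the other's ball, and sectors of one level are disjoint. *)
Definition in_level i (g : 'F_p) (x : E) := forall y, nr (y - x) < eps -> sector om g (psi i y).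
Definition negative (x : E) := forall y, nr (y - x) < eps -> phi y < 0.

(** If no level works, [find] returns the length N of the list. *)
Definition free_lev (x : E) : nat := find (fun i => `[< exists g, in_level i g x >]) (iota 0 N).

(** Sectors take precedence. Level N + 1 is left, within K, to points whose eps-ball lies in {phi >
    0}, by the alternatives of [lebesgue_number]. *)
Definition lev (x : E) : nat :=
  if (free_lev x < N)%N then free_lev x else if `[< negative x >] then N else N.+1.

Definition grp (x : E) : 'F_p := xget 0 [set g | in_level (lev x) g x].

Lemma near_self x : nr (x - x) < eps. Proof. by rewrite subrr colnorm0. Qed.

Lemma lev_free x : (lev x < N)%N -> in_level (lev x) (grp x) x.
Proof.
move=> lx; have fx : (free_lev x < N)%N.
  rewrite ltnNge; apply/negP => fN; move: lx; rewrite /lev [(free_lev x < N)%N]ltnNge fN /=.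
  by case: ifP => _; rewrite ltnNge ?leqnn ?leqnSn.
suff h : exists g, in_level (lev x) g x by exact: (xgetPex 0 h).
rewrite /lev fx; apply/asboolP; have := nth_find 0%N (a := fun i => `[< exists g, in_level i g x >]) (s := iota 0 N).
by rewrite has_find size_iota => /(_ fx); rewrite nth_iota.
Qed.

Lemma free_lev_lt x i g : (i < N)%N -> in_level i g x -> (free_lev x < N)%N.
Proof.
move=> iN h; rewrite /free_lev -[X in (_ < X)%N](size_iota 0 N) -has_find.
apply/hasP; exists i; first by rewrite mem_iota.
by apply/asboolP; exists g.
Qed.

Lemma lev_neg x : lev x = N -> negative x.
Proof.
rewrite /lev; case: ltnP => [h e|_]; first by rewrite e ltnn in h.
by case: asboolP => // _ /eqP; rewrite -[X in _ == X]addn0 -addn1 eqn_add2l.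
Qed.

Lemma act_surj (y : E) : exists y', y = A *m y'.
Proof.
exists (iter p.-1 act y); rewrite -[RHS]iterS prednK ?prime_gt0 // actp.
Qed.

Lemma in_level_act i g x : in_level i g x -> in_level i (g + 1) (A *m x).
Proof.
move=> h y; have [y' ->] := act_surj y; rewrite -mulmxBr nrA => yx.
rewrite psi_act; apply: (sector_om p_pr om_prim); exact: h yx.
Qed.

Lemma negative_act x : negative x -> negative (A *m x).
Proof.
move=> h y; have [y' ->] := act_surj y; rewrite -mulmxBr nrA phi_act; exact: h.
Qed.

Lemma act_invariant (P : E -> Prop) x : (forall y, P y -> P (A *m y)) -> P (A *m x) -> P x.
Proof.
move=> h Px; have -> : x = iter p.-1 act (A *m x).
  by rewrite -iterSr prednK ?prime_gt0 // actp.
elim: (p.-1) => [|j IH]; [exact: Px | rewrite iterS; exact: h].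
Qed.

Lemma lev_act (x : E) : lev (A *m x) = lev x.
Proof.
have e1 : free_lev (A *m x) = free_lev x.
  apply: eq_find => i; apply/asboolP/asboolP => h.
    apply: (@act_invariant (fun y => exists g, in_level i g y)) h => y [g hg].
    by exists (g + 1); apply: in_level_act.
  by case: h => g hg; exists (g + 1); apply: in_level_act.
have e2 : `[< negative (A *m x) >] = `[< negative x >].
  apply/asboolP/asboolP; last exact: negative_act.
  by apply: act_invariant => y; apply: negative_act.
exact: (congr2 (fun a (b : bool) => if (a < N)%N then a else if b then N else N.+1) e1 e2).
Qed.

Lemma grp_act (x : E) : (lev x < N)%N -> grp (A *m x) = grp x + 1.
Proof.
move=> lx; have lax : (lev (A *m x) < N)%N by rewrite lev_act.
have h1 := lev_free lax (near_self _); have h2 := in_level_act (lev_free lx) (near_self _).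
by rewrite lev_act in h1; apply: sector_uniq h1 h2.
Qed.

Lemma grp_near x y : nr (x - y) < eps -> lev x = lev y -> (lev x < N)%N -> grp x = grp y.
Proof.
move=> xy e lx; have h1 := lev_free lx (near_self _).
rewrite e in lx h1; exact: sector_uniq h1 (lev_free lx xy).
Qed.

Lemma lev_near x y : K y -> nr (x - y) < eps -> lev x = N -> (lev y <= N)%N.
Proof.
move=> Ky xy lx; have xn := lev_neg lx.
rewrite /lev; case: ltnP => [/ltnW h|fy]; first exact: h.
case: asboolP => [_|nny]; first exact: leqnn.
have [[||i g] h] := leb Ky.
- by case: nny.
- have := h x xy; have := xn x (near_self x); rewrite /= => h1 h2.
  by have := lt_trans h1 h2; rewrite ltxx.
have [iN _] := h y (near_self y).
by have := @free_lev_lt y i g iN (fun z zy => (h z zy).2); rewrite ltnNge fy.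
Qed.

Lemma lev0 : K 0 -> phi 0 < 0 -> lev 0 = N.
Proof.
move=> K0 ph; have psi0 i : psi i 0 = 0.
  have := psi_act i 0; rewrite mulmx0 => /eqP; rewrite -[X in X == _]mul1r -subr_eq0 -mulrBl mulf_eq0.
  case/orP=> [|/eqP//]; rewrite subr_eq0 => /eqP om1.
  have := prim_order_dvd om_prim 1; rewrite expr1 om1 eqxx dvdn1 => /eqP p1.
  by move: p_pr; rewrite p1.
rewrite /lev; case: ltnP => [h|_].
  have lh : (lev 0 < N)%N by rewrite /lev h.
  by have := lev_free lh (near_self 0); rewrite psi0 => /sector0.
case: asboolP => [_|nn]; first reflexivity.
have [[||i g] h] := leb K0.
- by case: nn.
- by have := h 0 (near_self 0); rewrite /= => /(lt_trans ph); rewrite ltxx.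
by have [_] := h 0 (near_self 0); rewrite psi0 => /sector0.
Qed.

End Labels.

(** * Vertices, half-spaces and the obstruction for a diagonal action *)

Section DiagonalAction.
Variables (R : realType) (n p : nat).
Local Notation C := (CC R).
Local Notation E := 'cV[C]_n.+1.
Variables (Q A : 'M[C]_n.+1) (om : C) (al : 'I_n.+1 -> C).
Local Notation nr := (colnorm Q).
Local Notation act := (mulmx A).
Hypothesis p_pr : prime p.
Hypothesis p_odd : odd p.
Hypothesis om_prim : p.-primitive_root om.
Hypothesis Qu : Q \in unitmx.
Hypothesis QA : forall (x : E) j, (Q *m (A *m x)) j ord0 = al j * (Q *m x) j ord0.
Hypothesis alp : forall j, al j ^+ p = 1.

Lemma Q_iter j (x : E) i : (Q *m iter j act x) i ord0 = al i ^+ j * (Q *m x) i ord0.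
Proof. by elim: j => [|j IH]; rewrite ?expr0 ?mul1r // iterS QA IH exprS mulrA. Qed.

Lemma Q_inj (x y : E) : (forall i, (Q *m x) i ord0 = (Q *m y) i ord0) -> x = y.
Proof. by move=> h; rewrite -(mulKmx Qu x) -(mulKmx Qu y); congr (_ *m _); apply/colP. Qed.

Lemma iter_act_p (x : E) : iter p act x = x.
Proof. by apply: Q_inj => i; rewrite Q_iter alp mul1r. Qed.

Lemma cabs_unity (z : C) : z ^+ p = 1 -> cabs z = 1.
Proof.
exact: cabs_unity_root (prime_gt0 p_pr).
Qed.

Lemma nr_act (x : E) : nr (A *m x) = nr x.
Proof. by apply: eq_bigr => j _; rewrite QA cabsM cabs_unity ?mul1r. Qed.

(* Two consecutive vertices on each coordinate axis: the joins of their orbits under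
   the action form a sphere of real dimension 2n+1. *)
Definition vertex (r : R) (q : nat) : E := invmx Q *m (r%:C *: delta_mx (inord q./2) ord0).

Lemma Q_vertex r q i : (Q *m vertex r q) i ord0 = if i == inord q./2 then r%:C else 0.
Proof. by rewrite /vertex mulKVmx // !mxE eqxx andbT; case: eqP; rewrite ?mulr1 ?mulr0. Qed.

Lemma nr_vertex r q : 0 <= r -> nr (vertex r q) = r.
Proof.
move=> r0; rewrite /colnorm (bigD1 (inord q./2)) //= big1 ?addr0 => [|i iq].
  by rewrite Q_vertex eqxx cabs_real ger0_norm.
by rewrite Q_vertex (negbTE iq) cabs0.
Qed.

(* -1 is not a p-th root of unity for odd p. *)
Lemma unity_gap : exists2 d : R, 0 < d & forall z : C, z ^+ p = 1 -> d <= 1 + complex.Re z.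
Proof.
have pos (z : C) : z ^+ p = 1 -> 0 < 1 + complex.Re z.
  move=> zp; have z1 := cabs_unity zp.
  have := cabs_Re z; rewrite z1 ler_norml => /andP[h _].
  have h0 : 0 <= 1 + complex.Re z by rewrite addrC -lerBlDr sub0r.
  rewrite lt_neqAle h0 andbT; apply/eqP => e.
  have re : complex.Re z = -1 by apply/eqP; rewrite -addr_eq0 addrC -e.
  have := add_Re2_Im2 z; rewrite normC_cabs z1 expr1n re sqrrN expr1n => /complexI/eqP.
  rewrite -subr_eq0 addrAC subrr add0r sqrf_eq0 => /eqP im.
  have zm : z = -1 by apply/eqP; rewrite eq_complex re im /= oppr0 !eqxx.
  move: zp; rewrite zm -signr_odd p_odd expr1 => /eqP.
  by rewrite -subr_eq0 -opprD oppr_eq0 -mulr2n pnatr_eq0.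
have [d d0 hd] : exists2 d : R, 0 < d & forall j : 'I_p, d <= 1 + complex.Re (om ^+ j).
  exists (\big[Order.min/1]_(j < p) (1 + complex.Re (om ^+ j))).
    apply/bigmin_gtP; split=> // j _; apply: pos.
    by rewrite exprAC (prim_expr_order om_prim) expr1n.
  by move=> j; apply: bigmin_le.
by exists d => // z /(prim_rootP om_prim)[j ->].
Qed.

(* [height t] is a real linear form which is bounded below on the simplex with
   vertices A^(t q) (vertex q): on the axis j, the two vertices are multiples of roots
   of unity a and b, and Re (a conj (a + b)) = 1 + Re (a conj b). *)
Definition direction (t : nat -> nat) (j : 'I_n.+1) : C :=
  al j ^+ t j.*2 + al j ^+ t j.*2.+1.

Definition height (t : nat -> nat) (x : E) : R :=
  \sum_j complex.Re ((Q *m x) j ord0 * conjc (direction t j)).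

Lemma heightD t x y : height t (x + y) = height t x + height t y.
Proof.
rewrite /height -big_split; apply: eq_bigr => j _ /=.
by rewrite mulmxDr mxE mulrDl raddfD.
Qed.

Lemma heightZ t (a : R) x : height t (a%:C *: x) = a * height t x.
Proof.
rewrite /height mulr_sumr; apply: eq_bigr => j _; rewrite -scalemxAr mxE -mulrA.
exact: Re_realM.
Qed.

Lemma height_le t x : height t x <= 2 * nr x.
Proof.
rewrite /height /colnorm mulr_sumr; apply: ler_sum => j _.
apply: le_trans (ler_norm _) _; apply: le_trans (cabs_Re _) _; rewrite cabsM mulrC.
apply: ler_wpM2r; first exact: cabs_ge0.
have -> : cabs (conjc (direction t j)) = cabs (direction t j) by apply: complexI; rewrite -!normC_cabs normcJ.
apply: le_trans (cabsD _ _) _; rewrite !cabsX !cabs_unity // !expr1n; lra.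
Qed.

Lemma height_vertex t r d q : 0 <= r -> (q < n.+1.*2)%N ->
  (forall z : C, z ^+ p = 1 -> d <= 1 + complex.Re z) ->
  d * r <= height t (iter (t q) act (vertex r q)).
Proof.
move=> r0 qn hd; pose j : 'I_n.+1 := inord q./2.
have jq : (j : nat) = q./2.
  apply: inordK; rewrite -ltn_double; apply: leq_ltn_trans qn.
  by rewrite -[X in (_ <= X)%N]odd_double_half leq_addl.
rewrite /height (bigD1 j) //= big1 ?addr0 => [|i ij]; last first.
  by rewrite Q_iter Q_vertex (negbTE ij) mulr0 mul0r.
rewrite Q_iter Q_vertex eqxx.
pose a := al j ^+ t q; pose b := al j ^+ t (if odd q then j.*2 else j.*2.+1).
have dir : direction t j = a + b.
  rewrite /direction /a /b jq; move: (al j) (odd_double_half q) => z.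
  by case: (odd q) => qe; rewrite -[in t q]qe ?add1n ?add0n // addrC.
have ap : a ^+ p = 1 by rewrite -exprM mulnC exprM alp expr1n.
have bp : b ^+ p = 1 by rewrite -exprM mulnC exprM alp expr1n.
have -> : a * r%:C * conjc (direction t j) = r%:C * (1 + a * conjc b).
  have aa : a * conjc a = 1 by rewrite -sqr_normc normC_cabs cabs_unity // expr1n.
  rewrite dir (rmorphD (@conjc R)) /= -aa.
  by rewrite [a * _]mulrC -mulrA mulrDr.
have h : d <= 1 + complex.Re (a * conjc b).
  apply: hd; rewrite exprMn ap mul1r -rmorphXn /= bp; exact: conjc1.
have -> : complex.Re (r%:C * (1 + a * conjc b)) = r * (1 + complex.Re (a * conjc b)).
  by rewrite Re_realM; case: (a * conjc b) => u v.
by rewrite mulrC ler_wpM2l.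
Qed.

Lemma natrC k : (k%:R : R[i]) = (k%:R : R)%:C.
Proof. by rewrite rmorph_nat. Qed.

Lemma bary_closed_height t b : bary_closed (fun x : 'cV[R[i]]_n.+1 => b <= height t x).
Proof.
move=> s s0 h; have hs : height t (\sum_(x <- s) x) = \sum_(x <- s) height t x.
  elim: (s) => [|x l IH]; last by rewrite !big_cons heightD IH.
  have := heightD t 0 0; rewrite addr0 !big_nil => /eqP.
  by rewrite -subr_eq0 opprD addrA subrr sub0r oppr_eq0 => /eqP.
have sp : 0 < (size s)%:R :> R by rewrite ltr0n lt0n size_eq0.
have -> : bary s = ((size s)%:R^-1 : R)%:C *: (\sum_(x <- s) x).
  by rewrite /bary natrC fmorphV.
rewrite heightZ hs ler_pdivlMl // mulr_natl -[_ *+ _]iter_addr_0 -(count_predT s) -big_const_seq.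
by rewrite big_seq [leRHS]big_seq; apply: ler_sum => x /h.
Qed.

Lemma nr_inv_nat k (x : 'cV[R[i]]_n.+1) : nr (k.+1%:R^-1 *: x) = k.+1%:R^-1 * nr x.
Proof. by rewrite [LHS]colnormZ cabsV natrC cabs_real ger0_norm ?ler0n. Qed.

Lemma bary_closed_nr b : bary_closed (fun x : 'cV[R[i]]_n.+1 => nr x <= b).
Proof.
move=> s s0 h; rewrite -[bary s]subr0.
apply: (bary_closed_ball (@colnormD _ _ Q) (@colnorm0 _ _ Q) nr_inv_nat s0) => x /h.
by rewrite subr0.
Qed.

Theorem no_equivariant_cover (phi : E -> R) (psi : nat -> E -> C) :
  continuous phi -> (forall x : E, phi (A *m x) = phi x) ->
  (forall i, continuous (psi i)) -> (forall i x, psi i (A *m x) = om * psi i x) ->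
  phi 0 < 0 -> (exists r, forall x, r < nr x -> 0 < phi x) ->
  (forall x, phi x = 0 -> exists i (g : 'F_p), (i < n.*2.+1)%N /\ sector om g (psi i x)) -> False.
Proof.
move=> phic phia psic psia ph0 [r0 hr0] cover.
(* With this r the half-space height >= d r lies in {nr >= |r0| + 1} by [height_le], hence in {phi >
   0}. *)
have [d d0 hd] := unity_gap; pose r := 2 * (`|r0| + 1) / d.
have rpos : 0 < r by rewrite divr_gt0 // mulr_gt0 // ltr_wpDl.
pose K := [set x : E | nr x <= r].
have cK : compact K by apply: compact_colnorm.
have K0 : K 0 by rewrite /K /= colnorm0 ltW.
have [eps eps0 leb] := lebesgue_number Qu phic psic cover cK.
pose l := @lev R n.+1 p n.*2.+1 Q om phi psi eps.
pose gr := @grp R n.+1 p n.*2.+1 Q om phi psi eps.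
have Kact (x : 'cV[R[i]]_n.+1) : K x -> K (A *m x) by rewrite /K /= nr_act.
have Kv q : (q <= n.*2.+1)%N -> K (vertex r q) by move=> _; rewrite /K /= nr_vertex ?lexx ?ltW.
have lact (x : 'cV[R[i]]_n.+1) : K x -> l (A *m x) = l x.
  by move=> _; apply: (lev_act _ p_pr om_prim nr_act iter_act_p phia psia).
have gact (x : 'cV[R[i]]_n.+1) : K x -> (l x < n.*2.+1)%N -> gr (A *m x) = gr x + 1.
  by move=> _; apply: (grp_act p_pr om_prim nr_act iter_act_p phia psia eps0).
have gnear (x y : 'cV[R[i]]_n.+1) : K x -> K y -> nr (x - y) < eps -> l x = l y ->
    (l x < n.*2.+1)%N -> gr x = gr y.
  by move=> _ _; apply: (grp_near eps0).
have lnear (x y : 'cV[R[i]]_n.+1) : K x -> K y -> nr (x - y) < eps -> l x = n.*2.+1 ->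
    (l y <= n.*2.+1)%N.
  by move=> _; apply: (lev_near eps0 leb).
have l0 : l 0 = n.*2.+1 by apply: (lev0 p_pr om_prim psia eps0 leb K0 ph0).
have far (t : nat -> nat) : exists C' : 'cV[R[i]]_n.+1 -> Prop,
    [/\ bary_closed C', forall q, (q <= n.*2.+1)%N -> C' (iter (t q) act (vertex r q)) &
      forall x, K x -> C' x -> l x <> n.*2.+1].
  exists (fun x => d * r <= height t x); split.
  - exact: bary_closed_height.
  - by move=> q qN; apply: height_vertex hd; [exact: ltW | rewrite doubleS].
  move=> x _ hx lx; have := lev_neg lx (near_self Q eps0 x).
  have : 0 < phi x.
    apply: hr0; have := le_trans hx (height_le t x); rewrite /r mulrC divfK ?gt_eqF //.
    rewrite ler_pM2l // => h; apply: lt_le_trans h.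
    by apply: le_lt_trans (ler_norm _) _; rewrite ltrDl.
  by move=> h1 /(lt_trans h1); rewrite ltxx.
apply: (@no_labelling p R[i] 'cV[R[i]]_n.+1 R nr (mulmx A) l gr n.*2.+1 (vertex r) K eps r p_pr
  (@colnormD _ _ Q) (@colnormN _ _ Q) (@colnorm0 _ _ Q) nr_inv_nat iter_act_p eps0
  (@bary_closed_nr r) Kact (fun x Kx => Kx) K0 Kv lact gact gnear lnear l0 far).
Qed.

End DiagonalAction.

(** * Dimension of the zero set *)

Lemma prime_unity_order (K : fieldType) (p : nat) (om z : K) j : prime p -> p.-primitive_root om ->
  z ^+ p = 1 -> z != 1 -> z ^+ j = 1 -> (p %| j)%N.
Proof.
move=> pp op /(prim_rootP op)[a ->] a1 /eqP; rewrite -exprM -(prim_order_dvd op) Euclid_dvdM //.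
case/orP=> // pa; case/eqP: a1; apply/eqP; by rewrite -(prim_order_dvd op).
Qed.

Section ZeroSetDimension.
Variables (R : realType) (n m p : nat).
Local Notation C := (CC R).
Local Notation E := 'cV[C]_n.+1.
Variables (Q A : 'M[C]_n.+1) (om : C) (al : 'I_n.+1 -> C) (phi : E -> R) (fv : 'I_m -> E -> C).
Local Notation nr := (colnorm Q).
Local Notation act := (mulmx A).
Hypothesis p_pr : prime p.
Hypothesis p_odd : odd p.
Hypothesis om_prim : p.-primitive_root om.
Hypothesis Qu : Q \in unitmx.
Hypothesis QA : forall (x : E) j, (Q *m (A *m x)) j ord0 = al j * (Q *m x) j ord0.
Hypothesis alp : forall j, al j ^+ p = 1.
Hypothesis al1 : forall j, al j != 1.
Hypothesis mn : (m <= n)%N.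
Hypothesis phic : continuous phi.
Hypothesis phia : forall x : E, phi (A *m x) = phi x.
Hypothesis ph0 : phi 0 < 0.
Hypothesis ph_large : exists r, forall x, r < nr x -> 0 < phi x.
Hypothesis fvc : forall j, continuous (fv j).
Hypothesis fva : forall j x, fv j (A *m x) = om * fv j x.

Definition zero_set : set E := [set x | phi x = 0 /\ forall j, fv j x = 0].

Lemma zero_set_compact : compact zero_set.
Proof.
have [r hr] := ph_large; apply: (@subclosed_compact _ _ [set x : E | nr x <= r]).
- have -> : zero_set = (phi @^-1` [set 0]) `&` \bigcap_(j in [set: 'I_m]) ((cabs \o fv j) @^-1` [set 0]).
    apply/seteqP; split=> x /=.
      by case=> h1 h2; split=> // j _ /=; rewrite h2 cabs0.
    by case=> h1 h2; split=> // j; apply/eqP; rewrite -cabs_eq0; apply/eqP/(h2 j).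
  apply: closedI; first by apply: closed_comp => [x _|]; [exact: phic | exact: closed_eq].
  apply: closed_bigI => j _; apply: closed_comp => [x _|]; last exact: closed_eq.
  by have h := cont_comp (@fvc j) (@continuous_cabs R); exact: h.
- exact: compact_colnorm.
by move=> x [px _] /=; rewrite leNgt; apply/negP => /hr; rewrite px ltxx.
Qed.

Lemma zero_set_act x : zero_set x -> zero_set (A *m x).
Proof. by case=> h1 h2; split=> [|j]; rewrite ?phia ?fva ?h2 ?mulr0. Qed.

(** All eigenvalues have exact order p, so a vector fixed by a smaller power is 0, and phi 0 < 0
    excludes 0. *)
Lemma zero_set_free x j : zero_set x -> (0 < j < p)%N -> iter j act x != x.
Proof.
move=> [px _] /andP[j0 jp]; apply/eqP => e; have /eqP := px; rewrite lt_eqF //.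
suff -> : x = 0 by [].
apply: (Q_inj Qu) => i; rewrite mulmx0 [RHS]mxE; apply/eqP; apply: contraT => xi.
have := Q_iter QA j x i; rewrite e => /eqP; rewrite -[X in X == _]mul1r -subr_eq0 -mulrBl mulf_eq0.
rewrite (negbTE xi) orbF subr_eq0 => /eqP/esym/(prime_unity_order p_pr om_prim (alp i) (al1 i)).
by move/dvdn_leq => /(_ j0); rewrite leqNgt jp.
Qed.

Definition twist (b : bool) (z : C) : C := if b then 'i * z else z.

Lemma twist_cont b (f : E -> C) : continuous f -> continuous (fun x => twist b (f x)).
Proof.
case: b => fc; last exact: fc.
by apply: contCM; [exact: contC_cst | exact: fc].
Qed.

Lemma twistM b (a z : C) : twist b (a * z) = a * twist b z.
Proof. by case: b; rewrite /twist // mulrCA. Qed.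

Theorem zero_set_dim_ge : covering_dim_ge (set_type zero_set) (2 * (n.+1 - m) - 1)%N.
Proof.
pose d := (n - m)%N; have -> : (2 * (n.+1 - m) - 1 = d + d + 1)%N by rewrite /d; lia.
move=> dimZ.
(* A tie between the roots g and h is orthogonality to their difference, so finitely many directions
   cover all ties. *)
pose cs := [seq omx om gh.1 - omx om gh.2 | gh <- enum {: 'F_p * 'F_p} & gh.1 != gh.2].
have [|F [[Fc Fa] Fne]] := @avoiding_equimap R n.+1 d p Q A zero_set om Qu
  (nr_act p_pr QA alp) (prime_gt0 p_pr) (iter_act_p Qu QA alp) (prim_expr_order om_prim)
  zero_set_compact zero_set_act zero_set_free dimZ cs.
  move=> c /mapP[[g h]]; rewrite mem_filter /= => /andP[gh _] ->.
  by rewrite subr_eq0 (inj_eq (omx_inj p_pr om_prim)).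
pose fvn j x := if insub j is Some o then fv o x else 0 : C.
pose Fn j x := if insub j is Some o then F (Some o) x else 0 : C.
(* Levels come in pairs psi and i psi, whose sectors together cover C \ 0, except for the
   last one, which is only needed away from the ties. *)
pose psi i x : C :=
  if (i < m.*2)%N then twist (odd i) (fvn i./2 x) else
  if (i - m.*2 < d.*2)%N then twist (odd (i - m.*2)) (Fn (i - m.*2)./2 x) else F None x.
apply: (@no_equivariant_cover R n p Q A om al p_pr p_odd om_prim Qu QA alp phi psi) => //.
- move=> i; rewrite /psi; case: (i < m.*2)%N.
    by apply: twist_cont; rewrite /fvn; case: (insub i./2 : option 'I_m) => [j|]; [exact: fvc | exact: contC_cst].
  case: (i - m.*2 < d.*2)%N; last exact: Fc.
  by apply: twist_cont; rewrite /Fn; case: (insub _ : option 'I_d) => [j|]; [exact: Fc | exact: contC_cst].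
- move=> i x; rewrite /psi; case: ifP => _.
    by rewrite -twistM /fvn; case: (insub i./2 : option 'I_m) => [j|]; rewrite ?fva ?mulr0.
  case: ifP => _; last exact: Fa.
  by rewrite -twistM /Fn; case: (insub _ : option 'I_d) => [j|]; rewrite ?Fa ?mulr0.
move=> x px.
have [[j fj]|nf] := pselect (exists j, fv j x <> 0).
  have [g hg] := sector_cover p_pr p_odd om_prim (introN eqP fj).
  have fvj : fvn j x = fv j x by rewrite /fvn insubT //= => jm; congr (fv _ x); apply: val_inj.
  have jm := ltn_ord j.
  case: hg => sg; [exists (j : nat).*2 | exists (j : nat).*2.+1]; exists g.
    have jm2 : (j.*2 < m.*2)%N by rewrite ltn_double.
    split; first by apply: ltn_trans jm2 _; rewrite ltnS leq_double.
    by rewrite /psi jm2 odd_double doubleK fvj.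
  have jm2 : (j.*2.+1 < m.*2)%N by rewrite ltn_Sdouble.
  split; first by apply: ltn_trans jm2 _; rewrite ltnS leq_double.
  by rewrite /psi jm2 /= odd_double uphalf_double fvj.
have Zx : zero_set x by split=> // j; apply: contrapT => fj; apply: nf; exists j.
have [[j Fj]|nF] := pselect (exists j, F (Some j) x <> 0).
  have [g hg] := sector_cover p_pr p_odd om_prim (introN eqP Fj).
  have Fnj : Fn j x = F (Some j) x by rewrite /Fn insubT //= => jm; congr (F (Some _) x); apply: val_inj.
  have jd := ltn_ord j.
  case: hg => sg; [exists (m.*2 + (j : nat).*2)%N | exists (m.*2 + (j : nat).*2.+1)%N]; exists g.
    have jd2 : (j.*2 < d.*2)%N by rewrite ltn_double.
    split; first by move: jd2; rewrite /d; lia.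
    by rewrite /psi ltnNge leq_addr /= addKn jd2 odd_double doubleK Fnj.
  have jd2 : (j.*2.+1 < d.*2)%N by rewrite ltn_Sdouble.
  split; first by move: jd2; rewrite /d; lia.
  by rewrite /psi ltnNge leq_addr /= addKn jd2 /= odd_double uphalf_double Fnj.
exists (m.*2 + d.*2)%N.
have psiN : psi (m.*2 + d.*2)%N x = F None x by rewrite /psi ltnNge leq_addr /= addKn ltnn.
rewrite psiN; apply: contrapT => ns.
(* Without a sector the last function is at a tie, and all 2d + 1 real conditions of [proj] hold at
   the point x of Z. *)
have [g sg|g [h [gh tg]]] := @tie R p om (F None x).
  by apply: ns; exists g; split=> //; rewrite /d; lia.
have ccs : omx om g - omx om h \in cs by apply/mapP; exists (g, h); rewrite // mem_filter /= gh mem_enum.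
case/eqP: (Fne x _ Zx ccs); apply: proj_eq0 => // j.
by apply: contrapT => Fj; apply: nF; exists j.
Qed.

End ZeroSetDimension.

(** * Dense cyclic subgroups of the torus *)

Lemma cont_eps (R : realType) (f : R -> R) (x e : R) : continuous f -> 0 < e ->
  exists2 d : R, 0 < d & forall y, `|x - y| < d -> `|f x - f y| < e.
Proof.
move=> cf e0; have /cvgrPdist_lt/(_ e e0) := cf x.
by move=> /(@nbhs_ballP _ R^o x)[d /= d0 hd]; exists d.
Qed.

Section Circle.
Variable R : realType.
Local Notation C := (CC R).

Definition turn (x : R) : C := cos (x * (pi *+ 2)) +i* sin (x * (pi *+ 2)).

Lemma turnD x y : turn (x + y) = turn x * turn y.
Proof. by rewrite /turn mulrDl cosD sinD; simpc; congr (_ +i* _); rewrite addrC. Qed.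

Lemma turn0 : turn 0 = 1.
Proof. by rewrite /turn mul0r cos0 sin0. Qed.

Lemma turn_nat k : turn k%:R = 1.
Proof.
elim: k => [|k IH]; first exact: turn0.
rewrite -natr1 turnD IH mul1r /turn mul1r cos2pi -[pi *+ 2]add0r sinD2pi sin0.
by [].
Qed.

Lemma cabs_turn x : cabs (turn x) = 1.
Proof. by rewrite /cabs /= cos2Dsin2 sqrtr1. Qed.

Lemma turn_natM x k : turn (x *+ k) = turn x ^+ k.
Proof. by elim: k => [|k IH]; rewrite ?turn0 ?expr0 // mulrS turnD IH exprS. Qed.

Lemma turn_near1 (e : R) : 0 < e -> exists2 d : R, 0 < d & forall x, `|x| < d -> cabs (turn x - 1) < e.
Proof.
move=> e0; have e20 : 0 < e / 2 by rewrite divr_gt0.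
have cm : continuous (fun x : R => x * (pi *+ 2)).
  by move=> x; apply: cvgM; [exact: cvg_id | exact: cvg_cst].
have cc : continuous (fun x : R => cos (x * (pi *+ 2))).
  by move=> x; apply: continuous_comp; [exact: cm | exact: continuous_cos].
have cs : continuous (fun x : R => sin (x * (pi *+ 2))).
  by move=> x; apply: continuous_comp; [exact: cm | exact: continuous_sin].
have [d1 d10 h1] := cont_eps 0 cc e20; have [d2 d20 h2] := cont_eps 0 cs e20.
exists (Num.min d1 d2); first by rewrite lt_min d10.
move=> x; rewrite lt_min => /andP[x1 x2].
have := h1 x; have := h2 x; rewrite !sub0r !normrN mul0r cos0 sin0.
move=> /(_ x2) g2 /(_ x1) g1.
apply: le_lt_trans (cabs_le _) _; rewrite [e]splitr; apply: ltrD.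
  by rewrite raddfB /= distrC.
by rewrite raddfB /= subr0; move: g2; rewrite sub0r normrN.
Qed.

Lemma turn_surj (z : C) : cabs z = 1 -> exists2 x, 0 <= x <= 1 & turn x = z.
Proof.
case: z => a b; rewrite /cabs /= => ab; have {ab} ab : a ^+ 2 + b ^+ 2 = 1.
  have h : 0 <= a ^+ 2 + b ^+ 2 by rewrite addr_ge0 ?sqr_ge0.
  by rewrite -(sqr_sqrtr h) ab expr1n.
have a1 : -1 <= a <= 1.
  have : a ^+ 2 <= 1 by rewrite -ab lerDl sqr_ge0.
  by move=> a2; rewrite -ler_norml -sqrtr_sqr -(@sqrtr1 R) ler_wsqrtr.
have p0 : 0 < pi :> R := pi_gt0 R; have pp : 0 < pi *+ 2 :> R by rewrite pmulrn_lgt0.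
have sa : sin (acos a) = `|b|.
  by rewrite sin_acos // -ab addrAC subrr add0r sqrtr_sqr.
have ca : cos (acos a) = a by apply: acosK; rewrite in_itv.
have g0 := acos_ge0 a1; have gp := acos_lepi a1.
have p2 : pi <= pi *+ 2 :> R by rewrite mulr2n lerDl ltW.
case: (lerP 0 b) => b0.
  exists (acos a / (pi *+ 2)).
    by rewrite divr_ge0 ?(ltW pp) //= ler_pdivrMr // mul1r (le_trans gp).
  by rewrite /turn divfK ?gt_eqF // ca sa ger0_norm.
exists ((pi *+ 2 - acos a) / (pi *+ 2)).
  rewrite divr_ge0 ?(ltW pp) ?subr_ge0 ?(le_trans gp) //=.
  by rewrite ler_pdivrMr // mul1r lerBlDr lerDl.
rewrite /turn divfK ?gt_eqF // addrC cosD2pi sinD2pi cosN sinN ca sa ltr0_norm //.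
by rewrite opprK.
Qed.

(* [digits r xs] is a real number s for which the successive multiples
   s, r s, r^2 s, ... approximate, modulo 1, the entries of xs. *)
Fixpoint digits (r : nat) (xs : seq R) : R :=
  if xs is x :: xs' then ((Num.truncn (r%:R * x))%:R + digits r xs') / r%:R else 0.

Lemma digits_range r xs : (1 < r)%N -> {in xs, forall x, 0 <= x <= 1} -> 0 <= digits r xs <= 2.
Proof.
move=> r1; have r0 : 0 < r%:R :> R by rewrite ltr0n ltnW.
elim: xs => [|x xs IH] h /=; first by rewrite lexx ler0n.
have /andP[d0 d2] : 0 <= digits r xs <= 2 by apply: IH => y yx; apply: h; rewrite inE yx orbT.
have /andP[x0 x1] := h x (mem_head _ _).
have rx : 0 <= r%:R * x by rewrite mulr_ge0 // ltW.
rewrite divr_ge0 ?addr_ge0 ?ler0n //= ler_pdivrMr //.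
have /andP[t0 _] := truncn_itv rx.
have r2 : 2 <= r%:R :> R by rewrite ler_nat.
have : r%:R * x <= r%:R by rewrite -[leRHS]mulr1 ler_wpM2l // ltW.
lra.
Qed.

(** Multiplication by r^i turns the first i digits into integers, which z absorbs. What remains,
    divided by r, is a truncation error in (-1, 0] plus a tail in [0, 2]. *)
Lemma digits_spec r xs i : (1 < r)%N -> {in xs, forall x, 0 <= x <= 1} -> (i < size xs)%N ->
  exists z : nat, `|digits r xs * r%:R ^+ i - z%:R - nth 0 xs i| <= 2 / r%:R.
Proof.
move=> r1; have r0 : 0 < r%:R :> R by rewrite ltr0n ltnW.
elim: xs i => // x xs IH i h; have hxs : {in xs, forall x, 0 <= x <= 1}.
  by move=> y yx; apply: h; rewrite inE yx orbT.
case: i => [|i] /= ixs.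
  exists 0%N; rewrite expr0 mulr1 subr0; have /andP[d0 d2] := digits_range r1 hxs.
  have /andP[x0 x1] := h x (mem_head _ _).
  have rx : 0 <= r%:R * x by rewrite mulr_ge0 // ltW.
  have /andP[t0 t1] := truncn_itv rx; rewrite -natr1 in t1.
  set u := (Num.truncn _)%:R in t0 t1 *.
  have -> : (u + digits r xs) / r%:R - x = (u + digits r xs - r%:R * x) / r%:R.
    by rewrite mulrBl [r%:R * x]mulrC mulfK ?gt_eqF.
  have ri : 0 <= r%:R^-1 :> R by rewrite invr_ge0 ltW.
  rewrite normrM [X in _ * X]ger0_norm //; apply: ler_wpM2r => //.
  rewrite ler_norml; apply/andP; split; lra.
have [z hz] := IH i hxs ixs; exists (Num.truncn (r%:R * x) * r ^ i + z)%N.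
rewrite exprS mulrA divfK ?gt_eqF // natrD natrM natrX mulrDl.
move: (_ ^+ i) (digits r xs) hz => u D; congr (`|_| <= _); ring.
Qed.

End Circle.

Lemma quarter_bound (R : realFieldType) (del a L : R) : 0 < del ->
  del <= del / 4 + (a + L * a) -> (L + 1) * a < del / 4 -> False.
Proof. by rewrite mulrDl mul1r; lra. Qed.

Section CyclicSubgroup.
Variables (R : realType) (l : nat).
Local Notation C := (CC R).

Definition generator_pow (r p k : nat) : 'rV[C]_l := \row_j turn (r%:R ^+ j / p%:R) ^+ k.

Lemma generator_pow_torus r p k : torus (generator_pow r p k).
Proof. by move=> j; rewrite mxE normrX normC_cabs cabs_turn expr1n. Qed.

(* The angle of a power k of the generator is k r^j / p in the coordinate j; a target
   torus element is encoded in base r as a number s, and k is close to p s. *)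
Lemma cyclic_dense (e : R) : 0 < e -> exists r0, forall r p, (r0 <= r)%N -> (r ^ l <= p)%N -> (0 < p)%N ->
  forall t : 'rV[C]_l, torus t -> exists k, forall j, cabs (t ord0 j - generator_pow r p k ord0 j) < e.
Proof.
move=> e0; have [d d0 hd] := turn_near1 e0.
(* The error in each angle is at most 3 / r: 2 / r from [digits_spec], and r^j / p <= 1 / r from
   rounding p s to an integer, as j < l and r^l <= p. *)
exists (maxn 2 (Num.bound (3 / d))) => r p; rewrite geq_max => /andP[r2 rd] rp p0 t tt.
have r0 : 0 < r%:R :> R by rewrite ltr0n ltnW.
have pR : 0 < p%:R :> R by rewrite ltr0n.
have rd' : 3 / r%:R < d.
  rewrite ltr_pdivrMr // mulrC -ltr_pdivrMr //.
  have h : 0 <= 3 / d by rewrite divr_ge0 // ltW.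
  by apply: lt_le_trans (archi_boundP h) _; rewrite ler_nat.
have ex j : exists y, 0 <= y <= 1 /\ turn y = t ord0 j.
  have [|y y01 ty] := @turn_surj R (t ord0 j); last by exists y.
  by apply: complexI; rewrite -normC_cabs tt.
have [x hx] := choice ex.
pose xs := [seq x j | j <- enum 'I_l].
have xs01 : {in xs, forall y, 0 <= y <= 1} by move=> _ /mapP[j _ ->]; have [] := hx j.
pose s := digits r xs; have /andP[s0 _] := digits_range r2 xs01.
have ps : 0 <= p%:R * s by rewrite mulr_ge0 // ltW.
have /andP[k0 k1] := truncn_itv ps; rewrite -natr1 in k1; set k := Num.truncn _ in k0 k1.
exists k => j.
have jxs : (j < size xs)%N by rewrite size_map size_enum_ord.
have [z hz] := digits_spec r2 xs01 jxs.
have xj : nth 0 xs j = x j.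
  by rewrite (nth_map j) ?size_enum_ord // nth_ord_enum.
rewrite xj -/s in hz; set rj := r%:R ^+ j in hz.
pose y := k%:R * (rj / p%:R) - z%:R - x j.
have ty : generator_pow r p k ord0 j = turn y * t ord0 j.
  rewrite mxE -/rj -turn_natM -(mulr_natl (rj / p%:R) k) -(hx j).2 -turnD.
  have -> : turn (y + x j) = turn (y + x j + z%:R) by rewrite [RHS]turnD turn_nat mulr1.
  by congr turn; rewrite /y; ring.
have rj0 : 0 < rj by rewrite exprn_gt0.
have rjp : rj / p%:R <= 1 / r%:R.
  rewrite ler_pdivrMr // mulrAC ler_pdivlMr // mul1r -exprSr -natrX ler_nat.
  by apply: leq_trans rp; rewrite leq_exp2l.
have yd : `|y| <= 3 / r%:R.
  have -> : y = (s * rj - z%:R - x j) - (p%:R * s - k%:R) * (rj / p%:R).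
    rewrite /y; field; exact: lt0r_neq0.
  apply: le_trans (ler_normB _ _) _; have -> : 3 / r%:R = 2 / r%:R + 1 / r%:R :> R by rewrite -mulrDl; congr (_ / _); ring.
  apply: lerD => //; rewrite ger0_norm; last by rewrite mulr_ge0 ?subr_ge0 // divr_ge0 // ltW.
  apply: le_trans rjp; rewrite ler_piMl //; first by rewrite divr_ge0 // ltW.
  lra.
have tj1 : cabs (t ord0 j) = 1 by apply: complexI; rewrite -normC_cabs tt.
rewrite ty -{1}[t ord0 j]mul1r -mulrBl cabsM tj1 mulr1 cabsB; apply: hd.
exact: le_lt_trans rd'.
Qed.

Variables (n : nat) (rho : 'rV[C]_l -> 'M[C]_n).
Hypothesis rep : torus_rep rho.
Local Notation E := 'cV[C]_n.
Local Notation nr := (@colnorm R n 1%:M).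

Lemma generator_pow_iter r p k (x : E) :
  rho (generator_pow r p k) *m x = iter k (mulmx (rho (generator_pow r p 1))) x.
Proof.
have [rho1 rhoM _] := rep; elim: k => [|k IH] /=.
  rewrite (_ : generator_pow r p 0 = const_mx 1) ?rho1 ?mul1mx //.
  by apply/rowP => j; rewrite !mxE expr0.
rewrite -IH mulmxA -rhoM; try exact: generator_pow_torus.
by congr (rho _ *m x); apply/rowP => j; rewrite !mxE expr1 exprS.
Qed.

Lemma generator_order r p (x : E) : (0 < p)%N ->
  iter p (mulmx (rho (generator_pow r p 1))) x = x.
Proof.
move=> p0; rewrite -generator_pow_iter; have [rho1 _ _] := rep.
rewrite (_ : generator_pow r p p = const_mx 1) ?rho1 ?mul1mx //.
apply/rowP => j; rewrite !mxE -turn_natM -(mulr_natr (r%:R ^+ j / p%:R) p).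
by rewrite divfK ?pnatr_eq0 -?lt0n // -natrX turn_nat.
Qed.

Lemma rep_near (t : 'rV[C]_l) (e : R) : torus t -> 0 < e -> exists2 d : R, 0 < d &
  forall t', torus t' -> (forall j, cabs (t ord0 j - t' ord0 j) < d) ->
  forall i j, cabs (rho t i j - rho t' i j) < e.
Proof.
move=> tt e0; have [_ _ /subspace_continuousP/(_ t tt) ct] := rep.
have /ct : nbhs (rho t) [set M | forall i j, cabs (rho t i j - M i j) < e].
  exists (fun i j => [set w | cabs (rho t i j - w) < e]) => // i j.
  by apply/nbhs_C; exists e.
case=> P tP PA.
have h j := (nbhs_C (t ord0 j) (P ord0 j)).1 (tP ord0 j).
have [d hd] := choice (fun j => let: ex_intro2 d d0 hd := h j in ex_intro _ d (conj d0 hd)).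
exists (\big[Order.min/1]_j d j).
  by apply/bigmin_gtP; split=> // j _; have [] := hd j.
move=> t' tt' tn; apply: (PA t') => // i j; rewrite ord1; apply: (hd j).2.
by apply: lt_le_trans (tn j) _; apply: bigmin_le.
Qed.

Lemma colnorm_small (M : 'M[C]_n) (e : R) (x : E) : (forall i j, cabs (M i j) <= e) ->
  nr (M *m x) <= n%:R * (e * nr x).
Proof.
move=> Me; rewrite /colnorm -[n in n%:R]card_ord mulr_natl -sumr_const.
apply: ler_sum => i _; rewrite mul1mx mxE mulr_sumr; apply: le_trans (cabs_sum _ _) _.
apply: ler_sum => j _; rewrite mul1mx cabsM; apply: ler_wpM2r => //; exact: cabs_ge0.
Qed.

(** If rho t' fixed x, then rho t v - v would be the sum of (rho t - rho t') x, x - v and - rho t (x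
    - v), whose norms total less than half of [del]. *)
Lemma moved_near (v : E) (t : 'rV[C]_l) : torus t -> rho t *m v != v ->
  exists2 d : R, 0 < d & forall (x : E) t', nr x = 1 -> nr (x - v) < d -> torus t' ->
    (forall j, cabs (t ord0 j - t' ord0 j) < d) -> rho t' *m x != x.
Proof.
move=> tt vt; have del0 : 0 < nr (rho t *m v - v) by apply: colnorm_gt0; rewrite ?unitmx1 ?subr_eq0.
set del := nr _ in del0; have [L L0 hL] := colnorm_le 1%:M (rho t).
pose e := del / 4 / n.+1%:R; have e0 : 0 < e by rewrite !divr_gt0 // ltr0n.
have [d1 d10 h1] := rep_near tt e0.
exists (Num.min d1 (del / 4 / (L + 1))).
  by rewrite lt_min d10 !divr_gt0 // addr_gt0.
move=> x t' x1; rewrite lt_min => /andP[_ xv] tt' tn; apply/eqP => fx.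
have hM : nr ((rho t - rho t') *m x) <= del / 4.
  apply: le_trans (colnorm_small (e := e) _ _) _.
    move=> i j; rewrite !mxE; apply/ltW/h1 => // j'.
    by apply: lt_le_trans (tn j') _; rewrite ge_min lexx.
  rewrite x1 mulr1 /e mulrCA ler_piMr //; first by rewrite ltW // divr_gt0.
  by rewrite ler_pdivrMr ?ltr0n // mul1r ler_nat.
have xv' : (L + 1) * nr (x - v) < del / 4.
  by rewrite mulrC -ltr_pdivlMr // addr_gt0.
have hD : del <= nr ((rho t - rho t') *m x) + (nr (x - v) + nr (rho t *m (x - v))).
  rewrite /del; have -> : rho t *m v - v = (rho t - rho t') *m x + ((x - v) - rho t *m (x - v)).
    by rewrite mulmxBl fx mulmxBr opprB addrA subrKA [RHS]addrC subrKA.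
  apply: le_trans (colnormD _ _ _) _; rewrite lerD2l.
  by apply: le_trans (colnormD _ _ _) _; rewrite colnormN.
have hD' : del <= del / 4 + (nr (x - v) + L * nr (x - v)).
  by apply: le_trans hD _; apply: lerD => //; rewrite lerD2l; exact: hL.
exact: quarter_bound del0 hD' xv'.
Qed.

(** Each unit vector is moved by some torus element, with a tolerance valid nearby; compactness of
    the sphere makes the tolerance uniform. A unit vector fixed by the generator is fixed by all its
    powers, one of which approximates the element that moves it. *)
Lemma fixed_trivial : fixed_subspace rho = [set 0] ->
  exists r0, forall r p, (r0 <= r)%N -> (r ^ l <= p)%N -> (0 < p)%N ->
  forall x : E, rho (generator_pow r p 1) *m x = x -> x = 0.
Proof.
move=> fix0.
have un : (1%:M : 'M[C]_n) \in unitmx by apply: unitmx1.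
pose S := [set x : E | nr x = 1].
have cS : compact S := compact_colnorm_sphere (unitmx1 _ _).
have loc (v : E) : exists td : 'rV[C]_l * R, 0 < td.2 /\ (S v -> torus td.1 /\
   forall (x : E) t', nr x = 1 -> nr (x - v) < td.2 -> torus t' ->
    (forall j, cabs (td.1 ord0 j - t' ord0 j) < td.2) -> rho t' *m x != x).
  have [Sv|nS] := pselect (S v); last by exists (0, 1).
  have [t [tt tv]] : exists t, torus t /\ rho t *m v != v.
    apply: contrapT => nt; have : fixed_subspace rho v.
      by move=> t tt; apply/eqP; apply: contraT => h; case: nt; exists t.
    rewrite fix0 => /= v0; move: Sv; rewrite /S /= v0 colnorm0 => /eqP.
    by rewrite eq_sym oner_eq0.
  by have [d d0 hd] := moved_near tt tv; exists (t, d).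
have [td htd] := choice loc.
have [s [sS sc]] := colnorm_ball_cover un cS (fun x => (htd x).1).
have [e e0 he] := seq_lower_bound s (fun x => (htd x).1).
have [r0 hr0] := cyclic_dense e0; exists r0 => r p rr rp p0 x fx.
apply/eqP; apply: contraT => x0; have nx := colnorm_gt0 (unitmx1 _ _) x0.
pose y := ((nr x)^-1)%:C *: x.
have Sy : nr y = 1 by rewrite /y colnormZ cabs_real ger0_norm ?invr_ge0 ?ltW // mulVf ?gt_eqF.
have fy k : rho (generator_pow r p k) *m y = y.
  rewrite generator_pow_iter; elim: k => //= k ->.
  by rewrite /y -scalemxAr fx.
have [v vs yv] := sc y Sy; have [_ /(_ (sS v vs))[tt hv]] := htd v.
have [k hk] := hr0 r p rr rp p0 _ tt.
have hkj j : cabs ((td v).1 ord0 j - generator_pow r p k ord0 j) < (td v).2.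
  exact: lt_le_trans (hk j) (he v vs).
have /eqP := hv y _ Sy yv (generator_pow_torus r p k) hkj.
by case; exact: fy.
Qed.

End CyclicSubgroup.

(** * Inner products *)

Section InnerProduct.
Variables (R : realType) (n : nat).
Local Notation C := (CC R).
Local Notation E := 'cV[C]_n.
Variable dot : E -> E -> R.
Hypothesis dotP : real_inner_product dot.

Lemma inner_product_sumZ (I : Type) (s : seq I) (a : I -> R) (b : I -> E) y :
  dot (\sum_(i <- s) (a i)%:C *: b i) y = \sum_(i <- s) a i * dot (b i) y.
Proof.
have [_ dotD dotZ _] := dotP.
elim: s => [|i s IH]; last by rewrite !big_cons dotD dotZ IH.
by rewrite !big_nil -(scaler0 _ 0%:C) dotZ mul0r.
Qed.

Lemma real_basis (x : E) :
  x = \sum_(k : 'I_n * bool) (if k.2 then complex.Re (x k.1 ord0) else complex.Im (x k.1 ord0))%:C *: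
        (if k.2 then delta_mx k.1 ord0 else 'i *: delta_mx k.1 ord0).
Proof.
rewrite -(pair_big xpredT xpredT (fun j (b : bool) =>
  (if b then complex.Re (x j ord0) else complex.Im (x j ord0))%:C *:
        (if b then delta_mx j ord0 else 'i *: delta_mx j ord0 : E))) /=.
under eq_bigr do rewrite big_bool /=.
apply/colP => i; rewrite summxE (bigD1 i) //= big1 => [|j ji].
  by rewrite addr0 !mxE !eqxx !mulr1; case: (x i ord0) => u v; simpc.
by rewrite !mxE [i == j]eq_sym (negbTE ji) !mulr0 addr0.
Qed.

Lemma inner_product_continuous : continuous (fun x => dot x x).
Proof.
have [dotC _ _ _] := dotP.
pose co k (x : E) := if k.2 then complex.Re (x k.1 ord0) else complex.Im (x k.1 ord0).
pose bs k : E := if k.2 then delta_mx k.1 ord0 else 'i *: delta_mx k.1 ord0.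
have cc (k : 'I_n * bool) : continuous (co k).
  have ck := @coord_continuous C n 1 k.1 ord0; rewrite /co; case: k.2.
    exact: (cont_comp ck (@continuous_Re R)).
  exact: (cont_comp ck (@continuous_Im R)).
rewrite (_ : (fun x => _) = fun x => \sum_k co k x * \sum_h co h x * dot (bs h) (bs k)).
  apply: cont_sum => k _; apply: contM; first exact: cc.
  by apply: cont_sum => h _; apply: contM; [exact: cc | exact: cont_cst].
have expand x y : dot x y = \sum_k co k x * dot (bs k) y.
  by rewrite [x in LHS]real_basis inner_product_sumZ.
apply/funext => x; rewrite expand; apply: eq_bigr => k _; by rewrite dotC expand.
Qed.

(** This transfers the positivity of phi at infinity from the given norm to [colnorm Q], used in the
    rest of the argument. *)
Lemma inner_product_lower (Q : 'M[C]_n) : Q \in unitmx ->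
  exists2 c : R, 0 < c & forall x, c * colnorm Q x <= Num.sqrt (dot x x).
Proof.
move=> Qu; have [dotC dotD dotZ dot0] := dotP.
have [|c c0 hc] := compact_pos_min (compact_colnorm_sphere Qu) inner_product_continuous.
  move=> x /= x1; apply: dot0; apply: contra_eq_neq x1 => ->.
  by rewrite colnorm0 eq_sym oner_eq0.
exists (Num.sqrt c); first by rewrite sqrtr_gt0.
move=> x; have [->|x0] := eqVneq x 0; first by rewrite colnorm0 mulr0 sqrtr_ge0.
have nx := colnorm_gt0 Qu x0; pose y := ((colnorm Q x)^-1)%:C *: x.
have y1 : colnorm Q y = 1.
  by rewrite /y colnormZ cabs_real ger0_norm ?invr_ge0 ?ltW // mulVf ?gt_eqF.
have := hc y y1; rewrite dotZ dotC dotZ mulrA -expr2 exprVn mulrC ler_pdivlMr ?exprn_gt0 // => h.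
rewrite -[colnorm Q x](ger0_norm (ltW nx)) -sqrtr_sqr -(sqrtrM _ (ltW c0)).
exact: ler_wsqrtr.
Qed.

End InnerProduct.

Theorem proposition3p3 (R : realType) (l n m : nat)
  (rhoU : 'rV[CC R]_l -> 'M[CC R]_n) (rhoV : 'rV[CC R]_l -> 'M[CC R]_m)
  (N : 'cV[CC R]_n -> R) (phi : 'cV[CC R]_n -> R)
  (f : 'cV[CC R]_n -> 'cV[CC R]_m)
  (hl : (1 <= l)%N)
  (hU : torus_rep rhoU) (hV : torus_rep rhoV)
  (hU0 : fixed_subspace rhoU = [set 0]) (hV0 : fixed_subspace rhoV = [set 0])
  (hdim : (m < n)%N)
  (hN : euclidean_norm N) (hNinv : torus_invariant rhoU N)
  (hphi : continuous phi) (hphi_inv : torus_invariant rhoU phi)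
  (hphi0 : phi 0 < 0)
  (hphi_large : exists r : R, forall x, r < N x -> 0 < phi x)
  (hf : continuous f) (hf_eqv : torus_equivariant rhoU rhoV f) :
  covering_dim_ge
    (set_type ([set x | f x = 0] `&` [set x | phi x = 0]))
    (2 * (n - m) - 1)%N.
Proof.
case: n => [//|n] in rhoU N phi f hU hU0 hdim hN hNinv hphi hphi_inv hphi0 hphi_large hf hf_eqv *.
have [r1 fixU] := fixed_trivial hU hU0; have [r2 fixV] := fixed_trivial hV hV0.
(* The bound 2 makes p odd, and r^l makes one generator serve both U and V in [fixed_trivial]. *)
pose r := maxn r1 r2; have [p pr p_pr] := prime_above (maxn 2 (r ^ l)).
move: pr; rewrite gtn_max => /andP[p2 rp].
have p0 := prime_gt0 p_pr.
pose t : 'rV[CC R]_l := generator_pow R l r p 1.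
have tt : torus t := generator_pow_torus R r p 1.
have fixA := fixU r p (leq_maxl _ _) (ltnW rp) p0; have fixB := fixV r p (leq_maxr _ _) (ltnW rp) p0.
have ordA x := generator_order hU r x p0; have ordB x := generator_order hV r x p0.
have [om om_prim] : {om : CC R | p.-primitive_root om}.
  by apply: (@prime_unity_root R[i] p p_pr); rewrite pnatr_eq0 -lt0n.
have [Q [al [Qu QA]]] := finite_order_diagonal om_prim ordA.
have [Q' [be [Qu' QB]]] := finite_order_diagonal om_prim ordB.
have alp j := eigenvalue_order Qu QA j ordA; have al1 j := eigenvalue_neq1 Qu QA j fixA.
have bep j := eigenvalue_order Qu' QB j ordB; have be1 j := eigenvalue_neq1 Qu' QB j fixB.
have [c hc] := choice (fun j => let: ex_intro2 c c0 bc := unity_root_power p_pr om_prim (bep j) (be1 j)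
  in ex_intro (fun c => (0 < c)%N /\ be j ^+ c = om) c (conj c0 bc)).
pose fv j x : CC R := ((Q' *m f x) j ord0) ^+ c j.
have -> : [set x | f x = 0] `&` [set x | phi x = 0] = zero_set phi fv.
  apply/seteqP; split=> x /= [fx px]; split=> //.
    by move=> j; rewrite /fv fx mulmx0 mxE expr0n gtn_eqF //; have [] := hc j.
  apply: (can_inj (mulKmx Qu')); apply/colP => j; rewrite mulmx0 [RHS]mxE; apply/eqP.
  by have /eqP := px j; rewrite /fv expf_eq0 => /andP[].
have p_odd : odd p by apply: contraTT p2 => /(prime_oddPn p_pr)->.
have phia x : phi (rhoU t *m x) = phi x by exact: hphi_inv.
have ph_large : exists r, forall x, r < colnorm Q x -> 0 < phi x.
  have [s hs] := hphi_large; have [dot dotP Nd] := hN.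
  have [e e0 he] := inner_product_lower dotP Qu.
  exists (s / e) => x sx; apply: hs; rewrite Nd; apply: lt_le_trans (he x).
  by rewrite mulrC -ltr_pdivrMr.
have fvc j : continuous (fv j).
  have cj : continuous (fun x => (Q' *m f x) j ord0).
    rewrite (_ : (fun x => _) = fun x => \sum_i Q' j i * f x i ord0); last first.
      by apply/funext => x; rewrite mxE.
    apply: contC_sum => i _; apply: contCM; first exact: contC_cst.
    exact: (cont_comp hf (@coord_continuous (CC R) m 1 i ord0)).
  rewrite /fv; elim: (c j) => [|k IH].
    rewrite (_ : (fun x => _) = fun=> 1); first exact: contC_cst.
    by apply/funext => x; rewrite expr0.
  rewrite (_ : (fun x => _) = fun x => (Q' *m f x) j ord0 * (Q' *m f x) j ord0 ^+ k).
    exact: (contCM cj IH).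
  by apply/funext => x; rewrite exprS.
have fva j x : fv j (rhoU t *m x) = om * fv j x.
  by rewrite /fv (hf_eqv t x tt) QB exprMn (hc j).2.
exact: (zero_set_dim_ge p_pr p_odd om_prim Qu QA alp al1 hdim hphi phia hphi0 ph_large fvc fva).
Qed.
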